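(* Let $p\ge 0$ be an integer, let $\Omega\subset\mathbb{C}$ be a Jordan domain and let $J\subset\partial\Omega$ be a relatively open subset of $\partial\Omega$ such that for every $\alpha\in J$ there exists $\beta\in(\overline{\Omega})^c$ such that $(\alpha,\beta]\subseteq(\overline{\Omega})^c$. Then the set $$\{f\in A^p(\Omega,J): f^{(p+1)} \text{ is totally unbounded}\}$$ is dense and $G_\delta$ in $A^p(\Omega,J)$. Furthermore, the set of non-extendable functions in $A^p(\Omega,J)$ is $G_\delta$ and dense in $A^p(\Omega,J)$.
   Context: A Jordan domain is the bounded component of the complement of a Jordan curve in $\mathbb{C}$. $(\alpha,\beta]$ is the line segment from $\alpha$ to $\beta$ with $\alpha$ excluded and $\beta$ included; $(\overline\Omega)^c=\mathbb{C}\smallsetminus\overline\Omega$. $A(\Omega,J)$ is the set of functions $f$ holomorphic on $\Omega$ which extend continuously to $\Omega\cup J$. For an integer $p\ge0$, $A^p(\Omega,J)$ is the set of functions $f$ holomorphic on $\Omega$ such that for every $\ell=0,1,\dots,p$ the derivative $f^{(\ell)}$ belongs to $A(\Omega,J)$. The topology of $A^p(\Omega,J)$ is induced by the seminorms $\sup_{z\in\Delta_m}|f^{(\ell)}(z)|$, $0\le\ell\le p$, $m=1,2,\dots$ (with $f^{(\ell)}$ denoting also its continuous extension to $\Omega\cup J$), where $$\Delta_m=\Big\{z\in\Omega\cup J: \operatorname{dist}(z,\partial\Omega\smallsetminus J)\ge\tfrac1m\Big\}$$ (if $J=\partial\Omega$, then $\Delta_m=\overline\Omega$). A function $g:\Omega\to\mathbb{C}$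 is called totally unbounded (on $\Omega$) if for every open disc $B(\zeta,\varepsilon)$ with $\varepsilon>0$ and $\zeta\in\partial\Omega$ and every connected component $Y$ of $B(\zeta,\varepsilon)\cap\Omega$ the restriction $g|_Y$ is unbounded. A holomorphic function $f$ on $\Omega$ is called extendable if there exist a domain (nonempty connected open set) $U\subset\mathbb{C}$ with $\partial\Omega\cap U\neq\emptyset$ and a holomorphic function $F$ on $U$ such that $f|_Y=F|_Y$ for some connected component $Y$ of $U\cap\Omega$. Otherwise $f$ is called non-extendable. *)

(* Defs.v *)
(* MathComp-Analysis; C is R[i] over an arbitrary R : realType. *)
From HB Require Import structures.
From mathcomp Require Import all_boot all_order all_algebra.
From mathcomp Require Import complex.
From mathcomp Require Import all_classical all_reals all_analysis.
From mathcomp Require Import borel_hierarchy.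

Set Implicit Arguments.
Unset Strict Implicit.
Unset Printing Implicit Defensive.

Import Order.TTheory GRing.Theory Num.Theory.
Import numFieldTopology.Exports numFieldNormedType.Exports.

Local Open Scope classical_set_scope.
Local Open Scope ring_scope.
Local Open Scope complex_scope.

(* R[i] as a normed space over itself, so that [derivable f z 1] and [derive1n]
   are complex differentiability and the iterated complex derivative. *)
HB.instance Definition _ (R : rcfType) := GRing.ComAlgebra.copy R[i] R[i]^o.
HB.instance Definition _ (R : rcfType) := Vector.copy R[i] R[i]^o.
HB.instance Definition _ (R : rcfType) := NormedModule.copy R[i] R[i]^o.

(* The modulus as an element of R: the norm [`|z|] takes its values in R[i]. *)
Definition cabs (R : realType) (z : R[i]) : R := ComplexField.Normc.normc z.

Section PlaneSets.
Context {R : realType}.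
Implicit Types (A Y : set R[i]).

Definition frontier A : set R[i] := closure A `\` A°.

(* +oo when A is empty. *)
Definition dist (z : R[i]) A : \bar R :=
  ereal_inf [set (cabs (z - w))%:E | w in A].

Definition is_component Y A := exists2 x, A x & Y = connected_component A x.

Definition unit_circle : set R[i] := [set z | cabs z = 1].

Definition Jordan_curve A :=
  exists gamma : R[i] -> R[i],
    [/\ {within unit_circle, continuous gamma},
        {in unit_circle &, injective gamma} &
        A = gamma @` unit_circle].

Definition Jordan_domain A :=
  exists2 gamma, Jordan_curve gamma & is_component A (~` gamma) /\ bounded_set A.

Definition segment_oc (a b : R[i]) : set R[i] :=
  [set a + t%:C * (b - a) | t in [set t : R | 0 < t <= 1]].

Definition relatively_open (J A : set R[i]) :=
  exists2 V, open V & J = V `&` A.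

End PlaneSets.

Section FunctionSpaces.
Context {R : realType}.
Variables (Omega J : set R[i]) (p : nat).
Implicit Types (f g : R[i] -> R[i]).

Definition holomorphic (U : set R[i]) f := forall z, U z -> derivable f z 1.

Definition in_A f :=
  holomorphic Omega f /\
  exists g, {within Omega `|` J, continuous g} /\ {in Omega, f =1 g}.

Definition extension f (z : R[i]) : R[i] :=
  lim (f w @[w --> within Omega (nbhs z)]).

Lemma extensionE f g : J `<=` closure Omega ->
  {within Omega `|` J, continuous g} -> {in Omega, f =1 g} ->
  {in Omega `|` J, extension f =1 g}.
Proof.
move=> Jc gc fg z; rewrite inE => zJ; apply: cvg_lim.
- exact: norm_hausdorff.
- have: closure Omega z by case: zJ => [/subset_closure//|/Jc].
  by move=> cz; apply: within_nbhs_proper.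
have gz : g w @[w --> within (Omega `|` J) (nbhs z)] --> g z.
  by have := gc z; rewrite /prop_for /continuous_at /= /nbhs /= nbhs_subspace_in.
have gz' : g w @[w --> within Omega (nbhs z)] --> g z.
  by apply: cvg_trans gz; apply: cvg_app; apply: within_subset => ? ?; left.
apply: cvg_trans gz'; apply: near_eq_cvg; near=> w.
by rewrite fg// inE; near: w; exact: withinT.
Unshelve. all: by end_near. Qed.

Definition Delta (m : nat) : set R[i] :=
  [set z | (Omega `|` J) z /\ ((m%:R^-1)%:E <= dist z (frontier Omega `\` J))%E].

(* The sup is finite on A^p(Omega, J); it is 0 when Delta m is empty. *)
Definition seminorm (l m : nat) f : R :=
  sup [set cabs (extension (derive1n l f) z) | z in Delta m].

(* Functions on Omega are represented by their extension by 0 to the plane, so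
   that equality of representatives is equality on Omega. *)
Record Ap : Type := MkAp {
  Ap_fun :> R[i] -> R[i];
  Ap_holomorphic : holomorphic Omega Ap_fun;
  Ap_in_A : forall l, (l <= p)%N -> in_A (derive1n l Ap_fun);
  Ap_out : forall z, ~ Omega z -> Ap_fun z = 0
}.

HB.instance Definition _ := gen_eqMixin Ap.
HB.instance Definition _ := gen_choiceMixin Ap.

Definition seminorm_ball (f : Ap) (l m : nat) (e : R) : set Ap :=
  [set g : Ap | seminorm l m (fun z => g z - f z) < e].

Definition seminorm_balls : set (set Ap) :=
  [set B | exists (f : Ap) l m e,
    [/\ (l <= p)%N, (0 < m)%N, 0 < e & B = seminorm_ball f l m e]].

HB.instance Definition _ :=
  isSubBaseTopological.Build Ap seminorm_balls id.

End FunctionSpaces.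

Section Extendability.
Context {R : realType}.
Variable Omega : set R[i].
Implicit Types (f g : R[i] -> R[i]).

Definition totally_unbounded g :=
  forall (zeta : R[i]) (e : R) (Y : set R[i]),
    frontier Omega zeta -> 0 < e ->
    is_component Y (ball zeta e%:C `&` Omega) ->
    ~ [bounded g z | z in Y].

Definition extendable f :=
  exists (U : set R[i]) (F : R[i] -> R[i]),
    [/\ U !=set0, connected U, open U & frontier Omega `&` U !=set0] /\
    holomorphic U F /\
    exists2 Y, is_component Y (U `&` Omega) & {in Y, f =1 F}.

End Extendability.

(* Main.v *)
Require Import Defs.
From mathcomp Require Import all_boot all_order all_algebra.
From mathcomp Require Import complex finmap.
From mathcomp Require Import all_classical all_reals all_analysis.
From mathcomp Require Import borel_hierarchy.
From mathcomp Require Import ring lra zify.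

(* If f^(p+1) is totally unbounded then f is not extendable, so only the density
   of the first set is at stake.  Both sets are countable intersections of open
   sets: f^(p+1) has to exceed every bound on the component through z of each
   disc centred at a rational point z of Omega and meeting the frontier, and f is
   extendable iff [|f^(k) z| <= m * k! / r ^ k] for all k, some integer m, some
   such z and some rational r larger than the distance from z to the frontier.
   Point evaluations of derivatives are continuous on A^p by Cauchy's estimates.

   Density follows from Baire's argument, A^p being complete by Weierstrass'
   theorem, once every frontier point w has an h in A^p whose (p+1)-st derivative
   tends to infinity at w: [1 / (z - w)] if w is not in J, and otherwise
   [s ^ (2 p + 1)], where s is the principal square root of [(z - w) / (z - b)]
   and the segment from w to b lies outside the closure of Omega. *)

Set Implicit Arguments.
Unset Strict Implicit.
Unset Printing Implicit Defensive.

Import Order.TTheory GRing.Theory Num.Theory.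
Import numFieldTopology.Exports numFieldNormedType.Exports.

Local Open Scope classical_set_scope.
Local Open Scope ring_scope.
Local Open Scope complex_scope.

Local Notation Re := complex.Re.
Local Notation Im := complex.Im.

(** * Complex differentiability *)

(** All of the complex analysis is drawn from pointwise differentiability through one estimate, a
    bound for [f'] by the supremum of [|f|] on a disc. Constants worse than the classical ones do no
    harm, since only geometric growth of Taylor coefficients matters.

    The exponent [2 p + 1] makes [s ^ (2 p + 1)] behave like [(z - w) ^ (p + 1/2)]: its derivatives
    up to order p tend to 0 at w, while the next one grows like [(z - w) ^ (-1/2)], parity keeping
    its leading coefficient from vanishing. The segment makes the root single-valued, because
    [(z - w) / (z - b)] is a nonpositive real only there.

    Such an h gives density by perturbation: if [f^(p+1)] is bounded on a component whose closure
    contains w, that of [f + c h] is unbounded there for every [c > 0]. That every component in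
    question does reach the frontier inside its disc or domain is a connectedness argument, and the
    same argument shows that an extendable f has [f^(p+1)] bounded on some component near a frontier
    point. *)

Section Modulus.
Context {R : realType}.
Implicit Types (x y z w : R[i]) (r e : R).

Lemma norm_cabs z : `|z| = (cabs z)%:C.
Proof. by []. Qed.

Lemma cabs_ge0 z : 0 <= cabs z.
Proof. by case: z => a b; apply: sqrtr_ge0. Qed.

Lemma cabs0 : cabs (0 : R[i]) = 0.
Proof. exact: ComplexField.Normc.normc0. Qed.

Lemma cabs1 : cabs (1 : R[i]) = 1.
Proof. exact: ComplexField.Normc.normc1. Qed.

Lemma cabs_eq0 z : (cabs z == 0) = (z == 0).
Proof.
apply/idP/idP=> [/eqP h|/eqP ->]; last by rewrite cabs0.
by apply/eqP/ComplexField.Normc.eq0_normc.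
Qed.

Lemma cabs_gt0 z : (0 < cabs z) = (z != 0).
Proof. by rewrite lt_def cabs_ge0 andbT cabs_eq0. Qed.

Lemma cabsM z w : cabs (z * w) = cabs z * cabs w.
Proof. exact: ComplexField.Normc.normcM. Qed.

Lemma cabsV z : cabs z^-1 = (cabs z)^-1.
Proof. exact: ComplexField.Normc.normcV. Qed.

Lemma cabsN z : cabs (- z) = cabs z.
Proof. by apply: complexI; rewrite -!norm_cabs normrN. Qed.

Lemma cabsX z n : cabs (z ^+ n) = cabs z ^+ n.
Proof. by elim: n => [|n ih]; rewrite ?expr0 ?cabs1// !exprS cabsM ih. Qed.

Lemma cabsC z w : cabs (z - w) = cabs (w - z).
Proof. by rewrite -cabsN opprB. Qed.

Lemma cabs_real r : cabs r%:C = `|r|.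
Proof. by rewrite /cabs /= expr0n /= addr0 sqrtr_sqr. Qed.

Lemma cabs_nat n : cabs (n%:R : R[i]) = n%:R.
Proof. by rewrite -(rmorph_nat (real_complex R)) cabs_real ger0_norm. Qed.

Lemma cabs_i : cabs ('i : R[i]) = 1.
Proof. by rewrite /cabs /= expr0n /= add0r expr1n sqrtr1. Qed.

Lemma cabsD z w : cabs (z + w) <= cabs z + cabs w.
Proof. exact: le_normcD. Qed.

Lemma cabsB z w : cabs (z - w) <= cabs z + cabs w.
Proof. by rewrite -(cabsN w) cabsD. Qed.

Lemma cabs_dist y x z : cabs (x - z) <= cabs (x - y) + cabs (y - z).
Proof. by have := cabsD (x - y) (y - z); rewrite addrA subrK. Qed.

Lemma cabs_subD z w : cabs z <= cabs (z - w) + cabs w.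
Proof. by have := cabsD (z - w) w; rewrite subrK. Qed.

Lemma cabs_sum (I : Type) (s : seq I) (P : pred I) (F : I -> R[i]) :
  cabs (\sum_(i <- s | P i) F i) <= \sum_(i <- s | P i) cabs (F i).
Proof.
elim/big_ind2: _ => [|x a y b ha hb|//]; first by rewrite cabs0.
by apply: le_trans (cabsD _ _) _; apply: lerD.
Qed.

Lemma Re_le_cabs z : `|Re z| <= cabs z.
Proof. by rewrite -lecR -norm_cabs normc_ge_Re. Qed.

Lemma cabs_le_ReIm z : cabs z <= `|Re z| + `|Im z|.
Proof.
rewrite {1}[z]complexE; apply: le_trans (cabsD _ _) _.
by rewrite cabsM cabs_i !cabs_real mul1r.
Qed.

Lemma Im_le_cabs z : `|Im z| <= cabs z.
Proof.
rewrite -[leRHS]mul1r -cabs_i mulrC -cabsM.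
by apply: le_trans (Re_le_cabs _); rewrite ReiNIm normrN.
Qed.

Lemma le0_cabs_eq z : (forall e, 0 < e -> cabs z <= e) -> z = 0.
Proof.
move=> h; apply/eqP; rewrite -cabs_eq0 eq_le cabs_ge0 andbT.
by apply/ler_addgt0Pr => e /h; rewrite add0r.
Qed.

End Modulus.

(** * Discs and complex differentiability in epsilon-delta form *)

Section EpsDelta.
Context {R : realType}.
Implicit Types (A : set R[i]) (f g : R[i] -> R[i]) (x y z w d : R[i]) (r e : R).

Definition disc z r : set R[i] := [set w | cabs (w - z) < r].

Lemma disc_center z r : 0 < r -> disc z r z.
Proof. by rewrite /disc /= subrr cabs0. Qed.

Lemma ball_disc z r : ball z r%:C = disc z r.
Proof.
apply/seteqP; split => w; rewrite /disc -ball_normE /ball_ /= norm_cabs ltcR;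
  by rewrite cabsC.
Qed.

Lemma nbhs_disc z A : nbhs z A <-> exists2 r : R, 0 < r & disc z r `<=` A.
Proof.
split.
  move/nbhs_ballP => -[[e e'] /=]; rewrite ltcE /= => /andP[/eqP -> e0] h.
  by exists e => //; rewrite -ball_disc.
case=> r r0 h; apply/nbhs_ballP; exists r%:C; rewrite /= ?ltcR //.
by rewrite ball_disc.
Qed.

Lemma open_disc A :
  open A <-> forall z, A z -> exists2 r : R, 0 < r & disc z r `<=` A.
Proof.
rewrite openE; split=> h z /h /nbhs_disc //.
Qed.

Lemma disc_open z r : open (disc z r).
Proof.
apply/open_disc => w wz; exists (r - cabs (w - z)); first by rewrite subr_gt0.
move=> u; rewrite /disc /= ltrBrDr; apply: le_lt_trans.
exact: cabs_dist.
Qed.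

Lemma closure_disc A z :
  closure A z <-> forall r, 0 < r -> exists2 w, A w & cabs (w - z) < r.
Proof.
split=> [h r r0|h B /nbhs_disc[r r0 rB]].
  have [|w [Aw wz]] := h (disc z r); first by apply/nbhs_disc; exists r.
  by exists w.
by have [w Aw /rB Bw] := h _ r0; exists w.
Qed.

Lemma frontier_open A z : open A ->
  frontier A z <-> ~ A z /\ closure A z.
Proof. by rewrite interior_id /frontier /setD /= => ->; tauto. Qed.

(** Complex differentiability without a quotient: the centre needs no separate case and remainders
    add up, so the rules of calculus become norm estimates. *)
Definition isd f z d := forall e, 0 < e ->
  exists2 r : R, 0 < r &
    forall w, cabs (w - z) < r -> cabs (f w - f z - d * (w - z)) <= e * cabs (w - z).

Lemma isdP f z d : isd f z d <-> derivable f z 1 /\ derive1 f z = d.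
Proof.
pose q (h : R[i]) := h^-1 *: (f (h *: 1 + z) - f z).
have qd : isd f z d <-> q h @[h --> 0^'] --> d.
  split=> [h|/cvgrPdist_le h e e0].
    apply/cvgrPdist_le => -[e e'] /=; rewrite ltcE /= => /andP[/eqP -> e0].
    have [r r0 hr] := h _ e0.
    apply/nbhs_disc; exists r => // t; rewrite /disc /= subr0 => tr t0.
    rewrite norm_cabs lecR -(ler_pM2r (x := cabs t)) ?cabs_gt0 // -cabsM.
    have := hr (t + z); rewrite addrK => /(_ tr); congr (_ <= _).
    rewrite -[LHS]cabsN; congr cabs; rewrite /q /GRing.scale /= mulr1.
    by field.
  have := h e%:C; rewrite ltcR => /(_ e0) /nbhs_disc[r r0 hr].
  exists r => // w wr; have [->|wz] := eqVneq w z.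
    by rewrite !subrr mulr0 subr0 cabs0 mulr0.
  have := hr (w - z); rewrite /disc /= subr0 => /(_ wr).
  rewrite subr_eq0 => /(_ wz); rewrite norm_cabs lecR.
  have c0 : 0 < cabs (w - z) by rewrite cabs_gt0 subr_eq0.
  rewrite -(ler_pM2r c0) -cabsM; congr (_ <= _).
  rewrite -[LHS]cabsN; congr cabs; rewrite /q /GRing.scale /= mulr1 subrK.
  by field; rewrite subr_eq0.
rewrite qd derive1E /derivable /derive; split=> [h|[h <-]]; last exact: h.
by split; [apply/cvg_ex; exists d | apply: cvg_lim].
Qed.

Lemma isd_derive f z d : isd f z d -> derive1 f z = d.
Proof. by move/isdP => []. Qed.

Lemma derivable_isd f z : derivable f z 1 <-> isd f z (derive1 f z).
Proof. by rewrite isdP; split=> [//|[]]. Qed.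

End EpsDelta.

Arguments disc_open {R} z r _ _.

(** * Rules of differentiation *)

Section DerivativeRules.
Context {R : realType}.
Implicit Types (f g : R[i] -> R[i]) (x y z w c d : R[i]) (r e : R).

Lemma isd_lip f z d : isd f z d -> exists2 r : R, 0 < r &
  forall w, cabs (w - z) < r -> cabs (f w - f z) <= (cabs d + 1) * cabs (w - z).
Proof.
move=> /(_ 1 ltr01)[r r0 h]; exists r => // w /h.
have := cabsD (f w - f z - d * (w - z)) (d * (w - z)).
by rewrite subrK cabsM mulrDl; lra.
Qed.

Lemma isd_cts f z d : isd f z d -> forall e, 0 < e -> exists2 r : R, 0 < r &
  forall w, cabs (w - z) < r -> cabs (f w - f z) <= e.
Proof.
move=> /isd_lip[r r0 h] e e0.
have c1 : 0 < cabs d + 1 by have := cabs_ge0 d; lra.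
exists (Num.min r (e / (cabs d + 1))); first by rewrite lt_min r0 divr_gt0.
move=> w; rewrite lt_min => /andP[/h hw]; rewrite ltr_pdivlMr // => /ltW.
by rewrite mulrC; apply: le_trans.
Qed.

Lemma isd_near f g z d r : 0 < r ->
  (forall w, cabs (w - z) < r -> f w = g w) -> isd f z d -> isd g z d.
Proof.
move=> r0 fg h e /h[r' r'0 hr]; exists (Num.min r r').
  by rewrite lt_min r0.
move=> w; rewrite lt_min => /andP[wr wr'].
by rewrite -!fg ?subrr ?cabs0 //; apply: hr.
Qed.

Lemma isd_cst c z : isd (fun=> c) z 0.
Proof.
move=> e e0; exists 1 => // w _.
by rewrite mul0r !subrr cabs0 mulr_ge0 ?cabs_ge0 ?ltW.
Qed.

Lemma isd_id z : isd id z 1.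
Proof.
move=> e e0; exists 1 => // w _.
by rewrite mul1r subrr cabs0 mulr_ge0 ?cabs_ge0 ?ltW.
Qed.

Lemma isdD f g z d d' : isd f z d -> isd g z d' ->
  isd (fun w => f w + g w) z (d + d').
Proof.
move=> hf hg e e0.
have e20 : 0 < e / 2 by rewrite divr_gt0.
have [r r0 hr] := hf _ e20; have [r' r'0 hr'] := hg _ e20.
exists (Num.min r r'); first by rewrite lt_min r0.
move=> w; rewrite lt_min => /andP[/hr h /hr' h'].
have -> : f w + g w - (f z + g z) - (d + d') * (w - z) =
  (f w - f z - d * (w - z)) + (g w - g z - d' * (w - z)) by ring.
by apply: le_trans (cabsD _ _) _; lra.
Qed.

Lemma isdZ c f z d : isd f z d -> isd (fun w => c * f w) z (c * d).
Proof.
move=> hf e e0.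
have c1 : 0 < cabs c + 1 by have := cabs_ge0 c; lra.
have [|r r0 hr] := hf (e / (cabs c + 1)); first by rewrite divr_gt0.
exists r => // w /hr h.
have -> : c * f w - c * f z - c * d * (w - z) = c * (f w - f z - d * (w - z)).
  by ring.
rewrite cabsM; apply: (@le_trans _ _ ((cabs c + 1) * (e / (cabs c + 1) * cabs (w - z)))).
  by apply: ler_pM; rewrite ?cabs_ge0 //; lra.
by rewrite mulrA (mulrC _ (e / _)) divfK ?gt_eqF.
Qed.

Lemma isdN f z d : isd f z d -> isd (fun w => - f w) z (- d).
Proof.
move=> /(isdZ (-1)); rewrite mulN1r; apply: (isd_near ltr01) => w _.
by rewrite mulN1r.
Qed.

Lemma isdB f g z d d' : isd f z d -> isd g z d' ->
  isd (fun w => f w - g w) z (d - d').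
Proof. by move=> hf /isdN; apply: isdD. Qed.

Lemma isd_comp f g z d d' : isd f z d -> isd g (f z) d' ->
  isd (fun w => g (f w)) z (d' * d).
Proof.
move=> hf hg e e0.
have [r0 r00 hr0] := isd_lip hf.
have c1 : 0 < cabs d + 1 by have := cabs_ge0 d; lra.
have c1' : 0 < cabs d' + 1 by have := cabs_ge0 d'; lra.
(* The remainder of [g], taken at [f w - f z], costs a factor [cabs d + 1]; that of [f] gets
   multiplied by [d']. *)
pose e1 := e / 2 / (cabs d + 1); pose e2 := e / 2 / (cabs d' + 1).
have e10 : 0 < e1 by rewrite !divr_gt0.
have e20 : 0 < e2 by rewrite !divr_gt0.
have [r1 r10 hr1] := hg _ e10; have [r2 r20 hr2] := hf _ e20.
exists (Num.min (Num.min r0 r2) (r1 / (cabs d + 1))).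
  by rewrite !lt_min r00 r20 divr_gt0.
move=> w; rewrite !lt_min ltr_pdivlMr // => /andP[/andP[wr0 wr2] wr1].
have l := hr0 _ wr0.
have /hr1 h1 : cabs (f w - f z) < r1.
  by apply: le_lt_trans l _; rewrite mulrC.
have h2 := hr2 _ wr2.
have -> : g (f w) - g (f z) - d' * d * (w - z) =
  (g (f w) - g (f z) - d' * (f w - f z)) + d' * (f w - f z - d * (w - z)) by ring.
apply: le_trans (cabsD _ _) _.
have -> : e = e1 * (cabs d + 1) + (cabs d' + 1) * e2.
  by rewrite /e1 /e2; field; rewrite !gt_eqF.
rewrite mulrDl; apply: lerD.
  by apply: le_trans h1 _; rewrite -mulrA ler_pM2l.
rewrite cabsM -mulrA; apply: ler_pM; rewrite ?cabs_ge0 //; lra.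
Qed.

Lemma isd_sqr z : isd (fun w => w ^+ 2) z (2 * z).
Proof.
move=> e e0; exists e => // w we.
have -> : w ^+ 2 - z ^+ 2 - 2 * z * (w - z) = (w - z) * (w - z) by ring.
by rewrite cabsM ler_wpM2r ?cabs_ge0 // ltW.
Qed.

(** Polarisation, [f * g = ((f + g) ^ 2 - (f - g) ^ 2) / 4], reduces the product rule to the chain
    rule for squaring. *)
Lemma isdM f g z d d' : isd f z d -> isd g z d' ->
  isd (fun w => f w * g w) z (d * g z + f z * d').
Proof.
move=> hf hg.
have h1 := isd_comp (isdD hf hg) (isd_sqr _).
have h2 := isd_comp (isdB hf hg) (isd_sqr _).
have := isdZ (4^-1) (isdB h1 h2).
have -> : 4^-1 * (2 * (f z + g z) * (d + d') - 2 * (f z - g z) * (d - d')) =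
  d * g z + f z * d' by field.
by apply: (isd_near ltr01) => w _; field.
Qed.

Lemma isd_inv z : z != 0 -> isd (fun w => w^-1) z (- z ^- 2).
Proof.
move=> z0 e e0.
have cz : 0 < cabs z by rewrite cabs_gt0.
(* The first bound keeps the modulus of [w] above [cabs z / 2]; the second then makes the exact
   remainder [(w - z) ^ 2 / (w * z ^ 2)] small. *)
exists (Num.min (cabs z / 2) (e * cabs z ^+ 3 / 2)).
  by rewrite lt_min !divr_gt0 // mulr_gt0 // exprn_gt0.
move=> w; rewrite lt_min => /andP[w1 w2].
have cw : cabs z / 2 <= cabs w.
  by have := cabs_subD z w; rewrite cabsC; lra.
have w0 : w != 0 by rewrite -cabs_gt0; lra.
have -> : w^-1 - z^-1 - - z ^- 2 * (w - z) = (w - z) * (w - z) / (w * z ^+ 2).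
  by field; rewrite ?w0 ?z0.
rewrite !cabsM cabsV cabsM cabsX mulrAC ler_wpM2r ?cabs_ge0 //.
rewrite ler_pdivrMr; last by rewrite mulr_gt0 ?exprn_gt0 // cabs_gt0.
apply: le_trans (ltW w2) _.
have -> : e * cabs z ^+ 3 / 2 = e * (cabs z / 2 * cabs z ^+ 2) by field.
by rewrite ler_pM2l // ler_pM2r // exprn_gt0.
Qed.

Lemma isd_shift f a z d : isd f (z + a) d -> isd (fun w => f (w + a)) z d.
Proof.
move=> hf; have := @isd_comp (fun w => w + a) f z _ _ (isdD (isd_id z) (isd_cst a z)) hf.
by rewrite addr0 mulr1.
Qed.

End DerivativeRules.

(** * Limits of complex sequences *)

Section Completeness.
Context {R : realType}.
Implicit Types (u v : nat -> R[i]) (l : R[i]) (e : R).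

Definition tends u l := forall e, 0 < e ->
  exists N, forall n, (N <= n)%N -> cabs (u n - l) <= e.

Definition cauchyC u := forall e, 0 < e ->
  exists N, forall n m, (N <= n)%N -> (N <= m)%N -> cabs (u n - u m) <= e.

Lemma cauchy_real (a : nat -> R) :
  (forall e, 0 < e -> exists N, forall n m, (N <= n)%N -> (N <= m)%N ->
     `|a n - a m| <= e) ->
  exists l : R, forall e, 0 < e -> exists N, forall n, (N <= n)%N -> `|a n - l| <= e.
Proof.
move=> h; have /cauchy_cvg/cvg_ex[l /cvgrPdist_le hl] : cauchy (a @ \oo).
  apply/cauchyP => e e0; have [|N hN] := h (e / 2); first by rewrite divr_gt0.
  exists (a N); exists N => // n /= Nn; rewrite /ball /=.
  by apply: le_lt_trans (hN _ _ (leqnn _) Nn) _; lra.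
exists l => e /hl[N _ hN]; exists N => n /hN; by rewrite distrC.
Qed.

Lemma cauchy_tends u : cauchyC u -> exists l, tends u l.
Proof.
move=> h.
have [|a ha] := @cauchy_real (fun n => Re (u n)).
  move=> e /h[N hN]; exists N => n m /hN hn /hn; apply: le_trans.
  by rewrite -raddfB Re_le_cabs.
have [|b hb] := @cauchy_real (fun n => Im (u n)).
  move=> e /h[N hN]; exists N => n m /hN hn /hn; apply: le_trans.
  by rewrite -raddfB Im_le_cabs.
exists (a +i* b) => e e0; have e20 : 0 < e / 2 by rewrite divr_gt0.
have [N hN] := ha _ e20; have [M hM] := hb _ e20.
exists (maxn N M) => n; rewrite geq_max => /andP[/hN hn /hM hm].
apply: le_trans (cabs_le_ReIm _) _; rewrite !raddfB /=; lra.
Qed.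

Lemma tends_le u l c e N : tends u l ->
  (forall n, (N <= n)%N -> cabs (u n - c) <= e) -> cabs (l - c) <= e.
Proof.
move=> h hN; apply/ler_addgt0Pr => d /h[M hM].
have := hN (maxn N M); rewrite leq_maxl => /(_ isT).
have := hM (maxn N M); rewrite leq_maxr => /(_ isT).
have := cabs_dist (u (maxn N M)) l c; rewrite (cabsC l (u _)); lra.
Qed.

Lemma tends_uniq u l l' : tends u l -> tends u l' -> l = l'.
Proof.
move=> h h'; apply/eqP; rewrite -subr_eq0; apply/eqP/le0_cabs_eq => e /h'[N hN].
exact: tends_le h hN.
Qed.

Lemma geometric_lt (x c e : R) : 0 <= x < 1 -> 0 < e ->
  exists n, forall m, (n <= m)%N -> c * x ^+ m < e.
Proof.
move=> /andP[x0 x1] e0; have := cvg_geometric c (z := x); rewrite ger0_norm // => /(_ x1).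
move=> /cvgrPdist_lt/(_ _ e0)[n _ hn]; exists n => m /hn.
by rewrite sub0r normrN /=; apply: le_lt_trans (ler_norm _).
Qed.

End Completeness.

(** * Cauchy's estimate *)

Section Bisection.
Context {R : realType}.
Implicit Types (c z : R[i]) (s : R).

Definition square c s : set R[i] :=
  [set z | Re c <= Re z <= Re c + s /\ Im c <= Im z <= Im c + s].

Lemma square_diam c s z w : square c s z -> square c s w -> cabs (z - w) <= 2 * s.
Proof.
case=> /andP[h1 h2] /andP[h3 h4] [/andP[h5 h6] /andP[h7 h8]].
apply: le_trans (cabs_le_ReIm _) _; rewrite !raddfB /=.
by rewrite mulr2n mulrDl mul1r lerD // ler_norml; lra.
Qed.

Lemma nested_intervals (a : nat -> R) (s : R) : 0 <= s ->
  (forall n, a n <= a n.+1 /\ a n.+1 + s / 2 ^+ n.+1 <= a n + s / 2 ^+ n) ->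
  exists l, forall n, a n <= l <= a n + s / 2 ^+ n.
Proof.
move=> s0 h.
have mono n m : a n <= a (n + m)%N.
  by elim: m => [|m ih]; rewrite ?addn0 // addnS; apply: le_trans ih (h _).1.
have mono' n m : a (n + m)%N + s / 2 ^+ (n + m) <= a n + s / 2 ^+ n.
  by elim: m => [|m ih]; rewrite ?addn0 // addnS; apply: le_trans (h _).2 ih.
have pos n : 0 <= s / 2 ^+ n by rewrite divr_ge0 // exprn_ge0.
have ub n m : a m <= a n + s / 2 ^+ n.
  apply: le_trans (mono m n) _; rewrite addnC.
  by apply: le_trans (mono' n m); rewrite lerDl.
exists (sup (range a)) => n; apply/andP; split.
  by apply: ub_le_sup; [exists (a n + s / 2 ^+ n) => _ [m _ <-] | exists n].
by apply: ge_sup; [exists (a 0%N), 0%N | move=> _ [m _ <-]].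
Qed.

(** A failing square has a failing quarter, and the nested failing squares shrink to a point where
    the local hypothesis is violated. This is the compactness argument behind Goursat's lemma,
    boundedness on [inner n] and closedness of Jordan curves. *)
Lemma bisection (P : R[i] -> R -> Prop) :
  (forall c s, 0 < s -> P c s -> P (c + s%:C) s -> P (c + 'i * s%:C) s ->
     P (c + s%:C + 'i * s%:C) s -> P c (2 * s)) ->
  (forall z, exists2 d : R, 0 < d & forall c s, 0 < s -> s < d -> square c s z -> P c s) ->
  forall c s, 0 < s -> P c s.
Proof.
move=> hP hloc c0 s0 s00; apply: contrapT => nP.
pose child (c c' : R[i]) (s : R) :=
  (Re c' = Re c \/ Re c' = Re c + s) /\ (Im c' = Im c \/ Im c' = Im c + s).
(* The premises stand under the existential so that the choice function is total. *)
have /choice[step hstep] : forall x : R[i] * R, exists c', 0 < x.2 -> ~ P x.1 x.2 ->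
    ~ P c' (x.2 / 2) /\ child x.1 c' (x.2 / 2).
  case=> c s /=; apply: contrapT => /forallNP h.
  have h' c' : 0 < s -> ~ P c s -> child c c' (s / 2) -> P c' (s / 2).
    move=> s1 s2 s3; apply: contrapT => s4; apply: (h c') => *; by split.
  have [s1 s2] : 0 < s /\ ~ P c s by split; apply: contrapT => k; apply: (h c).
  apply: s2; have -> : s = 2 * (s / 2) by field.
  have n2 : ~ P c s by move=> k; apply: (h c).
  apply: hP; first by rewrite divr_gt0.
  - by apply: h' => //; split; left.
  - by apply: h' => //; split; rewrite raddfD /=; [right|left; rewrite addr0].
  - by apply: h' => //; split; rewrite raddfD /=; [left|right]; ring.
  - by apply: h' => //; split; rewrite !raddfD /=; right; ring.
(* Corners of the failing squares, the [n]-th of side [s0 / 2 ^ n]. *)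
pose cs := fix cs n := if n is m.+1 then step (cs m, s0 / 2 ^+ m) else c0.
have sE n : s0 / 2 ^+ n.+1 = s0 / 2 ^+ n / 2.
  by rewrite exprSr invfM mulrA.
have sp n : 0 < s0 / 2 ^+ n by rewrite divr_gt0 // exprn_gt0.
have nPs n : ~ P (cs n) (s0 / 2 ^+ n).
  elim: n => [|n ih]; first by rewrite expr0 divr1.
  by rewrite sE; apply: (hstep (cs n, s0 / 2 ^+ n) (sp n) ih).1.
have ch n : child (cs n) (cs n.+1) (s0 / 2 ^+ n / 2).
  exact: (hstep (cs n, s0 / 2 ^+ n) (sp n) (nPs n)).2.
have [|a ha] := @nested_intervals (fun n => Re (cs n)) s0 (ltW s00).
  by move=> n; rewrite sE; have := sp n; case: (ch n) => -[]-> _; lra.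
have [|b hb] := @nested_intervals (fun n => Im (cs n)) s0 (ltW s00).
  by move=> n; rewrite sE; have := sp n; case: (ch n) => _ []->; lra.
have [d d0 hd] := hloc (a +i* b).
have [n hn] : exists n, s0 / 2 ^+ n < d.
  have [|n hn] := @geometric_lt R 2^-1 s0 d _ d0; first lra.
  by exists n; have := hn n (leqnn _); rewrite exprVn.
by apply: (nPs n); apply: hd => //; split.
Qed.

End Bisection.

(** * Contour sums over squares and Goursat's lemma *)

Section ContourSums.
Context {R : realType}.
Implicit Types (f g h : R[i] -> R[i]) (a c z w : R[i]) (r s t e K : R) (n m j k : nat).

(* Riemann sum, with [2 ^ n] nodes, of the integral of h along the segment from
   z to [z + u * s].  Such sums replace integrals: bisecting a square splits its
   contour sum exactly, and contour sums vanish exactly on affine functions. *)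
Definition edge_sum h z u s n : R[i] :=
  (s / 2 ^+ n)%:C * u *
  \sum_(0 <= j < 2 ^ n) h (z + u * (j%:R * (s / 2 ^+ n))%:C).

(** Bottom, top, right and left side, signed for a counterclockwise circuit; the factor ['i] of the
    vertical sides is inside [edge_sum]. *)
Definition contour_sum h c s n : R[i] :=
  edge_sum h c 1 s n - edge_sum h (c + 'i * s%:C) 1 s n
  + edge_sum h (c + s%:C) 'i s n - edge_sum h c 'i s n.

Lemma edge_sum_split h z u s n :
  edge_sum h z u (2 * s) n.+1 = edge_sum h z u s n + edge_sum h (z + u * s%:C) u s n.
Proof.
have n2 : (2 : R) ^+ n != 0 by rewrite expf_neq0.
have sE : 2 * s / 2 ^+ n.+1 = s / 2 ^+ n.
  by rewrite exprS; field.
rewrite /edge_sum sE -mulrDr; congr (_ * _).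
have le2 : (2 ^ n <= 2 ^ n.+1)%N by rewrite leq_exp2l.
rewrite (big_cat_nat (n := 2 ^ n)) //=; congr (_ + _).
rewrite -{1}[(2 ^ n)%N]add0n big_addn expnS mul2n -addnn addnK.
apply: eq_bigr => j _; congr h.
rewrite -addrA -mulrDr -rmorphD /= natrD natrX; congr (_ + _ * _%:C).
by field.
Qed.

(** The interior sides occur twice with opposite signs and, the meshes being equal, with the same
    nodes. *)
Lemma contour_sum_split h c s n :
  contour_sum h c (2 * s) n.+1 =
  contour_sum h c s n + contour_sum h (c + s%:C) s n
  + contour_sum h (c + 'i * s%:C) s n + contour_sum h (c + s%:C + 'i * s%:C) s n.
Proof.
have e1 : c + (2 * s)%:C = c + s%:C + s%:C by rewrite rmorphM rmorph_nat; ring.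
have e2 : c + 'i * (2 * s)%:C = c + 'i * s%:C + 'i * s%:C.
  by rewrite rmorphM rmorph_nat; ring.
rewrite /contour_sum !edge_sum_split e1 e2 !mul1r.
rewrite [c + 'i * s%:C + 'i * s%:C + s%:C]addrAC.
rewrite ![c + 'i * s%:C + s%:C]addrAC.
rewrite ![c + s%:C + 'i * s%:C + s%:C]addrAC.
ring.
Qed.

Lemma contour_sumE h c s n :
  contour_sum h c s n = (s / 2 ^+ n)%:C * \sum_(0 <= j < 2 ^ n)
   (let t := (j%:R * (s / 2 ^+ n))%:C in
    h (c + t) - h (c + 'i * s%:C + t)
    + 'i * (h (c + s%:C + 'i * t) - h (c + 'i * t))).
Proof.
rewrite /contour_sum /edge_sum big_split sumrB /= -mulr_sumr sumrB /=.
under eq_bigr do rewrite mul1r.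
under [X in _ - _ * X + _]eq_bigr do rewrite mul1r.
ring.
Qed.

Lemma contour_sumB f g c s n :
  contour_sum (fun z => f z - g z) c s n = contour_sum f c s n - contour_sum g c s n.
Proof.
rewrite !contour_sumE -mulrBr -sumrB; congr (_ * _).
by apply: eq_bigr => j _ /=; ring.
Qed.

Lemma contour_sumZ b f c s n :
  contour_sum (fun z => b * f z) c s n = b * contour_sum f c s n.
Proof.
rewrite !contour_sumE mulrCA [in RHS]mulr_sumr; congr (_ * _).
by apply: eq_bigr => j _ /=; ring.
Qed.

(** At every node the horizontal sides give [- b' * 'i * s] and the vertical ones ['i * b' * s]. *)
Lemma contour_sum_affine b b' c s n : contour_sum (fun z => b + b' * z) c s n = 0.
Proof. by rewrite contour_sumE big1 ?mulr0 // => j _ /=; ring. Qed.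

Definition square_edge c s : set R[i] := [set z | square c s z /\
  [\/ Re z = Re c, Re z = Re c + s, Im z = Im c | Im z = Im c + s]].

Lemma contour_sum_le h c s n K : 0 < s ->
  (forall z, square_edge c s z -> cabs (h z) <= K) ->
  cabs (contour_sum h c s n) <= 4 * s * K.
Proof.
move=> s0 hK; have n0 : 0 < (2 : R) ^+ n by rewrite exprn_gt0.
have d0 : 0 < s / 2 ^+ n by rewrite divr_gt0.
rewrite contour_sumE cabsM cabs_real gtr0_norm //.
have -> : 4 * s * K = s / 2 ^+ n * \sum_(0 <= j < 2 ^ n) (4 * K).
  rewrite sumr_const_nat subn0 -[(4 * K) *+ _]mulr_natr natrX; field.
  by rewrite gt_eqF.
rewrite ler_pM2l //; apply: le_trans (cabs_sum _ _ _) _.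
rewrite big_nat_cond [leRHS]big_nat_cond; apply: ler_sum => j /andP[/andP[_ jn] _] /=.
set t := j%:R * _.
have t0 : 0 <= t by rewrite mulr_ge0 // ltW.
have ts : t <= s.
  have -> : s = (2 ^ n)%:R * (s / 2 ^+ n) by rewrite natrX; field; rewrite gt_eqF.
  by rewrite ler_pM2r // ler_nat ltnW.
have k1 : cabs (h (c + t%:C)) <= K.
  apply: hK; split; last by apply: Or43; rewrite raddfD /= addr0.
  by split; rewrite raddfD /=; apply/andP; split; lra.
have k2 : cabs (h (c + 'i * s%:C + t%:C)) <= K.
  apply: hK; split; last by apply: Or44; rewrite !raddfD /=; lra.
  by split; rewrite !raddfD /=; apply/andP; split; lra.
have k3 : cabs (h (c + s%:C + 'i * t%:C)) <= K.
  apply: hK; split; last by apply: Or42; rewrite !raddfD /=; lra.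
  by split; rewrite !raddfD /=; apply/andP; split; lra.
have k4 : cabs (h (c + 'i * t%:C)) <= K.
  apply: hK; split; last by apply: Or41; rewrite !raddfD /=; lra.
  by split; rewrite !raddfD /=; apply/andP; split; lra.
apply: le_trans (cabsD _ _) _; rewrite cabsM cabs_i mul1r.
have := cabsB (h (c + t%:C)) (h (c + 'i * s%:C + t%:C)).
have := cabsB (h (c + s%:C + 'i * t%:C)) (h (c + 'i * t%:C)).
lra.
Qed.

(** By comparison with the tangent affine map, a small square around a point carries at most [k]
    times its area; areas add up under quartering, so the bound reaches the whole square. *)
Lemma goursat f c s : 0 < s ->
  (forall z, square c s z -> exists d, isd f z d) ->
  forall e, 0 < e -> exists M, forall n, (M <= n)%N -> cabs (contour_sum f c s n) <= e.
Proof.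
move=> s0 hf e e0; pose k := e / s ^+ 2.
have k0 : 0 < k by rewrite divr_gt0 // exprn_gt0.
pose P c' s' := square c' s' `<=` square c s ->
  exists M, forall n, (M <= n)%N -> cabs (contour_sum f c' s' n) <= k * s' ^+ 2.
suff : P c s.
  move=> /(_ (fun _ => id))[M hM]; exists M => n /hM.
  by rewrite /k divfK // gt_eqF // exprn_gt0.
apply: (bisection (P := P)) => // [c' s' s'0 h1 h2 h3 h4 sub|z].
- have [M1 hM1] : exists M, forall n, (M <= n)%N ->
      cabs (contour_sum f c' s' n) <= k * s' ^+ 2.
    by apply: h1 => z [/andP[u1 u2] /andP[u3 u4]]; apply: sub; split; apply/andP; split; lra.
  have [M2 hM2] : exists M, forall n, (M <= n)%N ->
      cabs (contour_sum f (c' + s'%:C) s' n) <= k * s' ^+ 2.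
    apply: h2 => z [/andP[u1 u2] /andP[u3 u4]]; apply: sub.
    by move: u1 u2 u3 u4; rewrite !raddfD /= => *; split; apply/andP; split; lra.
  have [M3 hM3] : exists M, forall n, (M <= n)%N ->
      cabs (contour_sum f (c' + 'i * s'%:C) s' n) <= k * s' ^+ 2.
    apply: h3 => z [/andP[u1 u2] /andP[u3 u4]]; apply: sub.
    by move: u1 u2 u3 u4; rewrite !raddfD /= => *; split; apply/andP; split; lra.
  have [M4 hM4] : exists M, forall n, (M <= n)%N ->
      cabs (contour_sum f (c' + s'%:C + 'i * s'%:C) s' n) <= k * s' ^+ 2.
    apply: h4 => z [/andP[u1 u2] /andP[u3 u4]]; apply: sub.
    by move: u1 u2 u3 u4; rewrite !raddfD /= => *; split; apply/andP; split; lra.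
  exists (maxn (maxn M1 M2) (maxn M3 M4)).+1 => -[//|n].
  rewrite ltnS !geq_max => /andP[/andP[/hM1 b1 /hM2 b2] /andP[/hM3 b3 /hM4 b4]].
  rewrite contour_sum_split.
  have -> : k * (2 * s') ^+ 2 = k * s' ^+ 2 + k * s' ^+ 2 + k * s' ^+ 2 + k * s' ^+ 2.
    by ring.
  by do 3! (apply: le_trans (cabsD _ _) _; apply: lerD => //).
- have [zs|nzs] := pselect (square c s z); last first.
    (* No square containing [z] lies inside the given one, so [P] holds vacuously. *)
    by exists 1 => // c' s' _ _ zc' sub; case: nzs; apply: sub.
  have [d hd] := hf z zs.
  (* [k / 8] because the perimeter [4 * s'] times the diameter bound [2 * s'] is [8 * s' ^ 2]. *)
  have [|r r0 hr] := hd (k / 8); first by rewrite divr_gt0.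
  exists (r / 2); first by rewrite divr_gt0.
  move=> c' s' s'0 s'r zc' sub; exists 0%N => n _.
  have -> : contour_sum f c' s' n =
      contour_sum (fun w => f w - ((f z - d * z) + d * w)) c' s' n.
    by rewrite contour_sumB contour_sum_affine subr0.
  have -> : k * s' ^+ 2 = 4 * s' * (k / 8 * (2 * s')) by field.
  apply: contour_sum_le => // w [wc' _]; have ww := square_diam wc' zc'.
  have -> : f w - ((f z - d * z) + d * w) = f w - f z - d * (w - z) by ring.
  apply: le_trans (hr _ _) _; first lra.
  by rewrite ler_pM2l // divr_gt0.
Qed.

Lemma centered_square a s z : square (a - s%:C - 'i * s%:C) (2 * s) z <->
  Re a - s <= Re z <= Re a + s /\ Im a - s <= Im z <= Im a + s.
Proof.
rewrite /square /= !raddfD !raddfN /=.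
by split=> -[/andP[u1 u2] /andP[u3 u4]]; split; apply/andP; split; lra.
Qed.

Lemma centered_square_cabs a s z :
  square (a - s%:C - 'i * s%:C) (2 * s) z -> cabs (z - a) <= 2 * s.
Proof.
move=> /centered_square[/andP[u1 u2] /andP[u3 u4]].
apply: le_trans (cabs_le_ReIm _) _; rewrite !raddfB /=.
have l1 : `|Re z - Re a| <= s by rewrite ler_norml; lra.
have l2 : `|Im z - Im a| <= s by rewrite ler_norml; lra.
lra.
Qed.

Definition centered_sum h a s n := contour_sum h (a - s%:C - 'i * s%:C) (2 * s) n.

(** Cut the square into sixteen of side [s / 2]. The middle four form the half-size square; the
    other twelve miss [a], and Goursat's lemma makes each of them contribute at most [e / 12].
    Levels [n.+1] and [n] give equal meshes. *)
Lemma centered_sum_half h a s : 0 < s ->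
  (forall z, z != a -> square (a - s%:C - 'i * s%:C) (2 * s) z -> exists d, isd h z d) ->
  forall e, 0 < e -> exists M, forall n, (M <= n)%N ->
    cabs (centered_sum h a s n.+1 - centered_sum h a (s / 2) n) <= e.
Proof.
move=> s0 hh e e0; pose t := s / 2; have t0 : 0 < t by rewrite divr_gt0.
(* Lower left corners of the grid, counted from [a] in units of [t]; the values -2 to 1 occur for
   both coordinates. *)
pose corner p q := a + (p * t)%:C + 'i * (q * t)%:C.
pose K n p q := contour_sum h (corner p q) t n.
have K4 n p q : contour_sum h (corner p q) (2 * t) n.+1 =
    K n p q + K n (p + 1) q + K n p (q + 1) + K n (p + 1) (q + 1).
  rewrite contour_sum_split /K; congr (_ + _ + _ + _); congr contour_sum;
  by rewrite /corner !mulrDl !rmorphD !mul1r /=; ring.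
have big n : centered_sum h a s n.+2 =
    contour_sum h (corner (-2) (-2)) (2 * t) n.+1 +
    contour_sum h (corner 0 (-2)) (2 * t) n.+1 +
    contour_sum h (corner (-2) 0) (2 * t) n.+1 +
    contour_sum h (corner 0 0) (2 * t) n.+1.
  have t2 : 2 * t = s by rewrite /t; field.
  rewrite /centered_sum contour_sum_split t2; congr (_ + _ + _ + _);
  by congr contour_sum; rewrite /corner ?mulNr ?mul0r ?t2 ?rmorphN ?rmorph0 /=; ring.
have small n : centered_sum h a t n.+1 = contour_sum h (corner (-1) (-1)) (2 * t) n.+1.
  by rewrite /centered_sum; congr contour_sum; rewrite /corner !mulNr !mul1r !rmorphN /=; ring.
have outer (p q : R) : -2 <= p <= 1 -> -2 <= q <= 1 ->
    [\/ p = -2, p = 1, q = -2 | q = 1] ->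
    exists M, forall n, (M <= n)%N -> cabs (K n p q) <= e / 12.
  move=> /andP[p1 p2] /andP[q1 q2] pq; apply: goursat => //; last by rewrite divr_gt0.
  have pt1 : -2 * t <= p * t by rewrite ler_pM2r.
  have pt2 : p * t <= t by rewrite -[leRHS]mul1r ler_pM2r.
  have qt1 : -2 * t <= q * t by rewrite ler_pM2r.
  have qt2 : q * t <= t by rewrite -[leRHS]mul1r ler_pM2r.
  have st : s = 2 * t by rewrite /t; field.
  move=> z; rewrite /corner => -[]; rewrite !raddfD /= => /andP[u1 u2] /andP[u3 u4].
  apply: hh.
    apply/eqP => za; rewrite za in u1 u2 u3 u4.
    by case: pq => pq; rewrite pq in u1 u2 u3 u4; lra.
  by apply/centered_square; split; apply/andP; split; lra.
have [M1 h1] : exists M, forall n, (M <= n)%N -> cabs (K n (-2) (-2)) <= e / 12.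
  by apply: outer; [lra|lra|apply: Or41].
have [M2 h2] : exists M, forall n, (M <= n)%N -> cabs (K n (-1) (-2)) <= e / 12.
  by apply: outer; [lra|lra|apply: Or43].
have [M3 h3] : exists M, forall n, (M <= n)%N -> cabs (K n 0 (-2)) <= e / 12.
  by apply: outer; [lra|lra|apply: Or43].
have [M4 h4] : exists M, forall n, (M <= n)%N -> cabs (K n 1 (-2)) <= e / 12.
  by apply: outer; [lra|lra|apply: Or43].
have [M5 h5] : exists M, forall n, (M <= n)%N -> cabs (K n (-2) (-1)) <= e / 12.
  by apply: outer; [lra|lra|apply: Or41].
have [M6 h6] : exists M, forall n, (M <= n)%N -> cabs (K n 1 (-1)) <= e / 12.
  by apply: outer; [lra|lra|apply: Or42].
have [M7 h7] : exists M, forall n, (M <= n)%N -> cabs (K n (-2) 0) <= e / 12.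
  by apply: outer; [lra|lra|apply: Or41].
have [M8 h8] : exists M, forall n, (M <= n)%N -> cabs (K n 1 0) <= e / 12.
  by apply: outer; [lra|lra|apply: Or42].
have [M9 h9] : exists M, forall n, (M <= n)%N -> cabs (K n (-2) 1) <= e / 12.
  by apply: outer; [lra|lra|apply: Or41].
have [M10 h10] : exists M, forall n, (M <= n)%N -> cabs (K n (-1) 1) <= e / 12.
  by apply: outer; [lra|lra|apply: Or44].
have [M11 h11] : exists M, forall n, (M <= n)%N -> cabs (K n 0 1) <= e / 12.
  by apply: outer; [lra|lra|apply: Or44].
have [M12 h12] : exists M, forall n, (M <= n)%N -> cabs (K n 1 1) <= e / 12.
  by apply: outer; [lra|lra|apply: Or42].
exists (maxn (maxn (maxn M1 M2) (maxn M3 M4)) (maxn (maxn (maxn M5 M6) (maxn M7 M8))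
  (maxn (maxn M9 M10) (maxn M11 M12)))).+1 => -[//|n].
rewrite ltnS !geq_max => /andP[/andP[/andP[/h1 {}h1 /h2 {}h2] /andP[/h3 {}h3 /h4 {}h4]]
  /andP[/andP[/andP[/h5 {}h5 /h6 {}h6] /andP[/h7 {}h7 /h8 {}h8]]
  /andP[/andP[/h9 {}h9 /h10 {}h10] /andP[/h11 {}h11 /h12 {}h12]]]].
rewrite -/t big small !K4.
have -> : (-2 + 1 : R) = -1 by ring.
have -> : (-1 + 1 : R) = 0 by ring.
rewrite add0r.
set X := (X in cabs X).
have -> : X = K n (-2) (-2) + K n (-1) (-2) + K n 0 (-2) + K n 1 (-2) +
  K n (-2) (-1) + K n 1 (-1) + K n (-2) 0 + K n 1 0 +
  K n (-2) 1 + K n (-1) 1 + K n 0 1 + K n 1 1 by rewrite /X; ring.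
have -> : e = e / 12 + e / 12 + e / 12 + e / 12 + e / 12 + e / 12 + e / 12 + e / 12
  + e / 12 + e / 12 + e / 12 + e / 12 by field.
by do 11! (apply: le_trans (cabsD _ _) _; apply: lerD => //).
Qed.

Lemma centered_sum_shrink h a r : 0 < r ->
  (forall z, z != a -> square (a - r%:C - 'i * r%:C) (2 * r) z -> exists d, isd h z d) ->
  forall k e, 0 < e -> exists M, forall n, (M <= n)%N ->
    cabs (centered_sum h a r (n + k) - centered_sum h a (r / 2 ^+ k) n) <= e.
Proof.
move=> r0 hh; elim=> [|k ih] e e0.
  by exists 0%N => n _; rewrite addn0 expr0 divr1 subrr cabs0 ltW.
have e20 : 0 < e / 2 by rewrite divr_gt0.
have [M hM] := ih _ e20; pose s := r / 2 ^+ k.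
have s0 : 0 < s by rewrite divr_gt0 // exprn_gt0.
have sr : s <= r.
  have p1 : 1 <= (2 : R) ^+ k by rewrite exprn_ege1 // ler1n.
  by rewrite ler_pdivrMr ?exprn_gt0 // ler_peMr // ltW.
have [|M' hM'] := @centered_sum_half h a s s0 _ _ e20.
  move=> z za /centered_square[/andP[u1 u2] /andP[u3 u4]]; apply: hh => //.
  by apply/centered_square; split; apply/andP; split; lra.
exists (maxn M M') => n; rewrite geq_max => /andP[Mn M'n].
have := hM n.+1 (leqW Mn); have := hM' n M'n.
have -> : r / 2 ^+ k.+1 = s / 2 by rewrite /s exprSr invfM mulrA.
rewrite addSnnS -/s => b1 b2.
by apply: le_trans (cabs_dist (centered_sum h a s n.+1) _ _) _; lra.
Qed.

Lemma centered_square_edge a s z : 0 < s ->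
  square_edge (a - s%:C - 'i * s%:C) (2 * s) z -> s <= cabs (z - a).
Proof.
move=> s0 [_]; rewrite !raddfD !raddfN /=.
by case=> hz; [apply: le_trans (Re_le_cabs _)|apply: le_trans (Re_le_cabs _)
  |apply: le_trans (Im_le_cabs _)|apply: le_trans (Im_le_cabs _)];
  rewrite raddfB /= hz; rewrite ler_normr; lra.
Qed.

(** The integral is [2 * pi * 'i], but a lower bound is enough. The four contributions at a node
    combine to ['i * (4 * s / (x ^ 2 + s ^ 2))] with [|x| <= s], of modulus at least [2 / s], and a
    side has length [2 * s]. *)
Lemma centered_sum_inv a s n : 0 < s ->
  4 <= cabs (centered_sum (fun z => (z - a)^-1) a s n).
Proof.
move=> s0; rewrite /centered_sum contour_sumE.
set d := 2 * s / 2 ^+ n; pose x j := j%:R * d - s.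
have d0 : 0 < d by rewrite !divr_gt0 ?mulr_gt0 // exprn_gt0.
have D0 j : x j ^+ 2 + s ^+ 2 != 0.
  by rewrite gt_eqF // ltr_wpDl ?sqr_ge0 // exprn_gt0.
have invE (u v : R[i]) j : u * v = (x j ^+ 2 + s ^+ 2)%:C ->
    u^-1 = v * (x j ^+ 2 + s ^+ 2)^-1%:C.
  move=> uv; have u0 : u != 0.
    by apply: contra_neq (D0 j) => u0; apply: complexI; rewrite -uv u0 mul0r.
  by apply: (mulfI u0); rewrite mulfV // mulrA uv -rmorphM /= mulfV // D0.
rewrite (eq_bigr (fun j => 'i * (4 * s / (x j ^+ 2 + s ^+ 2))%:C)); last first.
  move=> j _ /=; set D := (x j ^+ 2 + s ^+ 2).
  have tE : (j%:R * d)%:C = (x j)%:C + s%:C :> R[i] by rewrite -rmorphD /x subrK.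
  have i2 : 'i * 'i = -1 :> R[i] by rewrite -expr2 sqr_i.
  have DE : D%:C = (x j)%:C * (x j)%:C - ('i * 'i) * s%:C * s%:C.
    by rewrite i2 /D rmorphD !rmorphXn /=; ring.
  rewrite (invE _ ((x j)%:C + 'i * s%:C) j); last first.
    by rewrite -/D DE tE; ring.
  rewrite (invE _ ((x j)%:C - 'i * s%:C) j); last first.
    by rewrite -/D DE tE !rmorphM rmorph_nat; ring.
  rewrite (invE _ (s%:C - 'i * (x j)%:C) j); last first.
    rewrite -/D tE !rmorphM rmorph_nat.
    transitivity (s%:C * s%:C - ('i * 'i) * (x j)%:C * (x j)%:C); first ring.
    by rewrite DE i2; ring.
  rewrite (invE _ (- s%:C - 'i * (x j)%:C) j); last first.
    rewrite -/D tE.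
    transitivity (s%:C * s%:C - ('i * 'i) * (x j)%:C * (x j)%:C); first ring.
    by rewrite DE i2; ring.
  by rewrite -/D !rmorphM rmorph_nat; ring.
rewrite -mulr_sumr mulrCA cabsM cabs_i mul1r -rmorph_sum -rmorphM.
rewrite cabs_real.
apply: le_trans (ler_norm _).
rewrite [leLHS](_ : 4 = d * \sum_(0 <= j < 2 ^ n) (2 / s)); last first.
  rewrite sumr_const_nat subn0 -[(2 / s) *+ _]mulr_natr natrX /d; field.
  by rewrite gt_eqF //= gt_eqF // exprn_gt0.
rewrite ler_pM2l // big_nat_cond [leRHS]big_nat_cond.
apply: ler_sum => j /andP[/andP[_ jn] _].
have t0 : 0 <= j%:R * d by rewrite mulr_ge0 // ltW.
have ts : j%:R * d <= 2 * s.
  have -> : 2 * s = (2 ^ n)%:R * d by rewrite natrX /d; field; rewrite gt_eqF // exprn_gt0.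
  by rewrite ler_pM2r // ler_nat ltnW.
rewrite ler_pdivrMr // mulrAC ler_pdivlMr ?ltr_wpDl ?sqr_ge0 ?exprn_gt0 //.
have xs : x j ^+ 2 <= s ^+ 2.
  by rewrite -subr_ge0 subr_sqr mulr_ge0 // /x; lra.
rewrite -[4 * s * s]mulrA -expr2; lra.
Qed.

(* The contour sums of [(f z - f a) / (z - a) ^ 2] over squares centred at a
   agree in the limit; they are at most [16 K / s] on a large square, and close
   to [g a] times those of [1 / (z - a)] on a small one. *)
Lemma cauchy_estimate f g a r K : 0 < r ->
  (forall z, cabs (z - a) < r -> isd f z (g z)) ->
  (forall z, cabs (z - a) < r -> cabs (f z) <= K) -> cabs (g a) <= 12 * K / r.
Proof.
(* Points of the square are within [2 * s] of [a], hence in the disc; [16 * K / s = 48 * K / r],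
   divided by the lower bound 4 of [centered_sum_inv], is the bound claimed. *)
move=> r0 fg fK; pose s := r / 3; have s0 : 0 < s by rewrite divr_gt0.
pose h z := (f z - f a) * ((z - a)^-1 * (z - a)^-1).
have in_disc z : square (a - s%:C - 'i * s%:C) (2 * s) z -> cabs (z - a) < r.
  have : s * 3 = r by rewrite /s divfK.
  by move=> sr /centered_square_cabs; lra.
have hd z : z != a -> square (a - s%:C - 'i * s%:C) (2 * s) z -> exists d, isd h z d.
  move=> za /in_disc zr; have za0 : z - a != 0 by rewrite subr_eq0.
  have i1 := isd_comp (isdB (isd_id z) (isd_cst a z)) (isd_inv za0).
  eexists; exact: (isdM (isdB (fg z zr) (isd_cst (f a) z)) (isdM i1 i1)).
have K0 : 0 <= K.
  by apply: le_trans (cabs_ge0 (f a)) (fK a _); rewrite subrr cabs0.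
have ub n : cabs (centered_sum h a s n) <= 16 * K / s.
  have -> : 16 * K / s = 4 * (2 * s) * (2 * K / s ^+ 2) by field; rewrite gt_eqF.
  apply: contour_sum_le => [|z ze]; first by rewrite mulr_gt0.
  have l := centered_square_edge s0 ze.
  rewrite /h !cabsM cabsV -invfM -expr2; apply: ler_pM; rewrite ?cabs_ge0 //.
  - by rewrite invr_ge0 exprn_ge0 // cabs_ge0.
  - have h1 := fK z (in_disc _ ze.1); have h2 := fK a; rewrite subrr cabs0 in h2.
    by apply: le_trans (cabsB _ _) _; have := h2 r0; lra.
  - rewrite lef_pV2 ?posrE ?exprn_gt0 //; last by apply: lt_le_trans l.
    by rewrite lerXn2r // nnegrE // ?ltW // (lt_le_trans s0).
suff main e : 0 < e -> 4 * cabs (g a) <= 16 * K / s + e.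
  have : 4 * cabs (g a) <= 16 * K / s by apply/ler_addgt0Pr.
  have -> : 16 * K / s = 4 * (12 * K / r) by rewrite /s; field; rewrite gt_eqF.
  by rewrite ler_pM2l.
move=> e0; have e20 : 0 < e / 2 by rewrite divr_gt0.
have fa : isd f a (g a) by apply: fg; rewrite subrr cabs0.
(* On the small square the remainder is divided by [cabs (z - a) >= t] and summed over the perimeter
   [8 * t], which leaves at most [e / 2]. *)
have [|d d0 hdd] := fa (e / 16); first by rewrite divr_gt0.
have [k hk] : exists k, s / 2 ^+ k < d / 3.
  have [||n hn] := @geometric_lt R 2^-1 s (d / 3); [lra|by rewrite divr_gt0|].
  by exists n; have := hn n (leqnn _); rewrite exprVn.
have [M hM] := centered_sum_shrink s0 hd k e20.
pose t := s / 2 ^+ k; have t0 : 0 < t by rewrite divr_gt0 // exprn_gt0.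
have := hM M (leqnn _); rewrite -/t => hM'.
have rem : cabs (centered_sum h a t M - g a * centered_sum (fun z => (z - a)^-1) a t M)
    <= e / 2.
  rewrite -contour_sumZ -contour_sumB.
  have -> : e / 2 = 4 * (2 * t) * (e / 16 / t) by field; rewrite gt_eqF.
  apply: contour_sum_le => [|z ze]; first by rewrite mulr_gt0.
  have l := centered_square_edge t0 ze.
  have za0 : z - a != 0 by rewrite -cabs_gt0 (lt_le_trans t0).
  have zd : cabs (z - a) < d.
    have := centered_square_cabs ze.1; have : d / 3 * 3 = d by rewrite divfK.
    by move: hk; rewrite -/t; lra.
  have -> : h z - g a * (z - a)^-1 =
      (f z - f a - g a * (z - a)) * ((z - a)^-1 * (z - a)^-1).
    by rewrite /h; field.
  have c0 := lt_le_trans t0 l.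
  rewrite !cabsM cabsV mulrA; apply: (@le_trans _ _ (e / 16 * (cabs (z - a))^-1)).
    rewrite ler_pM2r ?invr_gt0 //.
    by rewrite ler_pdivrMr //; apply: hdd.
  by rewrite ler_pM2l ?divr_gt0 // lef_pV2.
have c4 := centered_sum_inv a M t0.
have := ub (M + k)%N.
have : cabs (g a) * 4 <= cabs (g a * centered_sum (fun z => (z - a)^-1) a t M).
  by rewrite cabsM; apply: ler_wpM2l c4; apply: cabs_ge0.
have := cabs_subD (g a * centered_sum (fun z => (z - a)^-1) a t M) (centered_sum h a t M).
have := cabs_subD (centered_sum h a t M) (centered_sum h a s (M + k)).
move: rem hM'; rewrite (cabsC _ (g a * _)) (cabsC (centered_sum h a s _)).
lra.
Qed.

End ContourSums.

(** * Holomorphic functions *)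

Section MeanValue.
Context {R : realType}.
Implicit Types (f g : R[i] -> R[i]) (a b c z w : R[i]) (r s t e K : R) (n k : nat).

Lemma holomorphic_isd (U : set R[i]) f z :
  holomorphic U f -> U z -> isd f z (derive1 f z).
Proof. by move=> hf /hf/derivable_isd. Qed.

Lemma is_derive_Re_line f z v d u t :
  isd f (z + t%:C * v) d ->
  is_derive t 1 (fun s : R => Re (u * f (z + s%:C * v))) (Re (u * d * v)).
Proof.
move=> hf; have h : (Re (u * f (z + (h + t)%:C * v)) - Re (u * f (z + t%:C * v))) / h
    @[h --> (0 : R)^'] --> Re (u * d * v).
  apply/cvgrPdist_le => e e0.
  have k0 : 0 < cabs u * cabs v + 1.
    by have := mulr_ge0 (cabs_ge0 u) (cabs_ge0 v); lra.
  have [|r r0 hr] := hf (e / (cabs u * cabs v + 1)); first by rewrite divr_gt0.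
  have c0 : 0 < cabs v + 1 by have := cabs_ge0 v; lra.
  apply/nbhs_ballP; exists (r / (cabs v + 1)); first by rewrite /= divr_gt0.
  move=> h; rewrite /ball /= sub0r normrN ltr_pdivlMr // => hv h0.
  have wz : z + (h + t)%:C * v - (z + t%:C * v) = h%:C * v by rewrite rmorphD /=; ring.
  have habs : 0 < `|h| by rewrite normr_gt0.
  have /hr : cabs (z + (h + t)%:C * v - (z + t%:C * v)) < r.
    rewrite wz cabsM cabs_real; apply: le_lt_trans hv.
    by rewrite ler_pM2l // lerDl.
  rewrite wz; set D := f _ - f _ => hD.
  rewrite -(ler_pM2r habs) -normrM mulrBl divfK //.
  have -> : Re (u * d * v) * h - (Re (u * f (z + (h + t)%:C * v)) - Re (u * f (z + t%:C * v)))
    = Re (- u * (D - d * (h%:C * v))).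
    rewrite /D -raddfB -mulrBr; set X := f _ - f _.
    have -> : Re (u * d * v) * h = Re (u * d * v * h%:C).
      by case: (u * d * v) => p q /=; rewrite mulr0 subr0.
    by rewrite -raddfB; congr Re; ring.
  apply: le_trans (Re_le_cabs _) _; rewrite cabsM cabsN.
  apply: le_trans (ler_wpM2l (cabs_ge0 _) hD) _.
  rewrite cabsM cabs_real.
  have -> : cabs u * (e / (cabs u * cabs v + 1) * (`|h| * cabs v)) =
    e * `|h| * ((cabs u * cabs v) / (cabs u * cabs v + 1)) by ring.
  apply: ler_piMr; first by rewrite mulr_ge0 // ltW.
  by rewrite ler_pdivrMr // mul1r lerDl.
have h' : h^-1 *: (Re (u * f (z + (h *: (1 : R) + t)%:C * v)) - Re (u * f (z + t%:C * v)))
    @[h --> (0 : R)^'] --> Re (u * d * v).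
  apply: cvg_trans h; apply: near_eq_cvg; apply: nearW => s.
  by rewrite /GRing.scale /= mulr1 mulrC.
apply: DeriveDef; first by apply/cvg_ex; eexists; exact: h'.
by apply: cvg_lim.
Qed.

(** After a factor [u] turning the increment into a nonnegative real, the real mean value theorem
    applies to [Phi - Re (u * f)] along the segment. A majorant [Phi] rather than a constant is what
    [taylor_le] needs. *)
Lemma mean_value_majorant f g a v (phi Phi : R -> R) :
  (forall t, 0 <= t <= 1 -> isd f (a + t%:C * v) (g (a + t%:C * v))) ->
  (forall t, 0 <= t <= 1 -> cabs (g (a + t%:C * v)) * cabs v <= phi t) ->
  (forall t, is_derive t 1 Phi (phi t)) ->
  cabs (f (a + v) - f a) <= Phi 1 - Phi 0.
Proof.
move=> fg gphi dPhi.
have [u u1 uD] : exists2 u, cabs u <= 1 & Re (u * (f (a + v) - f a)) = cabs (f (a + v) - f a).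
  set D := f _ - f _; have [->|D0] := eqVneq D 0.
    by exists 0; rewrite ?mul0r cabs0.
  have c0 : (cabs D)%:C != 0 :> R[i] by rewrite -norm_cabs normr_eq0.
  exists ((cabs D)%:C^-1 * D^*).
    by rewrite cabsM cabsV cabs_real ger0_norm ?cabs_ge0 // -(lecR) rmorphM rmorphV ?unitfE ?cabs_eq0 //= -!norm_cabs normcJ mulVf // norm_cabs.
  rewrite -mulrA [_ * D]mulrC -sqr_normc norm_cabs expr2 mulrA mulVf // mul1r.
  by [].
pose psi t := Phi t - Re (u * f (a + t%:C * v)).
have dpsi t : 0 <= t <= 1 -> is_derive t 1 psi (phi t - Re (u * g (a + t%:C * v) * v)).
  move=> t01; have d1 := dPhi t; have d2 := is_derive_Re_line u (fg _ t01).
  exact: is_deriveB.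
have ge0 t : 0 <= t <= 1 -> 0 <= phi t - Re (u * g (a + t%:C * v) * v).
  move=> t01; rewrite subr_ge0; apply: le_trans (ler_norm _) _.
  apply: le_trans (Re_le_cabs _) _; apply: le_trans (gphi _ t01).
  rewrite !cabsM; apply: ler_wpM2r; first exact: cabs_ge0.
  by apply: ler_piMl => //; apply: cabs_ge0.
have [|||c c01] := @MVT R psi (fun t => phi t - Re (u * g (a + t%:C * v) * v)) 0 1.
- exact: ltr01.
- by move=> x; rewrite in_itv /= => /andP[x0 x1]; apply: dpsi; rewrite !ltW.
- apply: derivable_within_continuous => x; rewrite in_itv /= => x01.
  by have [] := dpsi _ x01.
rewrite subr0 mulr1 => psiE.
have : 0 <= psi 1 - psi 0.
  rewrite psiE; apply: ge0; move: c01; rewrite in_itv /= => /andP[c0 c1].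
  by rewrite !ltW.
rewrite /psi rmorph1 rmorph0 mul1r mul0r addr0 -uD mulrBr raddfB /=; lra.
Qed.

Lemma disc_segment a r z w t : disc a r z -> disc a r w -> 0 <= t <= 1 ->
  disc a r (z + t%:C * (w - z)).
Proof.
rewrite /disc /= => hz hw /andP[t0 t1].
have -> : z + t%:C * (w - z) - a = (1 - t)%:C * (z - a) + t%:C * (w - a).
  by rewrite rmorphB rmorph1; ring.
apply: le_lt_trans (cabsD _ _) _; rewrite !cabsM !cabs_real !ger0_norm ?subr_ge0 //.
have [t00|t00] := eqVneq t 0; first by rewrite t00 subr0 mul0r mul1r addr0.
have tp : 0 < t by rewrite lt_def t00.
have h1 : t * cabs (w - a) < t * r by rewrite ltr_pM2l.
have h2 : (1 - t) * cabs (z - a) <= (1 - t) * r by apply: ler_wpM2l; [lra|exact: ltW].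
lra.
Qed.

Lemma mean_value f g a r K : (forall z, disc a r z -> isd f z (g z)) ->
  (forall z, disc a r z -> cabs (g z) <= K) ->
  forall z w, disc a r z -> disc a r w -> cabs (f w - f z) <= K * cabs (w - z).
Proof.
move=> fg gK z w hz hw; pose Phi t := t * (K * cabs (w - z)).
have := @mean_value_majorant f g z (w - z) (fun=> K * cabs (w - z)) Phi.
rewrite [z + (w - z)]addrC subrK /Phi mul1r mul0r subr0; apply.
- by move=> t t01; apply/fg/disc_segment.
- by move=> t t01; rewrite ler_wpM2r ?cabs_ge0 // gK //; apply: disc_segment.
- move=> t; have d1 := is_derive_id t (1 : R).
  have := is_deriveM (is_derive_id t (1 : R)) (is_derive_cst (K * cabs (w - z)) t 1).
  by move=> h; apply: (is_derive_eq h); rewrite /GRing.scale /= mulr0 mulr1 add0r.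
Qed.

End MeanValue.

(** * Weierstrass' theorem and the differentiability of derivatives *)

Section Weierstrass.
Context {R : realType}.
Implicit Types (f g : R[i] -> R[i]) (u : nat -> R[i] -> R[i]).
Implicit Types (a c h z w : R[i]) (r e K : R) (n k : nat) (U : set R[i]).

Lemma disc_half a r z w : disc a (r / 2) z -> disc z (r / 2) w -> disc a r w.
Proof.
rewrite /disc /= => h h'; apply: le_lt_trans (cabs_dist z _ _) _; lra.
Qed.

(** Cauchy's estimate makes the derivatives uniformly Cauchy on the half disc; the mean value
    inequality then makes the increments of [f - u p] from [a] at most [e / 3] times the distance,
    so differentiability of [u p] at [a] passes to [f]. *)
Lemma weierstrass_at u (u' : nat -> R[i] -> R[i]) f a r : 0 < r ->
  (forall n z, disc a r z -> isd (u n) z (u' n z)) ->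
  (forall e, 0 < e -> exists N, forall n, (N <= n)%N ->
     forall z, disc a r z -> cabs (u n z - f z) <= e) ->
  exists2 d, isd f a d & tends (fun n => u' n a) d.
Proof.
move=> r0 uu' uf; have r20 : 0 < r / 2 by rewrite divr_gt0.
have cau e : 0 < e -> exists N, forall n m, (N <= n)%N -> (N <= m)%N ->
    forall z, disc a (r / 2) z -> cabs (u' n z - u' m z) <= e.
  (* [u n - u m] is then bounded by [e * r / 24], and the constant 12 on discs of radius [r / 2]
     gives [e]. *)
  move=> e0; have [|N hN] := uf (e * r / 48).
    by rewrite divr_gt0 // mulr_gt0.
  exists N => n m Nn Nm z zr.
  have := @cauchy_estimate _ (fun w => u n w - u m w) (fun w => u' n w - u' m w)
    z (r / 2) (e * r / 24) r20.
  have -> : 12 * (e * r / 24) / (r / 2) = e by field; rewrite gt_eqF.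
  apply => w wr; have wa := disc_half zr wr; first by apply: isdB; apply: uu'.
  have := cabs_dist (f w) (u n w) (u m w); rewrite (cabsC (f w)).
  have := hN n Nn w wa; have := hN m Nm w wa; lra.
have [|d hd] := @cauchy_tends _ (fun n => u' n a).
  move=> e /cau[N hN]; exists N => n m Nn Nm; apply: hN => //.
  exact: disc_center.
exists d => // e e0; have e30 : 0 < e / 3 by rewrite divr_gt0.
have [N hN] := cau _ e30; have [N' hN'] := hd _ e30.
pose p := maxn N N'.
have pN : (N <= p)%N by rewrite leq_maxl.
have pN' : (N' <= p)%N by rewrite leq_maxr.
have ap : disc a r a by apply: disc_center.
have [r' r'0 hr'] := uu' p a ap _ e30.
exists (Num.min r' (r / 2)); first by rewrite lt_min r'0.
move=> w; rewrite lt_min => /andP[wr' wr].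
have wr2 : disc a r w by rewrite /disc /=; lra.
have lip : cabs ((f w - u p w) - (f a - u p a)) <= e / 3 * cabs (w - a).
  (* [f] is not yet known to be differentiable, so the bound is proved for [u m - u p] with [m]
     large. *)
  apply/ler_addgt0Pr => eta eta0.
  have [|M hM] := uf (eta / 2); first by rewrite divr_gt0.
  pose m := maxn M N; have mM : (M <= m)%N by rewrite leq_maxl.
  have mN : (N <= m)%N by rewrite leq_maxr.
  have := @mean_value _ (fun z => u m z - u p z) (fun z => u' m z - u' p z) a (r / 2) (e / 3).
  move=> /(_ _ _ a w (disc_center _ r20) wr) mv.
  have {}mv : cabs (u m w - u p w - (u m a - u p a)) <= e / 3 * cabs (w - a).
    apply: mv => z zr; last exact: hN.
    apply: isdB; apply: uu'; move: zr; rewrite /disc /=; lra.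
  have -> : f w - u p w - (f a - u p a) =
    (u m w - u p w - (u m a - u p a)) - (u m w - f w) + (u m a - f a) by ring.
  have := hM m mM w wr2; have := hM m mM a ap.
  have := cabsD (u m w - u p w - (u m a - u p a) - (u m w - f w)) (u m a - f a).
  have := cabsB (u m w - u p w - (u m a - u p a)) (u m w - f w).
  lra.
have -> : f w - f a - d * (w - a) = (f w - u p w - (f a - u p a)) +
   (u p w - u p a - u' p a * (w - a)) + (u' p a - d) * (w - a) by ring.
apply: le_trans (cabsD _ _) _.
have := cabsD (f w - u p w - (f a - u p a)) (u p w - u p a - u' p a * (w - a)).
have := hr' w wr'.
have : cabs ((u' p a - d) * (w - a)) <= e / 3 * cabs (w - a).
  by rewrite cabsM ler_wpM2r ?cabs_ge0 // hN'.
move: lip.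
have -> : e * cabs (w - a) = e / 3 * cabs (w - a) + e / 3 * cabs (w - a)
   + e / 3 * cabs (w - a) by field.
lra.
Qed.

(* The difference quotients of f are holomorphic and converge uniformly to g,
   because Cauchy's estimate makes f and then g Lipschitz. *)
Lemma isd_derivative f g a r : 0 < r -> (forall z, disc a r z -> isd f z (g z)) ->
  exists d, isd g a d.
Proof.
move=> r0 fg; have [r1 [r10 r1r [K fK]]] : exists r1 : R, [/\ 0 < r1, r1 <= r &
    exists K : R, forall z, disc a r1 z -> cabs (f z) <= K].
  have [r1 r10 h] := isd_cts (fg a (disc_center _ r0)) ltr01.
  exists (Num.min r1 r); split; first by rewrite lt_min r10.
    by rewrite ge_min lexx orbT.
  exists (1 + cabs (f a)) => z; rewrite /disc /= lt_min => /andP[/h + _].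
  have := cabs_subD (f z) (f a); lra.
pose r2 := r1 / 2; have r20 : 0 < r2 by rewrite divr_gt0.
pose K2 := 12 * K / r2.
have gK2 z : disc a r2 z -> cabs (g z) <= K2.
  move=> zr; apply: (@cauchy_estimate _ f g z r2 K) => // w wr.
    by apply: fg; have := disc_half zr wr; rewrite /disc /=; lra.
  by apply: fK; apply: disc_half zr wr.
(* Each halving leaves room for one more estimate: [r3] admits shifts by [h], [r4] a Cauchy estimate
   for [D h], and [r5] below the mean value step. *)
pose r3 := r2 / 2; pose r4 := r3 / 2.
have r30 : 0 < r3 by rewrite divr_gt0.
have r40 : 0 < r4 by rewrite divr_gt0.
have r23 : r2 = 2 * r3 by rewrite /r3; field.
have r34 : r3 = 2 * r4 by rewrite /r4; field.
have r12 : r1 = 2 * r2 by rewrite /r2; field.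
have fg2 z : disc a r2 z -> isd f z (g z).
  by move=> zr; apply: fg; move: zr; rewrite /disc /=; lra.
pose D h z := h^-1 * (f (z + h) - f z).
pose D' h z := h^-1 * (g (z + h) - g z).
have shift h z : cabs h < r3 -> disc a r3 z -> disc a r2 (z + h).
  move=> hr; rewrite /disc /= => zr; rewrite addrAC.
  by apply: le_lt_trans (cabsD _ _) _; lra.
have DD' h z : cabs h < r3 -> disc a r3 z -> isd (D h) z (D' h z).
  move=> hr zr; apply: isdZ; apply: isdB.
    by apply: isd_shift; apply: fg2; apply: shift.
  by apply: fg2; move: zr; rewrite /disc /=; lra.
have lipf z w : disc a r2 z -> disc a r2 w -> cabs (f w - f z) <= K2 * cabs (w - z).
  exact: (mean_value fg2 gK2).
pose K3 := 12 * K2 / r4.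
have lipg h z : h != 0 -> cabs h < r3 -> disc a r4 z -> cabs (g (z + h) - g z) <= K3 * cabs h.
  move=> h0 hr zr; rewrite -ler_pdivrMr ?cabs_gt0 // -cabsV -cabsM mulrC.
  apply: (@cauchy_estimate _ (D h) (D' h)) => // w wr.
    by apply: DD' => //; apply: disc_half zr wr.
  have w3 : disc a r3 w := disc_half zr wr.
  have w2 : disc a r2 w by move: w3; rewrite /disc /=; lra.
  have := lipf w (w + h) w2 (shift _ _ hr w3).
  have -> : w + h - w = h by ring.
  by rewrite -ler_pdivrMr ?cabs_gt0 // mulrC -cabsV -cabsM.
pose r5 := r4 / 2; have r50 : 0 < r5 by rewrite divr_gt0.
have r45 : r4 = 2 * r5 by rewrite /r5; field.
have Dg h z : h != 0 -> cabs h < r5 -> disc a r5 z -> cabs (D h z - g z) <= 2 * `|K3| * cabs h.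
  move=> h0 hr zr; have ch : 0 < cabs h by rewrite cabs_gt0.
  have zhz : z + h - z = h by ring.
  (* Subtracting [g z * w] leaves the derivative [g w - g z], which [lipg] bounds by a multiple of
     [cabs h]; the radius [2 * cabs h] puts [z + h] inside the open disc. *)
  have mv := @mean_value _ (fun w => f w - g z * w) (fun w => g w - g z) z
    (Num.min r5 (2 * cabs h)) (`|K3| * (2 * cabs h)).
  have z0 : disc z (Num.min r5 (2 * cabs h)) z.
    by apply: disc_center; rewrite lt_min r50 mulr_gt0.
  have zh : disc z (Num.min r5 (2 * cabs h)) (z + h).
    by rewrite /disc /= lt_min zhz hr; lra.
  have zz w : disc z (Num.min r5 (2 * cabs h)) w -> disc z r5 w /\ cabs (w - z) < 2 * cabs h.
    by rewrite /disc /= lt_min => /andP[].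
  have {}mv : cabs (f (z + h) - g z * (z + h) - (f z - g z * z)) <= `|K3| * (2 * cabs h) * cabs (z + h - z).
    apply: mv => // w /zz[w5 wh].
      apply: isdB.
        by apply: fg2; have : disc a r4 w := disc_half zr w5; rewrite /disc /=; lra.
      by have := isdZ (g z) (isd_id w); rewrite mulr1.
    have [->|wz] := eqVneq w z.
      by rewrite subrr cabs0 !mulr_ge0 // cabs_ge0.
    have := lipg (w - z) z; rewrite subr_eq0 => /(_ wz).
    rewrite [z + (w - z)]addrC subrK => h1; apply: le_trans (h1 _ _) _.
    - by move: w5; rewrite /disc /=; lra.
    - by move: zr; rewrite /disc /=; lra.
    - apply: le_trans (ler_wpM2r (cabs_ge0 _) (ler_norm _)) _.
      by rewrite ler_wpM2l // ltW.
  rewrite -(ler_pM2r ch) -cabsM.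
  have -> : (D h z - g z) * h = f (z + h) - g z * (z + h) - (f z - g z * z).
    by rewrite /D; field.
  apply: le_trans mv _; rewrite zhz.
  by rewrite le_eqVlt; apply/orP; left; apply/eqP; ring.
pose hn n : R[i] := (r5 / 2 / n.+1%:R)%:C.
have hnE n : cabs (hn n) = r5 / 2 / n.+1%:R.
  by rewrite cabs_real gtr0_norm // !divr_gt0.
have hn0 n : hn n != 0 by rewrite -cabs_gt0 hnE !divr_gt0.
have hn5 n : cabs (hn n) < r5.
  rewrite hnE ltr_pdivrMr // ltr_pdivrMr // -mulrA ltr_pMr //.
  by rewrite -natrM ltr1n; lia.
have [||d hd _] := @weierstrass_at (fun n => D (hn n)) (fun n => D' (hn n)) g a r5 r50.
- move=> n z zr; apply: DD'; first by have := hn5 n; lra.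
  by move: zr; rewrite /disc /=; lra.
- move=> e e0.
  have [N hN] : exists N : nat, 2 * `|K3| * (r5 / 2) / e < N%:R.
    by exists (Num.truncn (2 * `|K3| * (r5 / 2) / e)).+1; apply: truncnS_gt.
  exists N => n Nn z zr; apply: le_trans (Dg _ _ (hn0 n) (hn5 n) zr) _.
  rewrite hnE mulrA ler_pdivrMr //; rewrite ltr_pdivrMr // in hN.
  apply: le_trans (ltW hN) _; rewrite mulrC ler_pM2l // ler_nat.
  by rewrite (leq_trans Nn).
by exists d.
Qed.

Lemma holomorphic_derive1 U f : open U -> holomorphic U f -> holomorphic U (derive1 f).
Proof.
move=> /open_disc oU hf z /[dup] Uz /oU[r r0 rU].
have [w /rU Uw|d /isdP[]//] := @isd_derivative f (derive1 f) z r r0.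
exact: holomorphic_isd hf Uw.
Qed.

Lemma holomorphic_derive1n U f k : open U -> holomorphic U f -> holomorphic U (derive1n k f).
Proof.
by move=> oU hf; elim: k => [//|k]; rewrite derive1nS; apply: holomorphic_derive1.
Qed.

Lemma holomorphicB U f g : holomorphic U f -> holomorphic U g ->
  holomorphic U (fun z => f z - g z).
Proof.
move=> hf hg z Uz.
by have /isdP[] := isdB (holomorphic_isd hf Uz) (holomorphic_isd hg Uz).
Qed.

Lemma eq_derive1n U f g k : open U -> (forall z, U z -> f z = g z) ->
  forall z, U z -> derive1n k f z = derive1n k g z.
Proof.
move=> oU fg; elim: k => [//|k ih] z Uz; rewrite !derive1nS !derive1E.
apply: near_eq_derive; apply: filterS (open_nbhs_nbhs (conj oU Uz)).
exact: ih.
Qed.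

Definition loc_unif U u f := forall z, U z -> exists2 r : R, 0 < r /\ disc z r `<=` U &
  forall e, 0 < e -> exists N, forall n, (N <= n)%N ->
    forall w, disc z r w -> cabs (u n w - f w) <= e.

Lemma weierstrass U u f : (forall n, holomorphic U (u n)) -> loc_unif U u f ->
  holomorphic U f /\ loc_unif U (fun n => derive1 (u n)) (derive1 f).
Proof.
move=> hu uf; have hf : holomorphic U f.
  move=> z /uf[r [r0 rU] h].
  have [|d /isdP[]//] := @weierstrass_at u (fun n => derive1 (u n)) f z r r0 _ h.
  by move=> n w /rU; apply: holomorphic_isd.
split=> // z /uf[r [r0 rU] h]; exists (r / 2).
  split; first by rewrite divr_gt0.
  by move=> w wr; apply: rU; move: wr; rewrite /disc /=; lra.
move=> e e0; have [|N hN] := h (e * r / 24); first by rewrite divr_gt0 ?mulr_gt0.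
exists N => n Nn w wr; have r20 : 0 < r / 2 by rewrite divr_gt0.
have := @cauchy_estimate _ (fun z => u n z - f z)
  (fun z => derive1 (u n) z - derive1 f z) w (r / 2) (e * r / 24) r20.
have -> : 12 * (e * r / 24) / (r / 2) = e by field; rewrite gt_eqF.
apply=> x xr; have xz := disc_half wr xr; last exact: hN.
have Ux : U x by apply: rU.
exact: isdB (holomorphic_isd (hu n) Ux) (holomorphic_isd hf Ux).
Qed.

Lemma weierstrass_derive1n U u f k : open U -> (forall n, holomorphic U (u n)) -> loc_unif U u f ->
  holomorphic U (derive1n k f) /\ loc_unif U (fun n => derive1n k (u n)) (derive1n k f).
Proof.
move=> oU hu uf; elim: k => [|k [ih1 ih2]].
  by split=> //; have [] := weierstrass hu uf.
have hk n : holomorphic U (derive1n k (u n)) := holomorphic_derive1n (k := k) oU (hu n).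
split; first by rewrite derive1nS; exact: holomorphic_derive1 oU ih1.
have -> : (fun n => derive1n k.+1 (u n)) = (fun n => derive1 (derive1n k (u n))).
  by apply/funext => n; rewrite derive1nS.
rewrite derive1nS; exact: (weierstrass hk ih2).2.
Qed.

Lemma loc_unif_tends U u f z : loc_unif U u f -> U z -> tends (fun n => u n z) (f z).
Proof.
move=> uf /uf[r [r0 _] h] e /h[N hN]; exists N => n /hN; apply.
exact: disc_center.
Qed.

End Weierstrass.

(** * Estimates for higher derivatives, the identity theorem and power series *)

Section HigherDerivatives.
Context {R : realType}.
Implicit Types (f g : R[i] -> R[i]) (u : nat -> R[i] -> R[i]).
Implicit Types (a c h z w : R[i]) (r e t q K : R) (n k : nat) (U W : set R[i]).

Lemma derive1n_derive1 f k : derive1n k (derive1 f) = derive1n k.+1 f.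
Proof. by rewrite /derive1n iterSr. Qed.

Lemma holomorphic_sub U W f : U `<=` W -> holomorphic W f -> holomorphic U f.
Proof. by move=> UW hf z /UW /hf. Qed.

Lemma derive1B U f g z : holomorphic U f -> holomorphic U g -> U z ->
  derive1 (fun w => f w - g w) z = derive1 f z - derive1 g z.
Proof.
move=> hf hg Uz.
exact: isd_derive (isdB (holomorphic_isd hf Uz) (holomorphic_isd hg Uz)).
Qed.

Lemma derive1nB U f g k z : open U -> holomorphic U f -> holomorphic U g -> U z ->
  derive1n k (fun w => f w - g w) z = derive1n k f z - derive1n k g z.
Proof.
move=> oU hf hg; elim: k z => [//|k ih] z Uz; rewrite !derive1nS.
rewrite -(derive1B (holomorphic_derive1n oU hf) (holomorphic_derive1n oU hg) Uz).
exact: (eq_derive1n 1 oU ih Uz).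
Qed.

Lemma derive1nZ U f c k z : open U -> holomorphic U f -> U z ->
  derive1n k (fun w => c * f w) z = c * derive1n k f z.
Proof.
move=> oU hf; elim: k z => [//|k ih] z Uz; rewrite !derive1nS.
rewrite -(isd_derive (isdZ c (holomorphic_isd (holomorphic_derive1n oU hf) Uz))).
exact: (eq_derive1n 1 oU ih Uz).
Qed.

(** 12 is the constant of [cauchy_estimate], and [expR 1] bounds [(1 + 1 / m) ^ m], the loss in the
    induction below. *)
Definition cauchy_const : R := 12 * expR 1.

Lemma cauchy_const_gt0 : 0 < cauchy_const.
Proof. by rewrite mulr_gt0 ?expR_gt0. Qed.

(** For order [k.+2], Cauchy's estimate bounds [f'] on the disc shrunk to radius
    [r * (k + 1) / (k + 2)], and induction applies to [f'] there. This choice of radii keeps the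
    growth geometric up to the factorial. *)
Lemma cauchy_estimate_derive1n f a r K k : 0 < r -> holomorphic (disc a r) f ->
  (forall z, disc a r z -> cabs (f z) <= K) ->
  cabs (derive1n k f a) <= K * k`!%:R * (cauchy_const / r) ^+ k.
Proof.
elim: k f r K => [|k ih] f r K r0 hf fK.
  by rewrite expr0 !mulr1; apply: fK; apply: disc_center.
have K0 : 0 <= K by apply: le_trans (cabs_ge0 _) (fK a (disc_center a r0)).
have e1 : 1 <= expR 1 :> R by have := expR_ge1Dx (1 : R); lra.
case: k ih => [_|k ih].
  rewrite derive1n1 mulr1 expr1.
  have /le_trans := @cauchy_estimate _ f (derive1 f) a r K r0 (fun z zr => holomorphic_isd hf zr) fK.
  apply; rewrite mulrA (mulrC K) ler_pM2r ?invr_gt0 // ler_wpM2r //.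
  by rewrite /cauchy_const; lra.
rewrite -derive1n_derive1.
have [m mdef] : exists m : R, m = k.+1%:R by exists (k.+1%:R).
have [m1 m1def] : exists m1 : R, m1 = k.+2%:R by exists (k.+2%:R).
have mE : m1 = m + 1 by rewrite m1def mdef -natr1.
have m0 : 0 < m by rewrite mdef ltr0n.
have m10 : 0 < m1 by rewrite m1def ltr0n.
pose r' := r * m / m1; have r'0 : 0 < r' by rewrite divr_gt0 ?mulr_gt0.
have rr' : r' + r / m1 = r by rewrite /r' mE; field; rewrite -?mE gt_eqF.
have rm0 : 0 < r / m1 by rewrite divr_gt0.
have sub : disc a r' `<=` disc a r by move=> z; rewrite /disc /=; lra.
have h1 : holomorphic (disc a r') (derive1 f).
  exact: holomorphic_sub sub (holomorphic_derive1 (disc_open a r) hf).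
have h2 z : disc a r' z -> cabs (derive1 f z) <= 12 * K / (r / m1).
  move=> zr; have zs : disc z (r / m1) `<=` disc a r.
    move=> w; rewrite /disc /= => wr; apply: le_lt_trans (cabs_dist z _ _) _.
    by move: zr; rewrite /disc /=; lra.
  apply: (@cauchy_estimate _ f (derive1 f) z (r / m1) K) => // w /zs.
    exact: holomorphic_isd hf.
  exact: fK.
apply: le_trans (ih _ _ _ r'0 h1 h2) _.
have -> : cauchy_const / r' = cauchy_const / r * (m1 / m).
  by rewrite /r'; field; rewrite !gt_eqF.
rewrite exprMn.
have pw : (m1 / m) ^+ k.+1 <= expR 1.
  have -> : m1 / m = 1 + m^-1 by rewrite mE; field; rewrite gt_eqF.
  rewrite [X in _ <= expR X](_ : 1 = k.+1%:R * m^-1); last by rewrite -mdef mulfV ?gt_eqF.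
  rewrite expRM_natl lerXn2r // ?nnegrE ?expR_ge0 //.
    by rewrite addr_ge0 // invr_ge0 ltW.
  exact: expR_ge1Dx.
have -> : 12 * K / (r / m1) * (k.+1)`!%:R * ((cauchy_const / r) ^+ k.+1 * (m1 / m) ^+ k.+1) =
   K * (k.+2)`!%:R * (cauchy_const / r) ^+ k.+1 * (12 / r) * (m1 / m) ^+ k.+1.
  by rewrite [k.+2`!]factS natrM -m1def; field; rewrite !gt_eqF.
have -> : K * (k.+2)`!%:R * (cauchy_const / r) ^+ k.+2 =
  K * (k.+2)`!%:R * (cauchy_const / r) ^+ k.+1 * (12 / r) * expR 1.
  by rewrite [in LHS]exprSr /cauchy_const; ring.
apply: ler_wpM2l pw.
have q0 : 0 <= cauchy_const / r by rewrite divr_ge0 ?ltW ?cauchy_const_gt0.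
have r0' : 0 <= 12 / r by rewrite divr_ge0 ?ltW.
by rewrite mulr_ge0 // mulr_ge0 ?exprn_ge0 // mulr_ge0.
Qed.

(** Induction through [derive1 f]: on the segment from [a] to [z] its bound is a monomial in [t],
    whose primitive is the majorant for [f]. *)
Lemma taylor_le f a r K n : 0 < r -> holomorphic (disc a r) f ->
  (forall j, (j < n)%N -> derive1n j f a = 0) ->
  (forall z, disc a r z -> cabs (derive1n n f z) <= K) ->
  forall z, disc a r z -> cabs (f z) <= K * cabs (z - a) ^+ n / n`!%:R.
Proof.
move=> r0; elim: n f => [|n ih] f hf f0 fK z zr.
  by rewrite expr0 mulr1 divr1; apply: fK.
have hf' := holomorphic_derive1 (disc_open a r) hf.
have {}ih : forall z, disc a r z -> cabs (derive1 f z) <= K * cabs (z - a) ^+ n / n`!%:R.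
  apply: ih => // [j jn|w wr]; rewrite derive1n_derive1; first exact: f0.
  exact: fK.
pose C := K * cabs (z - a) ^+ n.+1 / n`!%:R.
have := @mean_value_majorant _ f (derive1 f) a (z - a) (fun t => C * t ^+ n)
   (fun t => C / n.+1%:R * t ^+ n.+1).
have fa : f a = 0 by apply: (f0 0%N).
rewrite [a + (z - a)]addrC subrK expr1n mulr1 expr0n mulr0 subr0 fa subr0.
have <- : C / n.+1%:R = K * cabs (z - a) ^+ n.+1 / n.+1`!%:R.
  by rewrite /C factS natrM invfM -!mulrA [n`!%:R^-1 * _]mulrC.
have line t : 0 <= t <= 1 -> disc a r (a + t%:C * (z - a)).
  by apply: disc_segment => //; apply: disc_center.
apply=> [t t01|t t01|t].
- exact: holomorphic_isd hf (line t t01).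
- apply: le_trans (ler_wpM2r (cabs_ge0 _) (ih _ (line t t01))) _.
  rewrite addrC addKr cabsM cabs_real ger0_norm; last by case/andP: t01.
  by rewrite le_eqVlt /C; apply/orP; left; apply/eqP; rewrite exprMn exprS; ring.
- have h := is_deriveZ (C / n.+1%:R) (is_deriveX n.+1 (is_derive_id t (1 : R))).
  have -> : (fun t0 : R => C / n.+1%:R * t0 ^+ n.+1) = (C / n.+1%:R) \*: id ^+ n.+1.
    by apply/funext => x; rewrite /GRing.scale /= exprfctE.
  apply: (is_derive_eq h); rewrite /GRing.scale /=.
  by rewrite mulr1 mulrA divfK // pnatr_eq0.
Qed.

Lemma taylor_eq0 f a r : 0 < r -> holomorphic (disc a r) f ->
  (forall k, derive1n k f a = 0) ->
  exists2 d : R, 0 < d <= r & forall z, disc a d z -> f z = 0.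
Proof.
move=> r0 hf f0.
have [r1 r10 h1] := isd_cts (holomorphic_isd hf (disc_center a r0)) ltr01.
pose s := Num.min r r1; have s0 : 0 < s by rewrite lt_min r0.
have sr : s <= r by rewrite ge_min lexx.
have sr1 : s <= r1 by rewrite ge_min lexx orbT.
have f1 z : disc a s z -> cabs (f z) <= 1.
  move=> zs; have := h1 z; rewrite (f0 0%N : f a = 0) subr0; apply.
  by move: zs; rewrite /disc /=; lra.
pose C := cauchy_const; have C0 : 0 < C := cauchy_const_gt0.
have s20 : 0 < s / 2 by rewrite divr_gt0.
have hs : holomorphic (disc a s) f.
  by apply: holomorphic_sub hf => z; rewrite /disc /=; lra.
have hs2 : holomorphic (disc a (s / 2)) f.
  by apply: holomorphic_sub hf => z; rewrite /disc /=; lra.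
(* [s / (4 * C)] keeps the ratio [C / (s / 2) * cabs (z - a)] below 1/2, so the Taylor bound of
   every order [n] is at most [2^-1 ^+ n]. *)
pose d := Num.min (s / 2) (s / (4 * C)).
have d1 : d <= s / 2 by rewrite ge_min lexx.
have d2 : d <= s / (4 * C) by rewrite ge_min lexx orbT.
have d0 : 0 < d by rewrite lt_min s20 divr_gt0 // mulr_gt0.
exists d; first by rewrite d0; lra.
move=> z zd; apply: le0_cabs_eq => e e0.
have bnd n : cabs (f z) <= (2^-1) ^+ n.
  have := @taylor_le f a (s / 2) (n`!%:R * (C / (s / 2)) ^+ n) n s20 hs2 (fun j _ => f0 j).
  move=> /(_ _ z) tl; apply: le_trans (tl _ _) _.
  - move=> w ws; rewrite -[leRHS]mul1r mulrA; apply: cauchy_estimate_derive1n => //.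
      by apply: holomorphic_sub hs => x; apply: disc_half.
    by move=> x xs; apply: f1; apply: disc_half ws xs.
  - by move: zd; rewrite /disc /=; lra.
  have -> : n`!%:R * (C / (s / 2)) ^+ n * cabs (z - a) ^+ n / n`!%:R =
      (C / (s / 2) * cabs (z - a)) ^+ n.
    have nf : n`!%:R != 0 :> R by rewrite pnatr_eq0 -lt0n fact_gt0.
    by rewrite [RHS]exprMn; apply: (mulIf nf); rewrite divfK //; ring.
  rewrite lerXn2r // ?nnegrE ?invr_ge0 //.
    by rewrite mulr_ge0 ?cabs_ge0 // divr_ge0 ?ltW.
  rewrite [leRHS](_ : _ = C / (s / 2) * (s / (4 * C))); last by field; rewrite !gt_eqF.
  by apply: ler_wpM2l; rewrite ?divr_ge0 ?ltW //; apply: lt_le_trans d2.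
have [n hn] : exists n, (2^-1 : R) ^+ n < e.
  have [|n hn] := @geometric_lt R 2^-1 1 e _ e0; first lra.
  by exists n; have := hn n (leqnn _); rewrite mul1r.
exact: le_trans (bnd n) (ltW hn).
Qed.

(** The points where all derivatives vanish form a set that is open by [taylor_eq0] and closed in
    [W] by continuity. *)
Lemma identity_theorem W f a : open W -> connected W -> holomorphic W f -> W a ->
  (forall k, derive1n k f a = 0) -> forall z, W z -> f z = 0.
Proof.
move=> oW cW hf Wa fa; pose Z := [set z | W z /\ forall k, derive1n k f z = 0].
suff -> : W = Z by move=> z [_ /(_ 0%N)].
have oW' := (open_disc W).1 oW; symmetry; apply: cW.
- by exists a.
- have oZ : open Z.
    apply/open_disc => z [Wz fz]; have [r r0 rW] := oW' _ Wz.
    have [d /andP[d0 dr] f0] := taylor_eq0 r0 (holomorphic_sub rW hf) fz.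
    exists d => // w wd; split=> [|k].
      by apply: rW; move: wd; rewrite /disc /=; lra.
    rewrite (eq_derive1n (g := fun=> 0) k (disc_open z d) f0 wd).
    elim: k w wd => [//|k ih] w wd; rewrite derive1nS.
    apply: etrans (eq_derive1n (g := fun=> 0) 1 (disc_open z d) ih wd) _.
    exact: isd_derive (isd_cst 0 w).
  by exists Z => //; apply/seteqP; split=> [z [Wz fz]|z []].
- exists (closure Z); first exact: closed_closure.
  apply/seteqP; split=> [z [Wz fz]|z [Wz clz]]; first by split=> //; apply: subset_closure.
  split=> // k; apply: le0_cabs_eq => e e0.
  have hk := holomorphic_isd (holomorphic_derive1n (k := k) oW hf) Wz.
  have [r r0 hr] := isd_cts hk e0.
  have [w [_ /(_ k) wk] wz] := (closure_disc Z z).1 clz r r0.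
  by have := hr w wz; rewrite wk sub0r cabsN.
Qed.

Lemma isd_poly (p : {poly R[i]}) a z : isd (fun w => p.[w - a]) z (p^`()).[z - a].
Proof.
elim/poly_ind: p => [|p c ih].
  by rewrite linear0 horner0; apply: isd_near ltr01 _ (isd_cst 0 z) => w _; rewrite horner0.
rewrite derivMXaddC hornerD hornerMX.
have i1 : isd (fun w => w - a) z 1.
  by have := isdB (isd_id z) (isd_cst a z); rewrite subr0.
have := isdD (isdM ih i1) (isd_cst c z); rewrite addr0 mulr1 addrC.
by apply: isd_near ltr01 _ => w _; rewrite hornerMXaddC.
Qed.

Lemma derive1n_poly (p : {poly R[i]}) a k :
  derive1n k (fun w => p.[w - a]) = fun w => (p^`(k)).[w - a].
Proof.
elim: k => [//|k ih]; rewrite derive1nS ih; apply/funext => z.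
exact: isd_derive (isd_poly _ _ _).
Qed.

(** The partial sums are uniformly Cauchy on smaller discs. Their [k]-th derivatives at [a] are
    constant once the term of degree [k] is included, and Weierstrass' theorem transfers the value
    to the limit. *)
Lemma power_series_exists (c : nat -> R[i]) a r K : 0 < r ->
  (forall k, cabs (c k) <= K / r ^+ k) ->
  exists2 F, holomorphic (disc a r) F & forall k, derive1n k F a = k`!%:R * c k.
Proof.
move=> r0 cK; pose p n := \poly_(k < n) c k; pose S n z := (p n).[z - a].
have K0 : 0 <= K by have := cK 0%N; have := cabs_ge0 (c 0%N); rewrite expr0 divr1; lra.
have hS U n : holomorphic U (S n).
  by move=> z _; have /isdP[] := isd_poly (p n) a z.
have SS n z : S n.+1 z = S n z + c n * (z - a) ^+ n.
  by rewrite /S /p !horner_poly big_ord_recr.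
(* The geometric sum is kept as a difference, so that the induction on [m] telescopes. *)
have tail q : 0 <= q < r -> forall z, cabs (z - a) <= q -> forall n m,
    cabs (S (n + m)%N z - S n z) <= K * ((q / r) ^+ n - (q / r) ^+ (n + m)) / (1 - q / r).
  move=> /andP[q0 qr] z zq n; have x1 : q / r < 1 by rewrite ltr_pdivrMr // mul1r.
  elim=> [|m ih]; first by rewrite addn0 !subrr cabs0 mulr0 mul0r.
  rewrite addnS SS addrAC; apply: le_trans (cabsD _ _) _.
  have term : cabs (c (n + m)%N * (z - a) ^+ (n + m)) <= K * (q / r) ^+ (n + m).
    rewrite cabsM cabsX exprMn exprVn mulrA mulrAC; apply: ler_pM; rewrite ?cabs_ge0 //.
      by rewrite exprn_ge0 // cabs_ge0.
    by rewrite lerXn2r // nnegrE ?cabs_ge0.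
  apply: le_trans (lerD ih term) _; rewrite le_eqVlt; apply/orP; left; apply/eqP.
  move: (q / r) x1 => x x1; rewrite [x ^+ (n + m).+1]exprSr; field.
  by rewrite subr_eq0 gt_eqF.
have unif q : 0 <= q < r -> forall e, 0 < e -> exists N, forall n m, (N <= n)%N -> (N <= m)%N ->
    forall z, cabs (z - a) <= q -> cabs (S n z - S m z) <= e.
  move=> /[dup] q01 /andP[q0 qr] e e0; have x1 : q / r < 1 by rewrite ltr_pdivrMr // mul1r.
  have x0 : 0 <= q / r by rewrite divr_ge0 // ltW.
  have [N hN] : exists N, forall n, (N <= n)%N -> K / (1 - q / r) * (q / r) ^+ n < e.
    by apply: geometric_lt => //; rewrite x0.
  have {}hN n m z : (N <= n <= m)%N -> cabs (z - a) <= q -> cabs (S n z - S m z) <= e.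
    move=> /andP[Nn nm] zq; rewrite cabsC -(subnKC nm).
    apply: le_trans (tail _ q01 _ zq _ _) _; apply: le_trans (ltW (hN n Nn)).
    rewrite mulrAC ler_wpM2l //; first by rewrite divr_ge0 //; lra.
    by rewrite gerBl exprn_ge0.
  exists N => n m Nn Nm z zq; have [nm|/ltnW mn] := leqP n m; first by apply: hN; rewrite ?Nn.
  by rewrite cabsC; apply: hN; rewrite ?Nm.
have /choice[F hF] : forall z, exists l, disc a r z -> tends (fun n => S n z) l.
  move=> z; have [zr|nzr] := pselect (disc a r z); last by exists 0.
  have [|l hl] := @cauchy_tends _ (fun n => S n z); last by exists l.
  have zq : 0 <= cabs (z - a) < r by rewrite cabs_ge0.
  by move=> e /(unif _ zq)[N hN]; exists N => n m Nn Nm; apply: hN.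
have lu : loc_unif (disc a r) S F.
  move=> z zr; pose q := (cabs (z - a) + r) / 2.
  have zq : cabs (z - a) < q < r by move: zr; rewrite /disc /q /=; lra.
  have q01 : 0 <= q < r by have := cabs_ge0 (z - a); lra.
  have sub w : disc z (q - cabs (z - a)) w -> cabs (w - a) <= q.
    by rewrite /disc /= => wz; apply: le_trans (cabs_dist z _ _) _; lra.
  exists (q - cabs (z - a)).
    by split; [lra | move=> w /sub; rewrite /disc /=; lra].
  move=> e /(unif _ q01)[N hN]; exists N => n Nn w /sub wq.
  have wr : disc a r w by rewrite /disc /=; lra.
  rewrite cabsC; apply: (tends_le (N := N) (hF w wr)) => m Nm.
  exact: hN.
have oD := disc_open a r.
exists F => [|k]; first exact: (weierstrass (hS (disc a r)) lu).1.
have := loc_unif_tends (weierstrass_derive1n k oD (hS (disc a r)) lu).2 (disc_center a r0).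
move=> h; apply: (tends_uniq h) => e e0; exists k.+1 => n kn.
rewrite /S derive1n_poly subrr horner_coef0 coef_derivn addn0 ffactnn coef_poly kn.
by rewrite mulr_natl subrr cabs0 ltW.
Qed.

End HigherDerivatives.

(** * The space A^p *)

Section LimitsWithin.
Context {R : realType}.
Implicit Types (A : set R[i]) (f g : R[i] -> R[i]) (z w y d : R[i]) (r e : R).

Definition flim A f z y := forall e, 0 < e -> exists2 r : R, 0 < r &
  forall w, A w -> cabs (w - z) < r -> cabs (f w - y) <= e.

Lemma flim_within A f z y : flim A f z y <-> f w @[w --> within A (nbhs z)] --> y.
Proof.
split=> [h|/cvgrPdist_le h e e0].
  apply/cvgrPdist_le => -[e e'] /=; rewrite ltcE /= => /andP[/eqP -> e0].
  have [r r0 hr] := h _ e0.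
  apply/nbhs_disc; exists r => // w wr Ow.
  by rewrite norm_cabs lecR cabsC; apply: hr.
have := h e%:C; rewrite ltcR => /(_ e0) /nbhs_disc[r r0 hr].
exists r => // w Ow wr; have := hr w wr Ow.
by rewrite norm_cabs lecR cabsC.
Qed.

Lemma flim_uniq A f z y y' : closure A z -> flim A f z y -> flim A f z y' -> y = y'.
Proof.
move=> cz h h'; apply/eqP; rewrite -subr_eq0; apply/eqP/le0_cabs_eq => e e0.
have e20 : 0 < e / 2 by rewrite divr_gt0.
have [r r0 hr] := h _ e20; have [r' r'0 hr'] := h' _ e20.
have m0 : 0 < Num.min r r' by rewrite lt_min r0.
have [w Aw] := (closure_disc A z).1 cz _ m0; rewrite lt_min => /andP[wr wr'].
apply: le_trans (cabs_dist (f w) _ _) _; rewrite cabsC.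
by have := hr w Aw wr; have := hr' w Aw wr'; lra.
Qed.

Lemma flim_extension A f z y : closure A z -> flim A f z y -> extension A f z = y.
Proof.
move=> cz /flim_within; apply: cvg_lim; first exact: norm_hausdorff.
Qed.

Lemma flim_sub A B f z y : A `<=` B -> flim B f z y -> flim A f z y.
Proof. by move=> AB h e /h[r r0 hr]; exists r => // w /AB; apply: hr. Qed.

Lemma flim_eq A f g z y : (forall w, A w -> f w = g w) -> flim A f z y -> flim A g z y.
Proof. by move=> fg h e /h[r r0 hr]; exists r => // w Aw; rewrite -fg //; apply: hr. Qed.

Lemma flimD A f g z y y' : flim A f z y -> flim A g z y' ->
  flim A (fun w => f w + g w) z (y + y').
Proof.
move=> h h' e e0; have e20 : 0 < e / 2 by rewrite divr_gt0.
have [r r0 hr] := h _ e20; have [r' r'0 hr'] := h' _ e20.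
exists (Num.min r r'); first by rewrite lt_min r0.
move=> w Aw; rewrite lt_min => /andP[wr wr'].
rewrite opprD addrACA; apply: le_trans (cabsD _ _) _.
by have := hr w Aw wr; have := hr' w Aw wr'; lra.
Qed.

Lemma flimZ A c f z y : flim A f z y -> flim A (fun w => c * f w) z (c * y).
Proof.
move=> h e e0; have c0 : 0 < cabs c + 1 by have := cabs_ge0 c; lra.
have [|r r0 hr] := h (e / (cabs c + 1)); first by rewrite divr_gt0.
exists r => // w Aw /(hr w Aw) {}hr; rewrite -mulrBr cabsM.
rewrite ler_pdivlMr // mulrC in hr; apply: le_trans hr.
by rewrite ler_wpM2r ?cabs_ge0 // lerDl.
Qed.

Lemma flimB A f g z y y' : flim A f z y -> flim A g z y' ->
  flim A (fun w => f w - g w) z (y - y').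
Proof.
move=> h /(flimZ (-1)) h'; rewrite -mulN1r.
by apply: flim_eq (flimD h h') => w _; rewrite mulN1r.
Qed.

Lemma flim_isd A f z d : isd f z d -> flim A f z (f z).
Proof. by move=> hf e /(isd_cts hf)[r r0 hr]; exists r => // w _ /hr. Qed.

Lemma flim_continuous A g :
  {within A, continuous g} <-> forall z, A z -> flim A g z (g z).
Proof.
rewrite subspace_continuousP; split=> h z Az.
  by apply/flim_within; apply: h.
by apply/flim_within/h.
Qed.

Lemma flim_cauchy A f z : closure A z ->
  (forall e, 0 < e -> exists2 r : R, 0 < r & forall w w', A w -> A w' ->
     cabs (w - z) < r -> cabs (w' - z) < r -> cabs (f w - f w') <= e) ->
  exists y, flim A f z y.
Proof.
move=> cz h; have /choice[s hs] : forall n : nat, exists w, A w /\ cabs (w - z) < n.+1%:R^-1.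
  move=> n; have n0 : 0 < n.+1%:R^-1 :> R by rewrite invr_gt0.
  by have [w Aw wz] := (closure_disc A z).1 cz _ n0; exists w.
have near r : 0 < r -> exists N, forall n, (N <= n)%N -> cabs (s n - z) < r.
  move=> r0; exists (Num.truncn r^-1).+1 => n Nn; apply: lt_trans (hs n).2 _.
  rewrite invf_plt ?posrE //; apply: lt_le_trans (truncnS_gt _) _.
  by rewrite ler_nat (leq_trans Nn).
have [|y hy] := @cauchy_tends _ (fun n => f (s n)).
  move=> e /h[r r0 hr]; have [N hN] := near r r0; exists N => n m Nn Nm.
  by apply: hr; rewrite ?hN //; apply: (hs _).1.
exists y => e e0; have e20 : 0 < e / 2 by rewrite divr_gt0.
have [r r0 hr] := h _ e20; exists r => // w Aw wz.
have [N hN] := near r r0; have [M hM] := hy _ e20; pose n := maxn N M.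
apply: le_trans (cabs_dist (f (s n)) _ _) _.
have := hM n (leq_maxr _ _); have := hr w (s n) Aw (hs n).1 wz (hN n (leq_maxl _ _)); lra.
Qed.

End LimitsWithin.

Arguments Ap_holomorphic {R Omega J p} a z _.
Arguments Ap_in_A {R Omega J p} a l _.

(** * Topology, completeness and the Baire property of A^p *)

Section FunctionSpace.
Context {R : realType} (Omega J : set R[i]) (p : nat).
Implicit Types (f g : R[i] -> R[i]) (z w : R[i]) (r e K : R) (k l m n : nat).
Hypothesis oO : open Omega.
Hypothesis bO : exists B : R, forall z, Omega z -> cabs z <= B.
Hypothesis hJ : J `<=` frontier Omega.
Hypothesis hJopen : relatively_open J (frontier Omega).

Let Ap := Ap Omega J p.

Lemma J_closure z : J z -> closure Omega z.
Proof. by move=> /hJ /(frontier_open _ oO).1[]. Qed.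

Lemma OJ_closure z : (Omega `|` J) z -> closure Omega z.
Proof. by case=> [|/J_closure//]; apply: subset_closure. Qed.

Lemma in_A_flim f z : in_A Omega J f -> (Omega `|` J) z ->
  flim Omega f z (extension Omega f z).
Proof.
move=> [_ [g [/flim_continuous gc fg]]] zJ.
have gz : flim Omega f z (g z).
  apply: (flim_eq (f := g)) => [w Ow|]; first by rewrite fg // inE.
  by apply: flim_sub (gc z zJ) => w Ow; left.
by rewrite (flim_extension (OJ_closure zJ) gz).
Qed.

(** Limits at the single points suffice: the extension at a point near [z] is itself a limit of
    values in [Omega], and these are close to the value at [z]. *)
Lemma flim_in_A f : holomorphic Omega f ->
  (forall z, J z -> exists y, flim Omega f z y) -> in_A Omega J f.
Proof.
move=> hf hJf; split=> //.
have /choice[g hg] : forall z, exists y, (Omega `|` J) z -> flim Omega f z y.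
  move=> z; have [[Oz|Jz]|n] := pselect ((Omega `|` J) z); last by exists 0.
    by exists (f z) => _; apply: flim_isd (holomorphic_isd hf Oz).
  by have [y hy] := hJf z Jz; exists y.
exists g; split; last first.
  move=> z; rewrite inE => Oz; have zJ : (Omega `|` J) z by left.
  apply: flim_uniq (OJ_closure zJ) _ (hg z zJ). exact: flim_isd (holomorphic_isd hf Oz).
apply/flim_continuous => z zJ e e0; have e20 : 0 < e / 2 by rewrite divr_gt0.
have [r r0 hr] := hg z zJ _ e20; exists r => // z' z'J z'r.
have [r' r'0 hr'] := hg z' z'J _ e20.
have m0 : 0 < Num.min r' (r - cabs (z' - z)) by rewrite lt_min r'0 subr_gt0.
have [w Ow] := (closure_disc Omega z').1 (OJ_closure z'J) _ m0.
rewrite lt_min => /andP[wr' wr]; apply: le_trans (cabs_dist (f w) _ _) _.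
have := hr' w Ow wr'; rewrite cabsC.
have := hr w Ow; have := cabs_dist z' w z; lra.
Qed.

(* [Omega `&` Delta n.+1], with the distance unfolded. *)
Definition inner n z := Omega z /\
  forall w, frontier Omega w -> ~ J w -> n.+1%:R^-1 <= cabs (z - w).

Lemma DeltaE m z : Delta Omega J m z <-> (Omega `|` J) z /\
  forall w, frontier Omega w -> ~ J w -> m%:R^-1 <= cabs (z - w).
Proof.
split=> [[zJ h]|[zJ h]]; split=> //.
  move=> w fw Jw; rewrite -lee_fin; apply: le_trans h _.
  by apply: ereal_inf_lbound; exists w.
by apply: le_ereal_inf_tmp => _ [w [fw Jw] <-]; rewrite lee_fin; apply: h.
Qed.

Lemma inner_leq n m z : (n <= m)%N -> inner n z -> inner m z.
Proof.
move=> nm [Oz h]; split=> // w fw Jw; apply: le_trans (h w fw Jw).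
by rewrite lef_pV2 ?posrE // ler_nat.
Qed.

(** A point of [Omega] keeps a distance from the whole frontier, a point of [J] from the rest of the
    frontier because [J] is relatively open. *)
Lemma inner_nbhs z : (Omega `|` J) z -> exists2 r : R, 0 < r &
  exists n, forall w, Omega w -> cabs (w - z) < r -> inner n w.
Proof.
move=> zJ; have [r r0 hr] : exists2 r : R, 0 < r &
    forall w, frontier Omega w -> ~ J w -> r <= cabs (w - z).
  case: zJ => [Oz|Jz].
    have [r r0 rO] := (open_disc Omega).1 oO z Oz; exists r => // w.
    move=> /(frontier_open _ oO).1[nO _] _; rewrite leNgt; apply/negP => /rO.
    exact: nO.
  have [V oV JV] := hJopen; have [Vz _] : (V `&` frontier Omega) z by rewrite -JV.
  have [r r0 rV] := (open_disc V).1 oV z Vz; exists r => // w fw nJ.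
  by rewrite leNgt; apply/negP => /rV Vw; apply: nJ; rewrite JV.
exists (r / 2); first by rewrite divr_gt0.
exists (Num.truncn (r / 2)^-1) => w Ow wz; split=> // v fv nJ.
apply: (@le_trans _ _ (r / 2)).
  rewrite -[leRHS]invrK lef_pV2 ?posrE ?invr_gt0 ?divr_gt0 //.
  exact/ltW/truncnS_gt.
have := hr v fv nJ; have := cabs_dist w v z; rewrite (cabsC v w); lra.
Qed.

Lemma inner_disc z : Omega z -> exists2 r : R, 0 < r &
  disc z r `<=` Omega /\ exists n, disc z r `<=` inner n.
Proof.
move=> Oz; have [r r0 [n hr]] := inner_nbhs (or_introl Oz).
have [r' r'0 rO] := (open_disc Omega).1 oO z Oz.
exists (Num.min r r'); first by rewrite lt_min r0.
have sub w : disc z (Num.min r r') w -> Omega w /\ cabs (w - z) < r.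
  by rewrite /disc /= lt_min => /andP[wr /rO].
by split=> [w /sub[]//|]; exists n => w /sub[Ow]; apply: hr.
Qed.

Lemma Delta_inner n z e : 0 < e -> Delta Omega J n.+1 z ->
  exists2 w, inner n.+1 w & cabs (w - z) < e.
Proof.
(* Moving from [z] into [Omega] may bring it closer to the frontier; the slack is the difference
   between the margin of [Delta] and the smaller one of [inner n.+1]. *)
move=> e0 /DeltaE[zJ h]; pose d : R := n.+1%:R^-1 - n.+2%:R^-1.
have d0 : 0 < d by rewrite subr_gt0 ltf_pV2 ?posrE // ltr_nat.
have m0 : 0 < Num.min e d by rewrite lt_min e0.
have [w Ow] := (closure_disc Omega z).1 (OJ_closure zJ) _ m0.
rewrite lt_min => /andP[we wd]; exists w => //; split=> // v fv nJ.
move: wd (h v fv nJ) (cabs_dist w z v); rewrite /d (cabsC z w).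
by move: (n.+1%:R^-1 : R) (n.+2%:R^-1 : R) => a b; lra.
Qed.

Lemma inner_Delta n z : inner n z -> Delta Omega J n.+1 z.
Proof. by case=> Oz h; apply/DeltaE; split=> //; left. Qed.

(** Bisection of a square around [Omega]: near a point of [Omega] or [J] the function has a limit,
    and any other point has a neighbourhood free of [inner n]. *)
Lemma in_A_bounded f n : in_A Omega J f ->
  exists K, forall z, inner n z -> cabs (f z) <= K.
Proof.
move=> Af; have [B hB] := bO; pose B' := Num.max B 1.
have B'0 : 0 < B' by rewrite lt_max ltr01 orbT.
suff [K hK] : exists K, forall z,
    square (0 - B'%:C - 'i * B'%:C) (2 * B') z -> inner n z -> cabs (f z) <= K.
  exists K => z iz; apply: hK => //; apply/centered_square => /=.
  have zB : cabs z <= B' by rewrite le_max hB //; case: iz.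
  have := le_trans (Re_le_cabs z) zB; have := le_trans (Im_le_cabs z) zB.
  by rewrite !ler_norml /= => /andP[u1 u2] /andP[u3 u4]; split; apply/andP; split; lra.
pose P c s := exists K, forall z, square c s z -> inner n z -> cabs (f z) <= K.
apply: (bisection (P := P)); last by rewrite mulr_gt0.
  move=> c s s0 [K1 h1] [K2 h2] [K3 h3] [K4 h4].
  exists (Num.max (Num.max K1 K2) (Num.max K3 K4)) => z.
  move=> [/andP[u1 u2] /andP[u3 u4]] iz; rewrite !le_max.
  have [v1|/ltW v1] := leP (Re z) (Re c + s); have [v2|/ltW v2] := leP (Im z) (Im c + s).
  - by rewrite h1 //; split; apply/andP; split.
  - by rewrite h3 ?orbT //; split; rewrite !raddfD /=; apply/andP; split; lra.
  - by rewrite h2 ?orbT //; split; rewrite !raddfD /=; apply/andP; split; lra.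
  - by rewrite h4 ?orbT //; split; rewrite !raddfD /=; apply/andP; split; lra.
move=> z; have [zJ|nzJ] := pselect ((Omega `|` J) z).
  have [r r0 hr] := in_A_flim Af zJ ltr01.
  exists (r / 2); first by rewrite divr_gt0.
  move=> c s s0 sr zs; exists (1 + cabs (extension Omega f z)) => w ws [Ow _].
  have := cabs_subD (f w) (extension Omega f z).
  by have := square_diam ws zs; have := hr w Ow; lra.
have [r r0 hr] : exists2 r : R, 0 < r & forall w, inner n w -> r <= cabs (w - z).
  have [cz|ncz] := pselect (closure Omega z).
    exists n.+1%:R^-1; first by rewrite invr_gt0.
    move=> w [Ow]; apply; last by move=> Jz; apply: nzJ; right.
    by apply/(frontier_open _ oO); split=> // Oz; apply: nzJ; left.
  apply: contrapT => h; apply: ncz; apply/closure_disc => r r0.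
  apply: contrapT => h'; apply: h; exists r => // w [Ow _].
  by rewrite leNgt; apply/negP => wz; apply: h'; exists w.
exists (r / 2); first by rewrite divr_gt0.
move=> c s s0 sr zs; exists 0 => w ws iw.
by have := square_diam ws zs; have := hr w iw; lra.
Qed.

Lemma Ap_derive1n_holomorphic (h : Ap) k : holomorphic Omega (derive1n k h).
Proof. exact: holomorphic_derive1n oO (Ap_holomorphic h). Qed.
Arguments Ap_derive1n_holomorphic : clear implicits.

Lemma Ap_flim (h : Ap) l z : (l <= p)%N -> (Omega `|` J) z ->
  flim Omega (derive1n l h) z (extension Omega (derive1n l h) z).
Proof. by move=> lp; apply: in_A_flim; exact: Ap_in_A h l lp. Qed.

(** The function is cut off to 0 outside [Omega], as [Ap_out] demands; derivatives at points of the
    open set [Omega] are unaffected. *)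
Lemma Ap_exists f : holomorphic Omega f ->
  (forall l z, (l <= p)%N -> J z -> exists y, flim Omega (derive1n l f) z y) ->
  exists h : Ap, forall l z, Omega z -> derive1n l h z = derive1n l f z.
Proof.
move=> hf hJf; pose g z := if z \in Omega then f z else 0.
have gf l z : Omega z -> derive1n l g z = derive1n l f z.
  by apply: eq_derive1n => // w Ow; rewrite /g mem_set.
have hg : holomorphic Omega g.
  move=> z Oz; have [r r0 rO] := (open_disc Omega).1 oO z Oz.
  suff /isdP[] : isd g z (derive1 f z) by [].
  apply: isd_near r0 _ (holomorphic_isd hf Oz) => w /rO Ow.
  by rewrite /g mem_set.
have gA l : (l <= p)%N -> in_A Omega J (derive1n l g).
  move=> lp; apply: flim_in_A; first exact: holomorphic_derive1n oO hg.
  move=> z Jz; have [y hy] := hJf l z lp Jz; exists y.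
  by apply: flim_eq hy => w Ow; rewrite gf.
have g0 z : ~ Omega z -> g z = 0 by move=> nz; rewrite /g memNset.
by exists (MkAp hg gA g0).
Qed.

Lemma extension_derive1nB (f g : Ap) l z : (l <= p)%N -> (Omega `|` J) z ->
  extension Omega (derive1n l (fun w => g w - f w)) z =
  extension Omega (derive1n l g) z - extension Omega (derive1n l f) z.
Proof.
move=> lp zJ; apply: flim_extension (OJ_closure zJ) _.
apply: flim_eq (flimB (Ap_flim g lp zJ) (Ap_flim f lp zJ)) => w Ow.
by rewrite (derive1nB l oO (Ap_holomorphic g) (Ap_holomorphic f) Ow).
Qed.

Lemma extension_Omega (f : Ap) l z : Omega z ->
  extension Omega (derive1n l f) z = derive1n l f z.
Proof.
move=> Oz; apply: flim_extension; first exact: subset_closure.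
exact: flim_isd (holomorphic_isd (Ap_derive1n_holomorphic f l) Oz).
Qed.

Lemma extension_le (f g : Ap) l n e : (l <= p)%N -> 0 <= e ->
  (forall z, inner n.+1 z -> cabs (derive1n l g z - derive1n l f z) <= e) ->
  forall z, Delta Omega J n.+1 z ->
    cabs (extension Omega (derive1n l g) z - extension Omega (derive1n l f) z) <= e.
Proof.
move=> lp e0 h z zD; have zJ : (Omega `|` J) z by case: zD.
apply/ler_addgt0Pr => d d0.
have [r r0 hr] := flimB (Ap_flim g lp zJ) (Ap_flim f lp zJ) d0.
have [w iw wz] := Delta_inner r0 zD.
apply: le_trans (cabs_subD _ (derive1n l g w - derive1n l f w)) _.
by rewrite addrC; apply: lerD; [exact: h | rewrite cabsC; exact: hr w iw.1 wz].
Qed.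

Definition seminorm_set l m (f g : Ap) :=
  [set cabs (extension Omega (derive1n l (fun w => g w - f w)) z) | z in Delta Omega J m].

(** This makes the [sup] in [seminorm] a genuine supremum whenever [Delta] is nonempty. *)
Lemma seminorm_set_bounded l n (f g : Ap) : (l <= p)%N ->
  has_ubound (seminorm_set l n.+1 f g).
Proof.
move=> lp; have [K hK] := in_A_bounded n.+1 (Ap_in_A g l lp).
have [K' hK'] := in_A_bounded n.+1 (Ap_in_A f l lp).
exists (`|K| + `|K'|) => _ [z zD <-]; rewrite extension_derive1nB //; last by case: zD.
apply: extension_le zD => // w iw.
apply: le_trans (cabsB _ _) _; apply: lerD.
  by apply: le_trans (hK w iw) (ler_norm _).
by apply: le_trans (hK' w iw) (ler_norm _).
Qed.

Lemma le_seminorm l n (f g : Ap) z : (l <= p)%N -> Delta Omega J n.+1 z ->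
  cabs (extension Omega (derive1n l g) z - extension Omega (derive1n l f) z) <=
  seminorm Omega J l n.+1 (fun w => g w - f w).
Proof.
move=> lp zD; rewrite -extension_derive1nB //; last by case: zD.
by apply: ub_le_sup; [exact: seminorm_set_bounded | exists z].
Qed.

Lemma seminorm_le l n (f g : Ap) K : (l <= p)%N -> 0 <= K ->
  (forall z, Delta Omega J n.+1 z ->
    cabs (extension Omega (derive1n l g) z - extension Omega (derive1n l f) z) <= K) ->
  seminorm Omega J l n.+1 (fun w => g w - f w) <= K.
Proof.
move=> lp K0 h; have [[z zD]|nD] := pselect (Delta Omega J n.+1 !=set0).
  apply: ge_sup; first by exists (cabs (extension Omega (derive1n l (fun w => g w - f w)) z)), z.
  move=> _ [w wD <-]; rewrite extension_derive1nB //; first exact: h.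
  by case: wD.
(* An empty [Delta] gives [sup set0 = 0], which is where [0 <= K] enters. *)
rewrite /seminorm; have -> : Delta Omega J n.+1 = set0.
  by apply/seteqP; split=> // z zD; apply: nD; exists z.
by rewrite image_set0 sup0.
Qed.

(** One index governs both depth and tolerance, and only values in [Omega] occur. By [open_near_Ap]
    and [near_Ap_open] these relations describe the topology, so completeness and Baire's argument
    are carried out in terms of them. *)
Definition near_Ap (f g : Ap) n := forall l z, (l <= p)%N -> inner n z ->
  cabs (derive1n l g z - derive1n l f z) <= 2^-1 ^+ n.

Lemma near_Ap_refl (f : Ap) n : near_Ap f f n.
Proof. by move=> l z _ _; rewrite subrr cabs0 exprn_ge0 // invr_ge0. Qed.

Lemma near_Ap_leq (f g : Ap) n m : (n <= m)%N -> near_Ap f g m -> near_Ap f g n.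
Proof.
move=> nm h l z lp iz; apply: le_trans (h l z lp (inner_leq nm iz)) _.
by rewrite ler_wiXn2l // ?invr_ge0 //; lra.
Qed.

Lemma near_Ap_trans (f g h : Ap) n : near_Ap f g n.+1 -> near_Ap g h n.+1 -> near_Ap f h n.
Proof.
move=> fg gh l z lp iz; have iz' := inner_leq (leqnSn n) iz.
apply: le_trans (cabs_dist (derive1n l g z) _ _) _.
have -> : 2^-1 ^+ n = 2^-1 ^+ n.+1 + 2^-1 ^+ n.+1 :> R by rewrite exprS; field.
by apply: lerD; [apply: gh|apply: fg].
Qed.

Lemma near_ApP (f g : Ap) n m k l z : near_Ap f g n -> (m <= n)%N -> (k <= n)%N ->
  (l <= p)%N -> inner m z -> cabs (derive1n l g z - derive1n l f z) <= 2^-1 ^+ k.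
Proof.
move=> fg mn kn lp iz; apply: le_trans (fg l z lp (inner_leq mn iz)) _.
by rewrite ler_wiXn2l // ?invr_ge0 //; lra.
Qed.

Lemma seminorm_ge0 l n (f g : Ap) : (l <= p)%N ->
  0 <= seminorm Omega J l n.+1 (fun w => g w - f w).
Proof.
move=> lp; have [[z zD]|nD] := pselect (Delta Omega J n.+1 !=set0).
  exact: le_trans (cabs_ge0 _) (le_seminorm _ _ lp zD).
rewrite /seminorm; have -> : Delta Omega J n.+1 = set0.
  by apply/seteqP; split=> // z zD; apply: nD; exists z.
by rewrite image_set0 sup0.
Qed.

Lemma near_Ap_ball (f : Ap) (B : set Ap) : seminorm_balls B -> B f ->
  exists n, forall g : Ap, near_Ap f g n -> B g.
Proof.
case=> c [l [[|m] [e [lp // _ e0 ->]]]] /= fe.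
pose s := seminorm Omega J l m.+1 (fun w => f w - c w); have fs : s < e := fe.
have [n hn] : exists n, (2^-1 : R) ^+ n < e - s.
  have [||n hn] := @geometric_lt _ (2^-1) 1 (e - s); [lra|by rewrite subr_gt0|].
  by exists n; have := hn n (leqnn _); rewrite mul1r.
have s0 : 0 <= s by apply: seminorm_ge0.
have t0 : 0 <= 2^-1 ^+ n :> R by rewrite exprn_ge0 // invr_ge0.
exists (maxn n m.+1) => g fg; apply: (@le_lt_trans _ _ (2^-1 ^+ n + s)); last lra.
apply: seminorm_le => // [|z zD]; first by rewrite addr_ge0.
apply: le_trans (cabs_dist (extension Omega (derive1n l f) z) _ _) _.
apply: lerD; last exact: le_seminorm.
apply: extension_le zD => // w iw.
exact: near_ApP fg (leq_maxr _ _) (leq_maxl _ _) lp iw.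
Qed.

(** An open set is a union of finite intersections of seminorm balls; the indices found for the
    members of one finite family are combined by their maximum. *)
Lemma open_near_Ap (O : set Ap) (f : Ap) : open O -> O f ->
  exists n, forall g : Ap, near_Ap f g n -> O g.
Proof.
case=> D sD <- [B DB]; have [F sF eB] := sD B DB; rewrite -eB => BF.
have BF' : forall C, C \in F -> C f := BF.
have sF' : forall C, C \in F -> seminorm_balls C by move=> C CF; exact: set_mem (sF C CF).
have [n hn] : exists n, forall g : Ap, near_Ap f g n -> forall C, C \in enum_fset F -> C g.
  have : {subset enum_fset F <= F} by [].
  elim: (enum_fset F) => [|C s ih] sub; first by exists 0%N.
  have [|n hn] := ih; first by move=> C' C's; apply: sub; rewrite inE C's orbT.
  have CF : C \in F by apply: sub; rewrite inE eqxx.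
  have [m hm] := near_Ap_ball (sF' C CF) (BF' C CF).
  exists (maxn n m) => g fg C'; rewrite inE => /orP[/eqP ->|].
    by apply: hm; apply: near_Ap_leq fg; apply: leq_maxr.
  by apply: hn; apply: near_Ap_leq fg; apply: leq_maxl.
exists n => g fg; exists B => //.
by have : (\bigcap_(i in [set` F]) isSubBaseTopological.b i) g := hn g fg; rewrite eB.
Qed.

(** The balls of radius [2^-1 ^+ n] around [f] for the [p.+1] seminorms on [Delta n.+1] have their
    intersection inside the [n]-th relation, because [Delta n.+1] contains [inner n]. *)
Lemma near_Ap_open (S : set Ap) :
  (forall f : Ap, S f -> exists n, forall g : Ap, near_Ap f g n -> S g) -> open S.
Proof.
move=> h; rewrite openE => f /h[n hn]; rewrite /interior.
have ball_nbhs l : (l <= p)%N -> nbhs f (seminorm_ball f l n.+1 (2^-1 ^+ n)).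
  move=> lp; apply: open_nbhs_nbhs; split; last first.
    apply: (@le_lt_trans _ _ 0); last by rewrite exprn_gt0 // invr_gt0.
    by apply: seminorm_le => // z zD; rewrite subrr cabs0.
  pose B := seminorm_ball f l n.+1 (2^-1 ^+ n).
  exists [set B]; last by rewrite bigcup_set1.
  move=> _ ->; exists [fset B]%fset => [C /fset1P ->|].
    apply: mem_set; exists f, l, n.+1, (2^-1 ^+ n).
    by split; rewrite // exprn_gt0 // invr_gt0.
  by rewrite set_fset1 bigcap_set1.
have : \forall g \near f, forall l : 'I_p.+1, seminorm_ball f l n.+1 (2^-1 ^+ n) g.
  apply: (@filter_forall _ _ (fun l : 'I_p.+1 => seminorm_ball f l n.+1 (2^-1 ^+ n))
    _ (nbhs_filter f)).
  by move=> l; apply: ball_nbhs; rewrite -ltnS.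
apply: filterS => g hg; apply: hn => l z lp iz.
have := hg (Ordinal (lp : (l < p.+1)%N)) => /= gl.
have := le_seminorm f g lp (inner_Delta iz).
have Oz : Omega z := iz.1.
by rewrite !extension_Omega // => /le_trans; apply; apply: ltW.
Qed.

(** [k] may exceed [p]: closeness of the functions on a disc around [z] controls every derivative at
    [z] by Cauchy's estimate. *)
Lemma near_Ap_eval (f : Ap) k z e : Omega z -> 0 < e ->
  exists n, forall g : Ap, near_Ap f g n -> cabs (derive1n k g z - derive1n k f z) <= e.
Proof.
move=> Oz e0; have [r r0 [rO [m rm]]] := inner_disc Oz.
have [|n hn] := @geometric_lt _ (2^-1) (k`!%:R * (cauchy_const / r) ^+ k) e _ e0; first lra.
exists (maxn n m) => g fg.
rewrite -(derive1nB k oO (Ap_holomorphic g) (Ap_holomorphic f) Oz).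
have hB := holomorphic_sub rO (holomorphicB (Ap_holomorphic g) (Ap_holomorphic f)).
have := @cauchy_estimate_derive1n R _ z r (2^-1 ^+ n) k r0 hB _.
move=> /(_ _)/le_trans; apply=> [w wr|].
  exact: near_ApP fg (leq_maxr _ _) (leq_maxl _ _) (leq0n p) (rm _ wr).
by rewrite -mulrA mulrC; apply: ltW; apply: hn.
Qed.

(** Weierstrass' theorem gives the limit in [Omega]. Near a point of [J] the derivatives converge
    uniformly, as [Omega] is there contained in some [inner m]; hence those of the limit satisfy
    Cauchy's criterion at that point. *)
Lemma Ap_complete (u : nat -> Ap) :
  (forall n m, (n <= m)%N -> near_Ap (u n) (u m) n) ->
  exists f : Ap, forall l z, Omega z -> tends (fun n => derive1n l (u n) z) (derive1n l f z).
Proof.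
move=> near_u.
have small e : 0 < e -> exists n, forall m, (n <= m)%N -> 2^-1 ^+ m < e.
  move=> e0; have [|n hn] := @geometric_lt _ (2^-1) 1 e _ e0; first lra.
  by exists n => m /hn; rewrite mul1r.
have unif l n m k z : (l <= p)%N -> (k <= n)%N -> (k <= m)%N -> inner k z ->
    cabs (derive1n l (u n) z - derive1n l (u m) z) <= 2^-1 ^+ k.
  move=> lp; wlog nm : n m / (n <= m)%N => [hw|].
    by case/orP: (leq_total n m) => nm kn km iz; [|rewrite cabsC]; apply: hw.
  by move=> kn km iz; rewrite cabsC; apply: (near_ApP (near_u _ _ nm) kn kn lp iz).
have /choice[F hF] : forall z, exists y, Omega z -> tends (fun n => u n z) y.
  move=> z; have [Oz|nO] := pselect (Omega z); last by exists 0.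
  have [r r0 [_ [m rm]]] := inner_disc Oz.
  have [|y hy] := @cauchy_tends _ (fun n => u n z); last by exists y.
  move=> e /small[N hN]; exists (maxn N m) => a b aN bN.
  apply: le_trans (ltW (hN _ (leq_maxl N m))).
  apply: (unif 0%N) => //; apply: inner_leq (leq_maxr _ _) _.
  exact/rm/disc_center.
have lu : loc_unif Omega (fun n => u n) F.
  move=> z Oz; have [r r0 [rO [m rm]]] := inner_disc Oz; exists r => //.
  move=> e /small[N hN]; exists (maxn N m) => a aN w wr.
  rewrite cabsC; apply: (tends_le (N := maxn N m) (hF w (rO w wr))) => b bN.
  apply: le_trans (ltW (hN _ (leq_maxl N m))).
  by apply: (unif 0%N) => //; apply: inner_leq (leq_maxr _ _) (rm w wr).
have hu n : holomorphic Omega (u n) := Ap_holomorphic (u n).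
have W l := weierstrass_derive1n l oO hu lu.
have Wt l z (Oz : Omega z) := loc_unif_tends (W l).2 Oz.
have [||f hf] := @Ap_exists F.
- exact: (W 0%N).1.
- move=> l z lp Jz; have zJ : (Omega `|` J) z by right.
  apply: flim_cauchy; first exact: J_closure.
  move=> e e0; have e40 : 0 < e / 4 by rewrite divr_gt0.
  have [r r0 [m hr]] := inner_nbhs zJ.
  have [N hN] := small _ e40; pose k := maxn N m.
  have Fk w : Omega w -> cabs (w - z) < r -> cabs (derive1n l F w - derive1n l (u k) w) <= e / 4.
    move=> Ow wr; apply: (tends_le (N := k) (Wt l w Ow)) => n kn.
    apply: le_trans (ltW (hN k (leq_maxl N m))).
    by apply: unif => //; apply: inner_leq (leq_maxr _ _) (hr w Ow wr).
  have [r' r'0 hr'] := Ap_flim (u k) lp zJ e40.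
  exists (Num.min r r'); first by rewrite lt_min r0.
  move=> w w' Ow Ow'; rewrite !lt_min => /andP[wr wr'] /andP[w'r w'r'].
  set y := extension _ _ _ in hr'.
  apply: le_trans (cabs_dist (derive1n l (u k) w) _ _) _.
  have -> : e = e / 4 + (e / 4 + e / 4 + e / 4) by field.
  apply: lerD; first exact: Fk.
  apply: le_trans (cabs_dist (derive1n l (u k) w') _ _) _.
  apply: lerD; last by rewrite cabsC; apply: Fk.
  apply: le_trans (cabs_dist y _ _) _.
  by apply: lerD; [|rewrite cabsC]; apply: hr'.
by exists f => l z Oz; rewrite hf //; apply: Wt.
Qed.

(** The state of the construction is a centre with an index. Each step asks for one index more than
    the current one, so that by [near_Ap_trans] all later moves together stay within the current
    index. *)
Lemma Ap_baire (G : nat -> set Ap) :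
  (forall k (f : Ap), G k f -> exists n, forall g : Ap, near_Ap f g n -> G k g) ->
  (forall k (f : Ap) n, exists2 g : Ap, near_Ap f g n & G k g) ->
  forall (f : Ap) n, exists2 g : Ap, near_Ap f g n & forall k, G k g.
Proof.
move=> Gopen Gdense f n.
have /choice[step hstep] : forall x : nat * (Ap * nat), exists y : Ap * nat,
    [/\ near_Ap x.2.1 y.1 x.2.2.+1, (x.2.2 < y.2)%N &
        forall g : Ap, near_Ap y.1 g y.2 -> G x.1 g].
  case=> k [h m]; have [g hg Gg] := Gdense k h m.+1.
  have [m' hm'] := Gopen k g Gg; exists (g, maxn m.+1 m') => /=; split=> //.
    exact: leq_maxl.
  by move=> g' gg'; apply: hm'; apply: near_Ap_leq gg'; apply: leq_maxr.
pose s := fix s k := if k is k'.+1 then step (k', s k') else (f, n).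
(* The indices grow at least like [k], the rate that [Ap_complete] asks for. *)
have sN k : (k <= (s k).2)%N.
  by elim: k => [//|k ih]; have [_ h _] := hstep (k, s k); apply: leq_ltn_trans ih h.
have near_s k j : near_Ap (s k).1 (s (k + j)%N).1 (s k).2.
  elim: j k => [|j ih] k; first by rewrite addn0; apply: near_Ap_refl.
  have [h1 h2 _] := hstep (k, s k); rewrite -addSnnS.
  by apply: near_Ap_trans h1 _; apply: near_Ap_leq h2 (ih k.+1).
have [|g hg] := @Ap_complete (fun k => (s k).1).
  by move=> k m km; rewrite -(subnKC km); apply: near_Ap_leq (sN k) (near_s _ _).
have near_g k : near_Ap (s k).1 g (s k).2.
  move=> l z lp iz; apply: (tends_le (N := k) (hg l z iz.1)) => m km.
  by rewrite -(subnKC km); apply: near_s.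
exists g; first exact: (near_g 0%N).
by move=> k; have [_ _] := hstep (k, s k); apply; apply: (near_g k.+1).
Qed.

End FunctionSpace.

(** * Components of plane open sets *)

Section PlaneTopology.
Context {R : realType}.
Implicit Types (A B U Y : set R[i]) (f g : R[i] -> R[i]) (x y z w a b : R[i]) (r e t K : R).

Lemma connected_segment a b : connected [set a + t%:C * (b - a) | t in [set t : R | 0 <= t <= 1]].
Proof.
apply: connected_continuous_connected.
  have -> : [set t : R | 0 <= t <= 1] = `[0, 1]%classic.
    by apply/seteqP; split=> t /=; rewrite in_itv.
  exact: segment_connected.
apply: continuous_subspaceT => t; apply/cvgrPdist_le => -[e e'] /=.
rewrite ltcE /= => /andP[/eqP -> e0]; have c0 : 0 < cabs (b - a) + 1.
  by have := cabs_ge0 (b - a); lra.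
apply/nbhs_ballP; exists (e / (cabs (b - a) + 1)); first by rewrite /= divr_gt0.
move=> s; rewrite /ball /= ltr_pdivlMr // => ts; rewrite norm_cabs lecR.
have -> : a + t%:C * (b - a) - (a + s%:C * (b - a)) = (t - s)%:C * (b - a).
  by rewrite rmorphB /=; ring.
rewrite cabsM cabs_real; apply: le_trans (ltW ts).
by rewrite ler_wpM2l // lerDl.
Qed.

Lemma connected_disc a r : connected (disc a r).
Proof.
have [r0|r0] := ltP 0 r; last first.
  suff -> : disc a r = set0 by apply: connected0.
  by apply/seteqP; split=> // z; rewrite /disc /=; have := cabs_ge0 (z - a); lra.
have ar := disc_center a r0.
have -> : disc a r = \bigcup_(z in disc a r)
    [set a + t%:C * (z - a) | t in [set t : R | 0 <= t <= 1]].
  apply/seteqP; split=> [z zr|z [w wr [t t01 <-]]]; last exact: disc_segment.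
  exists z => //; exists 1; first by rewrite /= ler01 lexx.
  by rewrite rmorph1 mul1r addrC subrK.
apply: bigcup_connected => [|z _]; last exact: connected_segment.
exists a => z _; exists 0; first by rewrite /= lexx ler01.
by rewrite rmorph0 mul0r addr0.
Qed.

Lemma disc_component A x y r : connected_component A x y -> 0 < r ->
  disc y r `<=` A -> disc y r `<=` connected_component A x.
Proof.
move=> xy r0 rA; rewrite (same_connected_component xy).
by apply: connected_component_max => //; [exact: disc_center | exact: connected_disc].
Qed.

Lemma component_open A x : open A -> open (connected_component A x).
Proof.
move=> /open_disc oA; apply/open_disc => y xy.
have [r r0 rA] := oA y (connected_component_sub xy).
by exists r => //; apply: disc_component.
Qed.

Lemma disc_sub a b r s : cabs (b - a) + s <= r -> disc b s `<=` disc a r.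
Proof.
move=> h z; rewrite /disc /= => zb; apply: le_lt_trans (cabs_dist b _ _) _; lra.
Qed.

Lemma bounded_cabsP f A : [bounded f z | z in A] <-> exists K : R, forall z, A z -> cabs (f z) <= K.
Proof.
split.
  case=> -[M m] [Mreal h]; exists (M + 1) => z Az.
  have := h (M + 1)%:C; rewrite -lecR; apply=> //.
  move: Mreal; rewrite complex_real => /eqP ->.
  by rewrite ltcE /= eqxx ltrDl ltr01.
case=> K h; exists K%:C; split; first by rewrite complex_real.
by move=> [x x'] Kx z Az; apply: le_trans (ltW Kx); rewrite norm_cabs lecR; apply: h.
Qed.

(** Otherwise the component would be closed in [U] as well as open, hence all of [U], although [U]
    has a point outside [Omega]. *)
Lemma exit_point U Omega x : open U -> connected U -> open Omega ->
  (exists2 u, U u & ~ Omega u) -> (U `&` Omega) x ->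
  exists w, [/\ U w, closure (connected_component (U `&` Omega) x) w & frontier Omega w].
Proof.
move=> oU cU oO [u Uu nOu] [Ux Ox]; set Y := connected_component _ _.
have oUO : open (U `&` Omega) by apply: openI.
have oY : open Y by apply: component_open.
apply: contrapT => h; apply: nOu.
have YU : Y `<=` U by move=> z /connected_component_sub[].
have YO : Y `<=` Omega by move=> z /connected_component_sub[].
suff YUE : Y = U by apply: YO; rewrite YUE.
apply: cU; first by exists x; apply: connected_component_refl.
  by exists Y => //; apply/seteqP; split=> [z Yz|z []//]; split=> //; apply: YU.
exists (closure Y); first exact: closed_closure.
apply/seteqP; split=> [z Yz|z [Uz cz]].
  by split; [exact: YU | exact: subset_closure].
have [Oz|nOz] := pselect (Omega z); last first.
  case: h; exists z; split=> //; apply/frontier_open => //; split=> //.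
  by apply: closureS cz.
have [r r0 rUO] := (open_disc _).1 oUO z (conj Uz Oz).
have [y Yy yz] := (closure_disc Y z).1 cz r r0.
have : disc z r `<=` connected_component (U `&` Omega) y.
  by apply: connected_component_max => //; exact: connected_disc.
rewrite -(same_connected_component Yy); apply; exact: disc_center.
Qed.

Definition rat_pt (q : rat * rat) : R[i] := ratr q.1 +i* ratr q.2.

Lemma rat_pt_dense z e : 0 < e -> exists q, cabs (rat_pt q - z) < e.
Proof.
move=> e0; have h (x : R) : exists q, `|ratr q - x| < e / 2.
  have [|q] := @rat_in_itvoo R (x - e / 2) (x + e / 2); first lra.
  by rewrite in_itv /= => /andP[h1 h2]; exists q; rewrite ltr_norml; lra.
have [q1 h1] := h (Re z); have [q2 h2] := h (Im z).
exists (q1, q2); apply: le_lt_trans (cabs_le_ReIm _) _.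
rewrite !raddfB /=; lra.
Qed.

Lemma rat_pt_near Y w e : open Y -> closure Y w -> 0 < e ->
  exists q, Y (rat_pt q) /\ cabs (rat_pt q - w) < e.
Proof.
move=> oY cw e0; have [y Yy yw] := (closure_disc Y w).1 cw e e0.
have [r r0 rY] := (open_disc Y).1 oY y Yy.
have m0 : 0 < Num.min r (e - cabs (y - w)) by rewrite lt_min r0 subr_gt0.
have [q] := rat_pt_dense y m0; rewrite lt_min => /andP[q1 q2].
exists q; split; first exact: rY.
by apply: le_lt_trans (cabs_dist y _ _) _; lra.
Qed.

Definition meets_frontier Omega z r :=
  Omega z /\ exists2 w, frontier Omega w & cabs (w - z) < r.

Definition disc_comp Omega z r := connected_component (disc z r `&` Omega) z.

Lemma disc_comp_exit Omega z r : open Omega -> meets_frontier Omega z r ->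
  exists w, [/\ disc z r w, closure (disc_comp Omega z r) w & frontier Omega w].
Proof.
move=> oO [Oz [w fw wr]]; have r0 : 0 < r := le_lt_trans (cabs_ge0 _) wr.
apply: exit_point => //; [exact: disc_open | exact: connected_disc | | ].
  by exists w => //; case/(frontier_open _ oO): fw.
by split=> //; apply: disc_center.
Qed.

Lemma component_sub A B x y : A `<=` B -> A y -> connected_component B x y ->
  connected_component A y `<=` connected_component B x.
Proof.
move=> AB Ay xy; rewrite (same_connected_component xy).
apply: connected_component_max; [exact: connected_component_refl| |exact: component_connected].
by apply: subset_trans AB; apply: connected_component_sub.
Qed.

(** Components are traded for those through rational centres, a countable family. In both directions
    the given component comes close, by [exit_point], to a frontier point [w] inside its disc, and
    so contains a component of a smaller disc that contains [w]. *)
Lemma totally_unboundedP Omega g : open Omega ->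
  totally_unbounded Omega g <->
  forall q (r : rat), meets_frontier Omega (rat_pt q) (ratr r) ->
    forall K, exists2 z, disc_comp Omega (rat_pt q) (ratr r) z & K < cabs (g z).
Proof.
move=> oO; split=> [h q r mf K|h zeta e Y fz e0].
  have [w [wr cw fw]] := disc_comp_exit oO mf.
  have [s s0 sr] := (open_disc _).1 (disc_open _ _) w wr.
  have [y Yy yw] := (closure_disc _ w).1 cw s s0.
  have [yr Oy] := connected_component_sub Yy.
  apply: contrapT => nh; apply: (h w s (connected_component (disc w s `&` Omega) y) fw s0).
    by rewrite (ball_disc w s); exists y.
  apply/bounded_cabsP; exists K => z Yz; rewrite leNgt; apply/negP => Kz; apply: nh.
  exists z => //; apply: component_sub Yy _ Yz => //; exact: setSI.
rewrite (ball_disc zeta e) => -[x [xe Ox] YE] /bounded_cabsP[K hK].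
have [nOz _] := (frontier_open _ oO).1 fz.
have [|w [we cw fw]] := @exit_point (disc zeta e) Omega x (disc_open _ _) (@connected_disc _ _) oO _ (conj xe Ox).
  by exists zeta => //; apply: disc_center.
have oY : open Y by rewrite YE; apply: component_open; apply: openI => //; apply: disc_open.
have [s s0 se] := (open_disc _).1 (disc_open _ _) w we.
have s40 : 0 < s / 4 by rewrite divr_gt0.
rewrite -YE in cw; have [q [Yq qw]] := rat_pt_near oY cw s40.
(* With these bounds the disc about the rational point contains [w] and lies in the disc of radius
   [s] about [w]. *)
have [|r] := @rat_in_itvoo R (s / 4) (s / 2); first lra.
rewrite in_itv /= => /andP[r1 r2].
have Oq : Omega (rat_pt q) by move: Yq; rewrite YE => /connected_component_sub[].
have [|z Wz] := h q r _ K; first by split=> //; exists w => //; rewrite cabsC; lra.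
rewrite ltNge => /negP; apply; apply: hK; rewrite YE.
apply: (component_sub (A := disc (rat_pt q) (ratr r) `&` Omega)) Wz.
- apply: setSI => v vq; apply: se; apply: disc_sub vq; lra.
- by split=> //; apply: disc_center; lra.
- by rewrite -YE.
Qed.

End PlaneTopology.

(** * Singular functions *)

Section PrincipalSquareRoot.
Context {R : realType}.
Implicit Types (z w b s : R[i]) (t r e : R).

Definition psqrt z : R[i] := if 0 <= Re (sqrtc z) then sqrtc z else - sqrtc z.

Lemma sqr_psqrt z : psqrt z ^+ 2 = z.
Proof. by rewrite /psqrt; case: ifP => _; rewrite ?sqrrN sqr_sqrtc. Qed.

Lemma Re_psqrt_ge0 z : 0 <= Re (psqrt z).
Proof.
rewrite /psqrt; case: ifP => // /negbT; rewrite -ltNge raddfN /= => h.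
by rewrite oppr_ge0 ltW.
Qed.

Lemma Re_psqrt_gt0 z : (forall t, 0 <= t -> z <> - t%:C) -> 0 < Re (psqrt z).
Proof.
move=> h; rewrite lt_def Re_psqrt_ge0 andbT; apply/eqP => R0.
apply: (h (Im (psqrt z) ^+ 2)); first exact: sqr_ge0.
rewrite -[LHS]sqr_psqrt; case: (psqrt z) R0 => a b /= ->.
by rewrite expr2; simpc; rewrite expr2.
Qed.

Lemma cabs_psqrt z : cabs (psqrt z) ^+ 2 = cabs z.
Proof. by rewrite -cabsX sqr_psqrt. Qed.

(** Both roots have nonnegative real part, so [v + s] cannot cancel: its real part is at least
    [Re s], and [v - s = (w - z) / (v + s)] is of order [w - z]. The remainder is exactly
    [- (v - s) ^ 2 / (2 * s)]. *)
Lemma isd_psqrt z : 0 < Re (psqrt z) -> isd psqrt z (2 * psqrt z)^-1.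
Proof.
set s := psqrt z => s0 e e0; pose m := Re s.
have ms : m <= cabs s by apply: le_trans (ler_norm _) (Re_le_cabs _).
have sn0 : s != 0 by rewrite -cabs_gt0; apply: lt_le_trans ms.
exists (e * (2 * m) * m ^+ 2); first by rewrite !mulr_gt0 ?exprn_gt0.
move=> w wz; set v := psqrt w.
have vs : (v - s) * (v + s) = w - z by rewrite -subr_sqr !sqr_psqrt.
have le : cabs (v - s) * m <= cabs (w - z).
  rewrite -vs cabsM ler_wpM2l ?cabs_ge0 //.
  apply: le_trans (le_trans (ler_norm _) (Re_le_cabs _)); rewrite raddfD /= /m.
  by rewrite lerDr Re_psqrt_ge0.
have -> : v - s - (2 * s)^-1 * (w - z) = - ((v - s) ^+ 2 / (2 * s)).
  by rewrite -vs; field.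
rewrite cabsN cabsM cabsX cabsV cabsM cabs_nat ler_pdivrMr; last first.
  by rewrite mulr_gt0 // (lt_le_trans s0).
apply: (@le_trans _ _ (e * cabs (w - z) * (2 * m))); last first.
  apply: ler_wpM2l; last by rewrite ler_pM2l.
  by rewrite mulr_ge0 ?cabs_ge0 ?ltW.
have m2 : 0 < m ^+ 2 by rewrite exprn_gt0.
rewrite -(ler_pM2r m2) -exprMn.
apply: (@le_trans _ _ (cabs (w - z) * cabs (w - z))).
  by rewrite expr2 ler_pM ?mulr_ge0 ?cabs_ge0 // ltW.
rewrite -!mulrA [leRHS]mulrCA ler_wpM2l ?cabs_ge0 //.
by apply: le_trans (ltW wz) _; rewrite !mulrA.
Qed.

End PrincipalSquareRoot.

(** * Functions whose derivative of order [p.+1] is singular at a frontier point *)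

Section SingularFunctions.
Context {R : realType}.
Implicit Types (f g : R[i] -> R[i]) (U : set R[i]) (z w b s d : R[i]) (t r e K : R).
Implicit Types (l n p : nat).

Lemma isd_derivable f z d : isd f z d -> derivable f z 1.
Proof. by case/isdP. Qed.

Lemma isdX f z d n : isd f z d -> isd (fun w => f w ^+ n.+1) z (n.+1%:R * f z ^+ n * d).
Proof.
move=> hf; elim: n => [|n ih].
  rewrite mulr1 mul1r; apply: isd_near ltr01 _ hf => w _; by rewrite expr1.
have := isdM hf ih; have -> : d * f z ^+ n.+1 + f z * (n.+1%:R * f z ^+ n * d) =
   n.+2%:R * f z ^+ n.+1 * d by rewrite -[in RHS]natr1 exprS; ring.
by apply: isd_near ltr01 _ => w _; rewrite -exprS.
Qed.

Lemma derive1n_sequence U (F : nat -> R[i] -> R[i]) : open U ->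
  (forall l z, U z -> isd (F l) z (F l.+1 z)) ->
  forall l z, U z -> derive1n l (F 0%N) z = F l z.
Proof.
move=> oU hF; elim=> [//|l ih] z Uz; rewrite derive1nS.
apply: etrans (eq_derive1n (g := F l) 1 oU ih Uz) _.
exact: isd_derive (hF l z Uz).
Qed.

Definition inv_deriv w l z : R[i] := (-1) ^+ l * l`!%:R * (z - w)^-1 ^+ l.+1.

Lemma isd_inv_deriv w l z : z != w -> isd (inv_deriv w l) z (inv_deriv w l.+1 z).
Proof.
rewrite -subr_eq0 => zw.
have i1 := isd_comp (isdB (isd_id z) (isd_cst w z)) (isd_inv zw).
have := isdZ ((-1) ^+ l * l`!%:R) (isdX l i1).
have -> // : (-1) ^+ l * l`!%:R * (l.+1%:R * (z - w)^-1 ^+ l * (- (z - w) ^- 2 * (1 - 0)))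
   = inv_deriv w l.+1 z.
rewrite /inv_deriv factS natrM subr0 mulr1 -exprVn; move: (z - w)^-1 => v.
by rewrite !exprS expr0; ring.
Qed.

Section SlitRoot.
Variables (w b : R[i]) (p : nat).
Hypothesis wb : w != b.

(* Holomorphic off the segment from w to b, where the Moebius quotient avoids
   the negative half line. *)
Definition slit_root z := psqrt ((z - w) / (z - b)).

(** For the root [s] one has [1 - s ^ 2 = (w - b) / (z - b)], whence [s' = k * (1 - s ^ 2) ^ 2 / s].
    This equation involves [s] alone, so all derivatives are polynomials in [s] up to a power of
    [s]. *)
Let k : R[i] := (2 * (w - b))^-1.

(* [slit_root ^+ (2 * p).+1] has l-th derivative
   [slit_root ^+ (2 * p).+1 / slit_root ^+ (2 * l) * (slit_poly l).[slit_root]]. *)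
Fixpoint slit_poly l : {poly R[i]} :=
  if l is n.+1 then
    k%:P * (1 - 'X ^+ 2) ^+ 2 *
    (((2 * p).+1%:R - (2 * n)%:R)%:P * slit_poly n + 'X * (slit_poly n)^`())
  else 1.

Lemma slit_polyS l s : (slit_poly l.+1).[s] = k * (1 - s ^+ 2) ^+ 2 *
  (((2 * p).+1%:R - (2 * l)%:R) * (slit_poly l).[s] + s * (slit_poly l)^`().[s]).
Proof.
by rewrite /= !(hornerM, hornerD, hornerN, hornerC, hornerX, horner_exp).
Qed.

(** The power is written as a quotient because its exponent [2 p + 1 - 2 l] is negative for
    [l > p]. *)
Definition slit_deriv l z : R[i] :=
  slit_root z ^+ (2 * p).+1 * (slit_root z ^+ (2 * l))^-1 * (slit_poly l).[slit_root z].

Lemma slit_root_Re z : z != w -> ~ segment_oc w b z -> z != b /\ 0 < Re (slit_root z).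
Proof.
move=> zw nseg; have zb : z != b.
  apply/eqP => zb; apply: nseg; exists 1; first by rewrite /= ltr01 lexx.
  by rewrite rmorph1 mul1r addrC subrK zb.
split=> //; apply: Re_psqrt_gt0 => t t0 h; apply: nseg.
have zb0 : z - b != 0 by rewrite subr_eq0.
have E : z - w = - t%:C * (z - b) by rewrite -h divfK.
have t1 : 1 + t != 0 by rewrite gt_eqF //; lra.
have t1C : 1 + t%:C != 0 :> R[i].
  by rewrite -(rmorph1 (real_complex R)) -rmorphD fmorph_eq0.
(* [(z - w) / (z - b) = - t] solves to [z = (w + t * b) / (1 + t)], the point of the segment with
   this parameter. *)
exists (t / (1 + t)).
  have t00 : 0 < t.
    rewrite lt_def t0 andbT; apply: contra_neq zw => t00.
    by apply/eqP; rewrite -subr_eq0 E t00 rmorph0 oppr0 mul0r.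
  by rewrite /= divr_gt0 ?ler_pdivrMr //=; lra.
rewrite rmorphM fmorphV rmorphD rmorph1 /=; apply: (mulfI t1C).
transitivity (w + t%:C * b); first by field.
by apply/eqP; rewrite -subr_eq0; apply/eqP; transitivity (- (z - w) - t%:C * (z - b));
  [ring | rewrite E; ring].
Qed.

Lemma sqr_slit_root z : z != b -> 1 - slit_root z ^+ 2 = (w - b) / (z - b).
Proof. by rewrite -subr_eq0 => zb; rewrite sqr_psqrt; field. Qed.

Lemma isd_slit_root z : z != b -> 0 < Re (slit_root z) ->
  isd slit_root z (k * (1 - slit_root z ^+ 2) ^+ 2 / slit_root z).
Proof.
move=> zb Rs; rewrite sqr_slit_root //.
have zb0 : z - b != 0 by rewrite subr_eq0.
have wb0 : w - b != 0 by rewrite subr_eq0.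
have s0 : slit_root z != 0 by apply: contraTneq Rs => ->; rewrite ltxx.
have i1 := isd_comp (isdB (isd_id z) (isd_cst b z)) (isd_inv zb0).
have i2 := isdM (isdB (isd_id z) (isd_cst w z)) i1.
have := isd_comp i2 (isd_psqrt Rs); rewrite -/(slit_root z).
set D := (X in isd _ _ X -> _); have -> // : D = k * ((w - b) / (z - b)) ^+ 2 / slit_root z.
by rewrite /D /k; field; rewrite ?zb0 ?wb0 ?s0.
Qed.

(** By the equation for [s'], differentiation lowers the exponent of [s] by 2 and acts on the
    polynomial factor as the recursion of [slit_poly]. *)
Lemma isd_slit_deriv l z : z != b -> 0 < Re (slit_root z) ->
  isd (slit_deriv l) z (slit_deriv l.+1 z).
Proof.
move=> zb Rs; have s0 : slit_root z != 0 by apply: contraTneq Rs => ->; rewrite ltxx.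
have di := isd_slit_root zb Rs.
have i1 := isdX (2 * p) di.
have s2 : slit_root z ^+ (2 * l) != 0 by rewrite expf_neq0.
have i2 : isd (fun z => slit_root z ^+ (2 * l)) z
    ((2 * l)%:R * slit_root z ^+ (2 * l) / slit_root z * (k * (1 - slit_root z ^+ 2) ^+ 2 / slit_root z)).
  case: (2 * l)%N => [|n].
    by rewrite !mul0r; apply: isd_near ltr01 _ (isd_cst 1 z).
  have -> : n.+1%:R * slit_root z ^+ n.+1 / slit_root z = n.+1%:R * slit_root z ^+ n.
    by rewrite exprSr mulrA mulfK.
  exact: isdX n di.
have i3 := isd_comp i2 (isd_inv s2).
have i4 := isd_comp di (isd_poly (slit_poly l) 0 (slit_root z)).
have := isdM (isdM i1 i3) i4.
set D := (X in isd _ _ X -> _); have -> : D = slit_deriv l.+1 z.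
  rewrite /D /slit_deriv slit_polyS subr0 mulnS exprD [_ ^+ (2 * p).+1]exprS.
  move: (slit_poly l).[_] (slit_poly l)^`().[_] (slit_root z ^+ (2 * p)) => q q' Y.
  move: s2 s0 ((2 * l)%:R : R[i]) ((2 * p).+1%:R : R[i]).
  move: (slit_root z ^+ (2 * l)) (slit_root z) k => X s k' X0 s0 N M.
  by field; rewrite X0.
by apply: isd_near ltr01 _ => y _; rewrite subr0.
Qed.

(** At 0 the recursion multiplies by [k * (2 p + 1 - 2 l)], nonzero by parity. *)
Lemma slit_poly0 l : (slit_poly l).[0] != 0.
Proof.
elim: l => [|l ih]; first by rewrite hornerE oner_neq0.
rewrite slit_polyS mul0r expr0n /= subr0 expr1n mulr1 addr0.
rewrite !mulf_neq0 // ?invr_eq0 ?mulf_neq0 ?pnatr_eq0 ?subr_eq0 //.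
by rewrite eqr_nat; lia.
Qed.

Lemma slit_root_small e : 0 < e ->
  exists2 r : R, 0 < r & forall z, cabs (z - w) < r -> cabs (slit_root z) < e.
Proof.
move=> e0; have c0 : 0 < cabs (w - b) by rewrite cabs_gt0 subr_eq0.
exists (Num.min (cabs (w - b) / 2) (e ^+ 2 * (cabs (w - b) / 2))).
  by rewrite lt_min divr_gt0 // mulr_gt0 ?exprn_gt0 ?divr_gt0.
move=> z; rewrite lt_min => /andP[z1 z2].
have zb : cabs (w - b) / 2 <= cabs (z - b).
  by have := cabs_dist z w b; rewrite (cabsC w z); lra.
rewrite -(ltr_pXn2r (n := 2)) ?nnegrE ?cabs_ge0 ?ltW // cabs_psqrt cabsM cabsV.
rewrite ltr_pdivrMr; last by apply: lt_le_trans zb; rewrite divr_gt0.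
by apply: lt_le_trans z2 _; rewrite ler_pM2l // exprn_gt0.
Qed.

Lemma poly_slit_root_lim (P : {poly R[i]}) e : 0 < e ->
  exists2 r : R, 0 < r &
    forall z, cabs (z - w) < r -> cabs (P.[slit_root z] - P.[0]) <= e.
Proof.
move=> e0; have := isd_poly P 0 0; rewrite subr0 => dP.
have [r r0 hr] := isd_cts dP e0; have [d d0 hd] := slit_root_small r0.
exists d => // z /hd; move: (slit_root z) => s sr.
by have := hr s; rewrite !subr0; apply.
Qed.

(** A positive power of the root remains for [l <= p], so the derivative is a polynomial in a
    quantity tending to 0; the limit is in fact 0. *)
Lemma slit_deriv_lim l e : (l <= p)%N -> 0 < e ->
  exists2 r : R, 0 < r & forall z, slit_root z != 0 -> cabs (z - w) < r ->
    cabs (slit_deriv l z - ('X ^+ (2 * (p - l)).+1 * slit_poly l).[0]) <= e.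
Proof.
move=> lp /(poly_slit_root_lim ('X ^+ (2 * (p - l)).+1 * slit_poly l))[r r0 hr].
exists r => // z s0 /hr; congr (cabs (_ - _) <= e).
rewrite hornerM hornerXn /slit_deriv; congr (_ * _).
have -> : ((2 * p).+1 = (2 * (p - l)).+1 + 2 * l)%N by lia.
by rewrite exprD mulfK // expf_neq0.
Qed.

(** At order [p.+1] the remaining power of the root is exactly its inverse, and the polynomial
    factor tends to a nonzero value. *)
Lemma slit_deriv_unbounded K : exists2 r : R, 0 < r &
  forall z, slit_root z != 0 -> cabs (z - w) < r -> K < cabs (slit_deriv p.+1 z).
Proof.
have := slit_poly0 p.+1; rewrite /slit_deriv; move: (slit_poly p.+1) => Q Q0.
have Q20 : 0 < cabs Q.[0] / 2 by rewrite divr_gt0 // cabs_gt0.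
have [r r0 hr] := poly_slit_root_lim Q Q20.
have K0 : 0 < `|K| + 1 by have := normr_ge0 K; lra.
have [|d d0 hd] := @slit_root_small (cabs Q.[0] / 2 / (`|K| + 1)).
  by rewrite divr_gt0.
exists (Num.min r d) => [|z]; first by rewrite lt_min r0.
move=> + ; rewrite lt_min => s0 /andP[/hr + /hd]; move: s0.
move: (slit_root z) => s s0 zr; rewrite ltr_pdivlMr // => zd.
have sz : 0 < cabs s by rewrite cabs_gt0.
have -> : s ^+ (2 * p).+1 / s ^+ (2 * p.+1) = s^-1.
  by rewrite mulnS exprD !exprS expr0; field; rewrite s0 expf_neq0.
rewrite mulrC cabsM cabsV ltr_pdivlMr //.
apply: (@le_lt_trans _ _ (cabs s * (`|K| + 1))).
  by rewrite mulrC ler_pM2l //; have := ler_norm K; lra.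
by apply: lt_le_trans zd _; have := cabs_subD Q.[0] Q.[s]; rewrite cabsC; lra.
Qed.

End SlitRoot.

End SingularFunctions.

(** * Generic functions *)

Section GenericSets.
Context {R : realType} (Omega J : set R[i]) (p : nat).
Implicit Types (f g : R[i] -> R[i]) (z w : R[i]) (r e K : R) (k l m n : nat).
Hypothesis oO : open Omega.
Hypothesis bO : exists B : R, forall z, Omega z -> cabs z <= B.
Hypothesis hJ : J `<=` frontier Omega.
Hypothesis hJopen : relatively_open J (frontier Omega).
Hypothesis hseg : forall alpha, J alpha ->
  exists2 beta, (~` closure Omega) beta &
    segment_oc alpha beta `<=` ~` closure Omega.

Let Ap := Ap Omega J p.

(** Growth along all of [Omega] rather than mere unboundedness, so that one function serves every
    component whose closure contains [w]. *)
Definition blows_up (h : Ap) w := forall K, exists2 r : R, 0 < r &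
  forall z, Omega z -> cabs (z - w) < r -> K < cabs (derive1n p.+1 h z).

Lemma frontier_neq w z : frontier Omega w -> Omega z -> z != w.
Proof. by move=> /(frontier_open _ oO).1[nw _] Oz; apply/eqP => zw; apply: nw; rewrite -zw. Qed.

Lemma blows_up_off_J w : frontier Omega w -> ~ J w -> exists h : Ap, blows_up h w.
Proof.
move=> fw nJ; pose F := inv_deriv w.
have hF l z : Omega z -> isd (F l) z (F l.+1 z).
  by move=> Oz; apply/isd_inv_deriv/frontier_neq.
have dF := derive1n_sequence oO hF.
have holF : holomorphic Omega (F 0%N) := fun z Oz => isd_derivable (hF 0%N z Oz).
have [l z lp Jz|h hh] := @Ap_exists R Omega J p oO hJ (F 0%N) holF.
  exists (F l z); apply: (flim_eq (f := F l)) => [v Ov|]; first by rewrite dF.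
  by apply: flim_isd; apply: isd_inv_deriv; apply/eqP => zw; apply: nJ; rewrite -zw.
exists h => K; have K0 : 0 < `|K| + 1 by have := normr_ge0 K; lra.
exists (`|K| + 1)^-1 => [|z Oz zr]; first by rewrite invr_gt0.
have zw : 0 < cabs (z - w) by rewrite cabs_gt0 subr_eq0 frontier_neq.
rewrite hh // dF // /F /inv_deriv cabsM (cabsX _ p.+2) cabsM cabsX cabsN cabs1 expr1n mul1r cabs_nat cabsV.
have {zr} : `|K| + 1 < (cabs (z - w))^-1.
  by rewrite -[ltLHS]invrK ltf_pV2 ?posrE ?invr_gt0.
(* As [v >= 1], the power and the factorial can only enlarge the bound. *)
move: (cabs (z - w))^-1 => v Kv; have v1 : 1 <= v by have := normr_ge0 K; lra.
apply: (@lt_le_trans _ _ v); first by have := ler_norm K; lra.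
apply: (@le_trans _ _ (v ^+ p.+2)); first by rewrite exprS ler_peMr ?exprn_ege1 //; lra.
by rewrite ler_peMl ?exprn_ge0 ?ler1n ?fact_gt0 //; lra.
Qed.

(** Points of [J] other than [w] lie in the closure of [Omega], hence off the segment, and there the
    root is differentiable; only at [w] itself is [slit_deriv_lim] called for. *)
Lemma blows_up_on_J w : J w -> exists h : Ap, blows_up h w.
Proof.
move=> Jw; have [b nb seg] := hseg Jw.
have fw := hJ Jw; have cw : closure Omega w := J_closure oO hJ Jw.
have wb : w != b by apply/eqP => wb; apply: nb; rewrite -wb.
pose F := slit_deriv w b p.
have good z : closure Omega z -> z != w -> z != b /\ 0 < Re (slit_root w b z).
  by move=> cz zw; apply: slit_root_Re zw _ => /seg.
have goodO z : Omega z -> z != b /\ 0 < Re (slit_root w b z).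
  by move=> Oz; apply: good; [exact: subset_closure | exact: frontier_neq].
have hF l z : Omega z -> isd (F l) z (F l.+1 z).
  by move=> /goodO[zb Rs]; apply: isd_slit_deriv.
have dF := derive1n_sequence oO hF.
have holF : holomorphic Omega (F 0%N) := fun z Oz => isd_derivable (hF 0%N z Oz).
have sn0 z : Omega z -> slit_root w b z != 0.
  by move=> /goodO[_ Rs]; apply: contraTneq Rs => ->; rewrite ltxx.
have [l z lp Jz|h hh] := @Ap_exists R Omega J p oO hJ (F 0%N) holF.
  have [->|zw] := eqVneq z w; last first.
    exists (F l z); apply: (flim_eq (f := F l)) => [v Ov|]; first exact/esym/dF.
    have [zb Rs] := good z (J_closure oO hJ Jz) zw.
    exact: (flim_isd Omega (isd_slit_deriv p wb l zb Rs)).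
  eexists => e e0; have [r r0 hr] := slit_deriv_lim wb lp e0.
  exists r; first exact: r0.
  by move=> v Ov; rewrite (dF l v Ov); apply: hr; apply: sn0.
exists h => K; have [r r0 hr] := slit_deriv_unbounded p wb K.
exists r; first exact: r0.
by move=> z Oz; rewrite (hh _ z Oz) (dF _ z Oz); apply: hr; apply: sn0.
Qed.

Lemma blows_up_exists w : frontier Omega w -> exists h : Ap, blows_up h w.
Proof.
by move=> fw; have [Jw|nJ] := pselect (J w); [exact: blows_up_on_J | exact: blows_up_off_J].
Qed.

Lemma Ap_add_exists (f h : Ap) (c : R[i]) : exists g : Ap, forall l z, Omega z ->
  derive1n l g z = derive1n l f z + c * derive1n l h z.
Proof.
have D l z : Omega z -> derive1n l (fun w => f w - (- c) * h w) z =
    derive1n l f z + c * derive1n l h z.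
  move=> Oz; have hh : holomorphic Omega (fun w => - c * h w).
    exact: (fun v Ov => isd_derivable (isdZ (- c) (holomorphic_isd (Ap_holomorphic h) Ov))).
  rewrite (derive1nB l oO (Ap_holomorphic f) hh Oz).
  by rewrite (derive1nZ (- c) l oO (Ap_holomorphic h) Oz) mulNr opprK.
have hol : holomorphic Omega (fun w => f w - (- c) * h w).
  exact: (fun v Ov => isd_derivable (isdB (holomorphic_isd (Ap_holomorphic f) Ov)
    (isdZ (- c) (holomorphic_isd (Ap_holomorphic h) Ov)))).
have [l z lp Jz|g hg] := @Ap_exists R Omega J p oO hJ _ hol.
  have zJ : (Omega `|` J) z by right.
  have lim := flimD (Ap_flim oO hJ f lp zJ) (flimZ c (Ap_flim oO hJ h lp zJ)).
  by eexists; apply: flim_eq lim => v Ov; rewrite D.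
by exists g => l z Oz; rewrite hg // D.
Qed.

(** [t] lists centre, radius and bound. The condition is void when the centre is outside [Omega] or
    the disc misses the frontier, so all tuples may serve as indices. *)
Definition unbounded_set (t : (rat * rat) * (rat * nat)) : set Ap :=
  [set f : Ap | meets_frontier Omega (rat_pt t.1) (ratr t.2.1) ->
    exists2 z, disc_comp Omega (rat_pt t.1) (ratr t.2.1) z &
      t.2.2%:R < cabs (derive1n p.+1 f z)].

(** When the disc meets the frontier, failure of the condition bounds the Taylor coefficients at the
    centre so that the series converges in the disc. *)
Definition unextendable_set (t : (rat * rat) * (rat * nat)) : set Ap :=
  [set f : Ap | meets_frontier Omega (rat_pt t.1) (ratr t.2.1) ->
    exists k, t.2.2%:R * k`!%:R / ratr t.2.1 ^+ k < cabs (derive1n k f (rat_pt t.1))].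

Lemma disc_comp_Omega z r : disc_comp Omega z r `<=` Omega.
Proof. by move=> w /connected_component_sub[]. Qed.

Lemma large_derivative_near (f : Ap) k z K : Omega z -> K < cabs (derive1n k f z) ->
  exists n, forall g : Ap, near_Ap f g n -> K < cabs (derive1n k g z).
Proof.
move=> Oz Kf; have e0 : 0 < (cabs (derive1n k f z) - K) / 2 by rewrite divr_gt0 // subr_gt0.
have [n hn] := near_Ap_eval oO hJopen f k Oz e0; exists n => g /hn.
by have := cabs_subD (derive1n k f z) (derive1n k g z); rewrite cabsC; lra.
Qed.

Lemma unbounded_set_near t (f : Ap) : unbounded_set t f ->
  exists n, forall g : Ap, near_Ap f g n -> unbounded_set t g.
Proof.
move=> h; have [mf|nmf] := pselect (meets_frontier Omega (rat_pt t.1) (ratr t.2.1)).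
  have [z Wz Kz] := h mf.
  have [n hn] := large_derivative_near (disc_comp_Omega Wz) Kz.
  by exists n => g fg _; exists z; [exact: Wz | exact: (hn g fg)].
by exists 0%N => g _ /nmf.
Qed.

Lemma unextendable_set_near t (f : Ap) : unextendable_set t f ->
  exists n, forall g : Ap, near_Ap f g n -> unextendable_set t g.
Proof.
move=> h; have [mf|nmf] := pselect (meets_frontier Omega (rat_pt t.1) (ratr t.2.1)).
  have [k Kk] := h mf; have [n hn] := large_derivative_near mf.1 Kk.
  by exists n => g fg _; exists k; exact: (hn g fg).
by exists 0%N => g _ /nmf.
Qed.

Lemma cabs_perturbation (u v : R[i]) (c K : R) : 0 < c -> cabs u <= K ->
  2 * K / c < cabs v -> K < cabs (u + c%:C * v).
Proof.
move=> c0 uK; rewrite ltr_pdivrMr // mulrC => Kv.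
have := cabsB (u + c%:C * v) u; rewrite addrAC subrr add0r cabsM cabs_real gtr0_norm //.
lra.
Qed.

(** If [f] fails, its derivative of order [p.+1] is bounded on the component; a small multiple of a
    function blowing up at a frontier point in the closure of the component destroys the bound. *)
Lemma unbounded_set_dense t (f : Ap) n : exists2 g : Ap, near_Ap f g n & unbounded_set t g.
Proof.
have [uf|nuf] := pselect (unbounded_set t f); first by exists f => //; apply: near_Ap_refl.
have [mf nW] : meets_frontier Omega (rat_pt t.1) (ratr t.2.1) /\
    forall z, disc_comp Omega (rat_pt t.1) (ratr t.2.1) z ->
      cabs (derive1n p.+1 f z) <= t.2.2%:R.
  move: nuf => /not_implyP[mf nW]; split=> // z Wz.
  by rewrite leNgt; apply/negP => h; apply: nW; exists z.
have [w [_ cw fw]] := disc_comp_exit oO mf; have [h hh] := blows_up_exists fw.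
have [K hK] : exists K, forall l z, (l <= p)%N -> inner Omega J n z -> cabs (derive1n l h z) <= K.
  have /choice[B hB] : forall l, exists B, (l <= p)%N ->
      forall z, inner Omega J n z -> cabs (derive1n l h z) <= B.
    move=> l; have [lp|nlp] := pselect (l <= p)%N; last by exists 0.
    by have [B hB] := in_A_bounded oO bO hJ n (Ap_in_A h l lp); exists B.
  exists (\sum_(l < p.+1) `|B l|) => l z lp iz.
  apply: le_trans (hB l lp z iz) _; apply: le_trans (ler_norm _) _.
  rewrite (bigD1 (Ordinal (lp : (l < p.+1)%N))) //= lerDl.
  by apply: sumr_ge0 => i _.
(* On [inner n] the derivatives of [c * h] up to order [p] stay below [2^-1 ^+ n]. *)
pose c : R := 2^-1 ^+ n / (`|K| + 1).
have K0 : 0 < `|K| + 1 by have := normr_ge0 K; lra.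
have c0 : 0 < c by rewrite divr_gt0 // exprn_gt0 // invr_gt0.
have [g hg] := Ap_add_exists f h c%:C; exists g => [l z lp iz|_].
  rewrite hg; last by case: iz.
  rewrite addrAC subrr add0r cabsM cabs_real gtr0_norm // mulrAC ler_pdivrMr //.
  rewrite ler_pM2l ?exprn_gt0 ?invr_gt0 //; apply: le_trans (hK l z lp iz) _.
  by have := ler_norm K; lra.
(* The factor 2 pays once for the derivative of [f] and once for exceeding the bound. *)
have [r r0 hr] := hh (2 * t.2.2%:R / c).
have [z Wz zr] := (closure_disc _ w).1 cw r r0; exists z; first exact: Wz.
rewrite (hg _ z (disc_comp_Omega Wz)).
exact: cabs_perturbation c0 (nW z Wz) (hr z (disc_comp_Omega Wz) zr).
Qed.

Lemma totally_unbounded_bigcap :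
  [set f : Ap | totally_unbounded Omega (derive1n p.+1 f)] =
  \bigcap_(t in [set: (rat * rat) * (rat * nat)]) unbounded_set t.
Proof.
apply/seteqP; split=> [f /(totally_unboundedP _ oO) h [q [r m]] _ mf|f h].
  exact: h mf m%:R.
apply/(totally_unboundedP _ oO) => q r mf K.
have [z Wz hz] := h (q, (r, (Num.truncn `|K|).+1)) I mf; exists z => //.
apply: le_lt_trans hz; apply: le_trans (ler_norm K) _; exact/ltW/truncnS_gt.
Qed.

(* Recognising extendable functions by their Taylor coefficients makes them an
   F_sigma set without any appeal to normal families. *)
Lemma extendableP (f : Ap) : extendable Omega f <->
  exists q (r : rat) (m : nat), meets_frontier Omega (rat_pt q) (ratr r) /\
    forall k, cabs (derive1n k f (rat_pt q)) <= m%:R * k`!%:R / ratr r ^+ k.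
Proof.
split; last first.
  move=> [q [r [m [mf hk]]]]; set z := rat_pt q in mf hk; have [Oz [w fw wr]] := mf.
  have r0 : 0 < ratr r :> R := le_lt_trans (cabs_ge0 _) wr.
  have kf k : (k`!%:R : R[i]) != 0 by rewrite pnatr_eq0 -lt0n fact_gt0.
  (* The Taylor series of [f] at [z] converges in the whole disc, which contains a frontier
     point. *)
  have [|F hF dF] := @power_series_exists R (fun k => derive1n k f z / k`!%:R) z (ratr r) m%:R r0.
    move=> k; rewrite cabsM cabsV cabs_nat ler_pdivrMr ?ltr0n ?fact_gt0 //.
    by apply: le_trans (hk k) _; rewrite mulrAC.
  have oD := disc_open z (ratr r : R).
  exists (disc z (ratr r)), F; split; last split=> //.
    by split; [exists z; exact: disc_center|exact: connected_disc|exact: oD|exists w].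
  exists (disc_comp Omega z (ratr r)).
    by exists z => //; split=> //; apply: disc_center.
  have oW : open (disc_comp Omega z (ratr r)) by apply: component_open; apply: openI.
  have Wz : disc_comp Omega z (ratr r) z.
    by apply: connected_component_refl; split=> //; apply: disc_center.
  have hf : holomorphic (disc_comp Omega z (ratr r)) f.
    exact: holomorphic_sub (@disc_comp_Omega z _) (Ap_holomorphic f).
  have hF' : holomorphic (disc_comp Omega z (ratr r)) F.
    by apply: holomorphic_sub hF => v /connected_component_sub[].
  move=> v; rewrite inE => Wv; apply/eqP; rewrite -subr_eq0; apply/eqP.
  apply: (identity_theorem oW (@component_connected _ _ _) (holomorphicB hf hF') Wz) Wv.
  move=> k; rewrite (derive1nB k oW hf hF' Wz) dF mulrCA mulfV // mulr1 subrr //.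
move=> [U [F [[[u0 Uu0] cU oU [u [fu Uu]]] [hF [Y [x Ux YE] fF]]]]].
have [nOu _] := (frontier_open _ oO).1 fu.
have [|w [Uw cw fw]] := exit_point oU cU oO _ Ux; first by exists u.
rewrite -YE in cw; have oY : open Y by rewrite YE; apply: component_open; apply: openI.
have YO : Y `<=` Omega by rewrite YE => z /connected_component_sub[].
have [r r0 rU] := (open_disc U).1 oU w Uw.
have [r' r'0 hr'] := isd_cts (holomorphic_isd hF Uw) ltr01.
pose s := Num.min r r'; have s0 : 0 < s by rewrite lt_min r0.
pose K := 1 + cabs (F w).
have FK z : disc w s z -> cabs (F z) <= K.
  rewrite /disc /= lt_min => /andP[_ /hr']; have := cabs_subD (F z) (F w); rewrite /K; lra.
have sU : disc w s `<=` U by move=> z; rewrite /disc /= lt_min => /andP[/rU].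
pose C : R := cauchy_const; have C1 : 1 <= C.
  by rewrite /C /cauchy_const; have := expR_ge1Dx (1 : R); lra.
(* The estimate on discs of radius [s / 2] bounds the Taylor coefficients of [F] by multiples of
   [d ^ -k]. A centre within [d / 2] of [w] and a radius between [d / 2] and [d] respect this bound
   and still reach [w]. *)
pose d := s / 2 / C; have d0 : 0 < d by rewrite !divr_gt0 //; lra.
have ds : d <= s / 2 by rewrite ler_pdivrMr ?ler_peMr //; lra.
have d20 : 0 < d / 2 by rewrite divr_gt0.
have [q [Yq qw]] := rat_pt_near oY cw d20; set z := rat_pt q in Yq qw.
have [|t] := @rat_in_itvoo R (d / 2) d; first lra.
rewrite in_itv /= => /andP[t1 t2].
exists q, t, (Num.truncn K).+1; split.
  by split; [exact: YO | exists w => //; rewrite cabsC; lra].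
move=> k; rewrite -/z.
have -> : derive1n k f z = derive1n k F z.
  by apply: (eq_derive1n k oY _ Yq) => v Yv; apply: fF; rewrite inE.
have sub : disc z (s / 2) `<=` disc w s by apply: disc_sub; lra.
have s20 : 0 < s / 2 by rewrite divr_gt0.
have hFz : holomorphic (disc z (s / 2)) F.
  by apply: holomorphic_sub hF => v /sub/sU.
apply: le_trans (cauchy_estimate_derive1n k s20 hFz (fun v vz => FK v (sub v vz))) _.
have K0 : 0 <= K by rewrite addr_ge0 // cabs_ge0.
have t0 : 0 < ratr t :> R by lra.
have Xd : cauchy_const / (s / 2) = d^-1 :> R by rewrite /d -/C [in RHS]invfM invrK mulrC.
rewrite Xd -exprVn; apply: ler_pM.
- by rewrite mulr_ge0.
- by rewrite exprn_ge0 // invr_ge0 ltW.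
- by rewrite ler_wpM2r //; apply/ltW/truncnS_gt.
- by rewrite lerXn2r ?nnegrE ?invr_ge0 ?(ltW d0) ?(ltW t0) // lef_pV2 ?posrE // ltW.
Qed.

Lemma nonextendable_bigcap : [set f : Ap | ~ extendable Omega f] =
  \bigcap_(t in [set: (rat * rat) * (rat * nat)]) unextendable_set t.
Proof.
apply/seteqP; split=> [f nf [q [r m]] _ mf|f h].
  apply: contrapT => /forallNP nk; apply: nf; apply/extendableP; exists q, r, m.
  by split=> // k; rewrite leNgt; apply/negP.
move=> /extendableP[q [r [m [mf hk]]]].
by have [k] := h (q, (r, m)) I mf; rewrite ltNge hk.
Qed.

(** The component reaches a frontier point [w] inside [U]. There the derivative of [F] is
    continuous, hence bounded nearby, and it agrees with that of [f] on a component of a small disc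
    about [w]. *)
Lemma totally_unbounded_nonextendable (f : Ap) :
  totally_unbounded Omega (derive1n p.+1 f) -> ~ extendable Omega f.
Proof.
move=> tu [U [F [[[u0 Uu0] cU oU [u [fu Uu]]] [hF [Y [x Ux YE] fF]]]]].
have [nOu _] := (frontier_open _ oO).1 fu.
have [|w [Uw cw fw]] := exit_point oU cU oO _ Ux; first by exists u.
rewrite -YE in cw; have oY : open Y by rewrite YE; apply: component_open; apply: openI.
have [r r0 rU] := (open_disc U).1 oU w Uw.
have [r' r'0 hr'] := isd_cts (holomorphic_isd (holomorphic_derive1n (k := p.+1) oU hF) Uw) ltr01.
pose s := Num.min r r'; have s0 : 0 < s by rewrite lt_min r0.
have [y Yy yw] := (closure_disc Y w).1 cw s s0.
have Oy : Omega y by move: Yy; rewrite YE => /connected_component_sub[].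
have sub : disc w s `&` Omega `<=` U `&` Omega.
  by apply: setSI => v; rewrite /disc /= lt_min => /andP[/rU].
apply: (tu w s (connected_component (disc w s `&` Omega) y) fw s0).
  by rewrite (ball_disc w s); exists y.
apply/bounded_cabsP; exists (1 + cabs (derive1n p.+1 F w)) => z Wz.
have Yz : Y z.
  by rewrite YE; apply: component_sub Wz => //; rewrite -?YE.
rewrite (eq_derive1n (g := F) p.+1 oY) //; last by move=> v Yv; apply: fF; rewrite inE.
have [+ _] := connected_component_sub Wz; rewrite /disc /= lt_min => /andP[_ /hr'].
move=> Fz; exact: le_trans (cabs_subD _ _) (lerD Fz (lexx _)).
Qed.

Lemma Gdelta_near_bigcap (G : (rat * rat) * (rat * nat) -> set Ap) :
  (forall t (f : Ap), G t f -> exists n, forall g : Ap, near_Ap f g n -> G t g) ->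
  Gdelta (\bigcap_(t in [set: (rat * rat) * (rat * nat)]) G t).
Proof.
(* Numbers that decode to no index contribute the whole space. *)
move=> Gnear; exists (fun n => if choice.unpickle n is Some t then G t else classical_sets.setT).
  move=> n; case: (choice.unpickle n) => [t|] /=; last exact: openT.
  by apply: (near_Ap_open oO bO hJ) => f /Gnear.
apply/seteqP; split=> [f h n _|f h t _].
  by case: (choice.unpickle n) => [t|] //=; apply: h.
by have := h (choice.pickle t) I; rewrite choice.pickleK.
Qed.

Lemma totally_unbounded_dense :
  dense [set f : Ap | totally_unbounded Omega (derive1n p.+1 f)].
Proof.
move=> O [f Of] oOpen; have [n hn] := open_near_Ap oO bO hJ oOpen Of.
have [k h|k h m|g fg hg] := @Ap_baire R Omega J p oO hJ hJopen
    (fun k => if choice.unpickle k is Some t then unbounded_set t else classical_sets.setT) _ _ f n.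
- case: (choice.unpickle k) => [t /unbounded_set_near//|_ /=]; by exists 0%N.
- case: (choice.unpickle k) => [t|] /=; first exact: unbounded_set_dense.
  by exists h => //; apply: near_Ap_refl.
- exists g; split; first exact: hn.
  rewrite totally_unbounded_bigcap => t _.
  by have := hg (choice.pickle t); rewrite choice.pickleK.
Qed.

End GenericSets.

(** * Openness and boundedness of Jordan domains *)

Section JordanDomains.
Context {R : realType}.
Implicit Types (Omega : set R[i]).

(** Compactness of the circle by bisection: small squares around a point off the circle contain none
    of its points, and near a point of the circle the curve keeps a distance from [z] by
    continuity. *)
Lemma Jordan_curve_closed (gamma : set R[i]) : Jordan_curve gamma -> open (~` gamma).
Proof.
case=> g [/flim_continuous cg _ ->]; apply/open_disc => z nz.
have [rho rho0 hrho] : exists2 rho : R, 0 < rho & forall u,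
    square (0 - 1%:C - 'i * 1%:C) (2 * 1) u -> unit_circle u -> rho <= cabs (g u - z).
  pose P c s := exists2 rho : R, 0 < rho & forall u, square c s u ->
    unit_circle u -> rho <= cabs (g u - z).
  apply: (bisection (P := P)); last by rewrite mulr1.
    move=> c s s0 [r1 p1 h1] [r2 p2 h2] [r3 p3 h3] [r4 p4 h4].
    exists (Num.min (Num.min r1 r2) (Num.min r3 r4)); first by rewrite !lt_min p1 p2 p3.
    move=> u [/andP[u1 u2] /andP[u3 u4]] cu; rewrite !ge_min.
    have [v1|/ltW v1] := leP (Re u) (Re c + s); have [v2|/ltW v2] := leP (Im u) (Im c + s).
    - by rewrite h1 //; split; apply/andP; split.
    - by rewrite h3 ?orbT //; split; rewrite !raddfD /=; apply/andP; split; lra.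
    - by rewrite h2 ?orbT //; split; rewrite !raddfD /=; apply/andP; split; lra.
    - by rewrite h4 ?orbT //; split; rewrite !raddfD /=; apply/andP; split; lra.
  move=> v; have [cv|ncv] := pselect (unit_circle v).
    have gv : 0 < cabs (g v - z) / 2.
      rewrite divr_gt0 // cabs_gt0 subr_eq0; apply/eqP => gvz; apply: nz.
      by exists v.
    have [r r0 hr] := cg v cv _ gv; exists (r / 2); first by rewrite divr_gt0.
    move=> c s s0 sr vs; exists (cabs (g v - z) / 2) => // u us cu.
    have := hr u cu; have := square_diam us vs.
    have := cabs_dist (g u) (g v) z; rewrite (cabsC (g v) (g u)); lra.
  have d0 : 0 < `|1 - cabs v|.
    by rewrite normr_gt0 subr_eq0; apply/eqP => cv; apply: ncv.
  exists (`|1 - cabs v| / 2); first by rewrite divr_gt0.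
  move=> c s s0 sr vs; exists 1 => // u us cu.
  have := square_diam us vs; have := cabs_subD u v; have := cabs_subD v u.
  rewrite (cabsC v u) cu; move: sr; case: (ger0P (1 - cabs v)); lra.
exists rho => // y yz [u cu gu].
suff sq : square (0 - 1%:C - 'i * 1%:C) (2 * 1) u.
  by have := hrho u sq cu; rewrite gu leNgt (yz : cabs (y - z) < rho).
apply/centered_square => /=.
have u1 : cabs u <= 1 by rewrite cu.
have := le_trans (Re_le_cabs u) u1; have := le_trans (Im_le_cabs u) u1.
by rewrite !ler_norml => /andP[? ?] /andP[? ?]; split; apply/andP; split; lra.
Qed.

Lemma Jordan_domain_open Omega : Jordan_domain Omega -> open Omega.
Proof.
by case=> gamma /Jordan_curve_closed og [[x nx ->] _]; apply: component_open.
Qed.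

Lemma Jordan_domain_bounded Omega : Jordan_domain Omega ->
  exists B : R, forall z, Omega z -> cabs z <= B.
Proof. by case=> gamma _ [_ /bounded_cabsP]. Qed.

End JordanDomains.

Theorem theorem4p1 (R : realType) (p : nat) (Omega J : set R[i])
  (hOmega : Jordan_domain Omega)
  (hJ : J `<=` frontier Omega)
  (hJopen : relatively_open J (frontier Omega))
  (hseg : forall alpha, J alpha ->
     exists2 beta, (~` closure Omega) beta &
       segment_oc alpha beta `<=` ~` closure Omega) :
  (dense [set f : Ap Omega J p | totally_unbounded Omega (derive1n p.+1 f)] /\
   Gdelta [set f : Ap Omega J p | totally_unbounded Omega (derive1n p.+1 f)]) /\
  (Gdelta [set f : Ap Omega J p | ~ extendable Omega f] /\
   dense [set f : Ap Omega J p | ~ extendable Omega f]).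
Proof.
have oO := Jordan_domain_open hOmega; have bO := Jordan_domain_bounded hOmega.
have dense_tu := @totally_unbounded_dense R Omega J p oO bO hJ hJopen hseg.
split; [split=> //|split].
- rewrite totally_unbounded_bigcap //; apply: (Gdelta_near_bigcap oO bO hJ).
  exact: unbounded_set_near.
- rewrite nonextendable_bigcap //; apply: (Gdelta_near_bigcap oO bO hJ).
  exact: unextendable_set_near.
- move=> O O0 oOpen; have [f [Of tu]] := dense_tu O O0 oOpen.
  by exists f; split=> //; apply: totally_unbounded_nonextendable tu.
Qed.
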